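(* Let $(M,g,e_0)$ be a Sasakian $\eta$-Einstein 3-manifold, let $\alpha$ be the 1-form metrically dual to $e_0$, let $R$ be the (constant) scalar curvature, and let $W=\tfrac14(R+2)$. Then around every point there are local coordinates in which $g$ and $\alpha$ take the following form. If $W>0$, in coordinates $(\rho,\theta,\phi)$ with $0<\theta<\pi$: $$g=\frac{1}{2W}\left[d\theta^2+\sin^2\theta\,d\phi^2+\frac{2}{W}(d\rho+\cos\theta\,d\phi)^2\right],\qquad \alpha=\frac1W(d\rho+\cos\theta\,d\phi).$$ If $W=0$, in coordinates $(r,u,v)$: $$g=\left[dr+2v\,du\right]^2+du^2+dv^2,\qquad \alpha=dr+2v\,du.$$ If $W<0$, in coordinates $(\rho,\theta,\phi)$ with $\theta>0$: $$g=-\frac{1}{2W}\left[d\theta^2+\sinh^2\theta\,d\phi^2-\frac{2}{W}(d\rho+\cosh\theta\,d\phi)^2\right],\qquad \alpha=\frac1W(d\rho+\cosh\theta\,d\phi).$$ Conversely, for each real constant $W$ the corresponding formula defines a Sasakian $\eta$-Einstein structure with scalar curvature $R=4W-2$.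
   Context: Let $\nabla$ be the Levi-Civita connection and $R(X,Y)Z=\nabla_X\nabla_YZ-\nabla_Y\nabla_XZ-\nabla_{[X,Y]}Z$. A Riemannian manifold $(M,g)$ is Sasakian if there exists a unit length Killing vector field $e_0$ on $M$ such that $R(X,e_0)Y=g(e_0,Y)X-g(X,Y)e_0$ for all vector fields $X,Y$ on $M$. A Sasakian structure is $\eta$-Einstein if there exist constants $a,b$ such that the Ricci tensor satisfies $R_{ij}=a\,g_{ij}+b\,\eta_i\eta_j$, where $\eta$ is the 1-form metrically dual to the unit Killing vector $e_0$ (so $\eta=\alpha$); in dimension 3 the scalar curvature is then the constant $R=3a+b$. The quantity $W=\tfrac14(R+2)$ is the Tanaka-Webster curvature. The scalar curvature is normalized so that the unit round 3-sphere has $R=6$. *)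

(* Defs.v *)
From mathcomp Require Import all_boot all_order all_algebra.
From mathcomp Require Import ring.
From mathcomp Require Import all_classical all_reals all_analysis.
Set Implicit Arguments.
Unset Strict Implicit.
Unset Printing Implicit Defensive.

Import Order.TTheory GRing.Theory Num.Theory numFieldNormedType.Exports.
Local Open Scope classical_set_scope.
Local Open Scope ring_scope.

(** * Tensor calculus on open subsets of R^3

  Points, vectors and covectors of R^3 are row vectors; the components are
  numbered 0, 1, 2.  All the operators below are local: on an open set [U]
  they depend only on the values of their arguments on [U]. *)

Section LocalCalculus.
Context {R : realType}.
Notation space := 'rV[R]_3.

Definition dx (i : 'I_3) : space := delta_mx 0 i.

Definition partial (i : 'I_3) (f : space -> R) (x : space) : R :=
  'D_(dx i) f x.

Fixpoint C_k (k : nat) (U : set space) (f : space -> R) : Prop :=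
  match k with
  | 0 => forall x, U x -> {for x, continuous f}
  | k'.+1 => (forall x, U x -> differentiable f x) /\
             (forall i, C_k k' U (partial i f))
  end.

Definition smooth (U : set space) (f : space -> R) : Prop :=
  forall k, C_k k U f.

Definition smooth_map (U : set space) (F : space -> space) : Prop :=
  forall j, smooth U (fun x => F x 0 j).

(* A metric is given by its Gram matrix: g(v, w) = v *m g x *m w^T. *)
Definition inner (g : space -> 'M[R]_3) (X Y : space -> space) (x : space) : R :=
  (X x *m g x *m (Y x)^T) 0 0.

Definition is_metric (U : set space) (g : space -> 'M[R]_3) : Prop :=
  [/\ forall i j, smooth U (fun x => g x i j),
      forall x, U x -> (g x)^T = g x &
      forall x (v : space), U x -> v != 0 -> 0 < (v *m g x *m v^T) 0 0].

(* The vector field X acting on functions as a derivation. *)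
Definition act (X : space -> space) (f : space -> R) (x : space) : R :=
  \sum_i X x 0 i * partial i f x.

Definition bracket (X Y : space -> space) (x : space) : space :=
  \row_k (act X (fun y => Y y 0 k) x - act Y (fun y => X y 0 k) x).

(* christoffel g i j k is Gamma^k_{ij}. *)
Definition christoffel (g : space -> 'M[R]_3) (i j k : 'I_3) (x : space) : R :=
  2^-1 * \sum_l invmx (g x) k l *
    (partial i (fun y => g y j l) x + partial j (fun y => g y i l) x
     - partial l (fun y => g y i j) x).

(* The Levi-Civita covariant derivative nabla_X Y. *)
Definition nabla (g : space -> 'M[R]_3) (X Y : space -> space) (x : space) :
    space :=
  \row_k (act X (fun y => Y y 0 k) x
          + \sum_i \sum_j X x 0 i * Y x 0 j * christoffel g i j k x).

Lemma smooth_differentiable U (f : space -> R) x :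
  smooth U f -> U x -> differentiable f x.
Proof. by move=> /(_ 1) [+ _]; exact. Qed.

Lemma act_sum3 X (F : 'I_3 -> space -> R) x :
  (forall i, differentiable (F i) x) ->
  act X (fun y => \sum_i F i y) x = \sum_i act X (F i) x.
Proof.
move=> dF; rewrite /act exchange_big /=; apply: eq_bigr => k _.
rewrite -mulr_sumr; congr (_ * _); rewrite /partial -fct_sumE.
by rewrite derive_sum// => i; exact: diff_derivable.
Qed.

Lemma actM X (f h : space -> R) x :
  differentiable f x -> differentiable h x ->
  act X (fun y => f y * h y) x = act X f x * h x + f x * act X h x.
Proof.
move=> df dh; rewrite /act mulr_suml mulr_sumr -big_split /=.
apply: eq_bigr => k _; rewrite /partial.
rewrite (_ : (fun y => f y * h y) = f * h)//.
rewrite deriveM; [|exact: diff_derivable|exact: diff_derivable].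
by rewrite /GRing.scale/=; ring.
Qed.

Lemma is_metric_unit U g x : is_metric U g -> U x -> g x \in unitmx.
Proof.
move=> [_ _ gpos] Ux; rewrite -row_free_unit -kermx_eq0.
apply/eqP/row_matrixP => i; rewrite row0; apply/eqP; apply/negPn/negP => v0.
have := gpos x _ Ux v0; suff -> : row i (kermx (g x)) *m g x = 0.
  by rewrite mul0mx mxE ltxx.
by rewrite -row_mul mulmx_ker row0.
Qed.

(* Lemmas nabla_torsion_free and nabla_metric below characterize nabla as the
   Levi-Civita connection. *)
Lemma partial_metric_sym U g i j l x : open U -> is_metric U g -> U x ->
  partial l (fun y => g y i j) x = partial l (fun y => g y j i) x.
Proof.
move=> oU [_ gsym _] Ux; apply: near_eq_derive.
have : nbhs x U by exact: open_nbhs_nbhs.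
by apply: filterS => y /gsym {1}<-; rewrite mxE.
Qed.

Lemma nabla_torsion_free U g X Y x : open U -> is_metric U g -> U x ->
  nabla g X Y x - nabla g Y X x = bracket X Y x.
Proof.
move=> oU gm Ux; apply/rowP => k; rewrite !mxE.
have symG i j : christoffel g i j k x = christoffel g j i k x.
  rewrite /christoffel; congr (_ * _); apply: eq_bigr => l _; congr (_ * _).
  rewrite (partial_metric_sym i j l oU gm Ux).
  by congr (_ - _); rewrite addrC.
set A := \sum_i _; set B := \sum_i _; suff -> : A = B.
  by rewrite opprD addrACA subrr addr0.
rewrite /A /B exchange_big /=; apply: eq_bigr => i _; apply: eq_bigr => j _.
by rewrite symG [X x 0 j * _]mulrC.
Qed.

Lemma christoffel_lower U g i j k x : open U -> is_metric U g -> U x ->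
  \sum_m g x j m * christoffel g k i m x =
  2^-1 * (partial k (fun y => g y i j) x + partial i (fun y => g y k j) x
          - partial j (fun y => g y k i) x).
Proof.
move=> oU gm Ux.
pose D := \col_l (partial k (fun y => g y i l) x + partial i (fun y => g y k l) x
          - partial l (fun y => g y k i) x).
have : g x *m (invmx (g x) *m D) = D by rewrite mulKVmx// (is_metric_unit gm).
move/matrixP/(_ j 0); rewrite !mxE => <-; rewrite mulr_sumr.
apply: eq_bigr => m _; rewrite mxE /christoffel mulrCA; congr (_ * (_ * _)).
by apply: eq_bigr => l _; rewrite !mxE.
Qed.

Lemma innerE g X Y x :
  inner g X Y x = \sum_i \sum_j X x 0 i * (g x i j * Y x 0 j).
Proof.
rewrite /inner mxE exchange_big /=; apply: eq_bigr => j _.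
by rewrite mxE mulr_suml; apply: eq_bigr => i _; rewrite mxE mulrA.
Qed.

Lemma sum_swap4 (t : 'I_3 -> 'I_3 -> 'I_3 -> 'I_3 -> R) :
  \sum_i \sum_j \sum_k \sum_m t i j k m = \sum_m \sum_j \sum_k \sum_i t i j k m.
Proof.
rewrite exchange_big [RHS]exchange_big; apply: eq_bigr => j _.
rewrite exchange_big [RHS]exchange_big; apply: eq_bigr => k _.
exact: exchange_big.
Qed.

Lemma nabla_metric U g X Y Z x : open U -> is_metric U g ->
  smooth_map U X -> smooth_map U Y -> U x ->
  act Z (inner g X Y) x = inner g (nabla g Z X) Y x + inner g X (nabla g Z Y) x.
Proof.
move=> oU gm sX sY Ux; have [gs gsym _] := gm.
have dX i := smooth_differentiable (sX i) Ux.
have dY i := smooth_differentiable (sY i) Ux.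
have dg i j := smooth_differentiable (gs i j) Ux.
have gsymE a b : g x a b = g x b a by rewrite -[in LHS](gsym _ Ux) mxE.
have key i j : act Z (fun y => g y i j) x =
    (\sum_k \sum_m Z x 0 k * (g x j m * christoffel g k i m x)) +
    \sum_k \sum_m Z x 0 k * (g x i m * christoffel g k j m x).
  rewrite /act -big_split /=; apply: eq_bigr => k _.
  rewrite -!mulr_sumr -mulrDr; congr (_ * _).
  rewrite !(christoffel_lower _ _ _ oU gm Ux) -mulrDr.
  rewrite (partial_metric_sym j i k oU gm Ux) (partial_metric_sym k j i oU gm Ux).
  rewrite (partial_metric_sym k i j oU gm Ux).
  set a := partial k _ x; set b := partial i _ x; set c := partial j _ x.
  by field.
have dXgY i j : differentiable (fun y => X y 0 i * (g y i j * Y y 0 j)) x.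
  by apply: differentiableM => //; exact: differentiableM.
have dXgY' i : differentiable (fun y => \sum_j X y 0 i * (g y i j * Y y 0 j)) x.
  by rewrite -fct_sumE; apply: differentiable_sum => j; exact: dXgY.
rewrite (_ : inner g X Y = fun y => \sum_i \sum_j X y 0 i * (g y i j * Y y 0 j));
  last by apply/funext => y; rewrite innerE.
rewrite act_sum3//; under eq_bigr => i _.
  rewrite act_sum3//; under eq_bigr => j _.
    rewrite actM ?actM//; [|exact: differentiableM].
    rewrite key mulrDl !mulrDr addrA.
    over.
  over.
rewrite !innerE.
under [X in _ = X + _]eq_bigr => i _ do
  under eq_bigr => j _ do rewrite mxE mulrDl.
under [X in _ = _ + X]eq_bigr => i _ do
  under eq_bigr => j _ do rewrite mxE !mulrDr.
have S2 (F G : 'I_3 -> 'I_3 -> R) :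
  \sum_i \sum_j (F i j + G i j) = \sum_i \sum_j F i j + \sum_i \sum_j G i j.
  by rewrite -big_split; apply: eq_bigr => i _; rewrite big_split.
rewrite !S2.
rewrite -!addrA; congr (_ + _).
rewrite addrCA [RHS]addrCA [X in _ + X]addrC addrCA; congr (_ + _).
rewrite addrC; congr (_ + _).
  transitivity (\sum_i \sum_j \sum_k \sum_m
    Z x 0 k * X x 0 i * christoffel g k i m x * g x m j * Y x 0 j).
    apply: eq_bigr => i _; apply: eq_bigr => j _.
    rewrite mulr_suml mulr_sumr; apply: eq_bigr => k _.
    rewrite mulr_suml mulr_sumr; apply: eq_bigr => m _.
    by rewrite (gsymE m j); ring.
  rewrite sum_swap4; apply: eq_bigr => i _; apply: eq_bigr => j _.
  rewrite mulr_suml; apply: eq_bigr => k _.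
  by rewrite mulr_suml; apply: eq_bigr => m _; ring.
apply: eq_bigr => i _.
transitivity (\sum_j \sum_k \sum_m
    X x 0 i * (g x i m * (Z x 0 k * Y x 0 j * christoffel g k j m x))).
  apply: eq_bigr => j _.
  rewrite mulr_suml mulr_sumr; apply: eq_bigr => k _.
  by rewrite mulr_suml mulr_sumr; apply: eq_bigr => m _; ring.
rewrite exchange_big; under eq_bigr do rewrite exchange_big.
rewrite exchange_big; apply: eq_bigr => j _ /=.
rewrite !mulr_sumr; apply: eq_bigr => k _.
by rewrite !mulr_sumr.
Qed.

(* R(X, Y)Z *)
Definition curvature (g : space -> 'M[R]_3) (X Y Z : space -> space)
    (x : space) : space :=
  nabla g X (nabla g Y Z) x - nabla g Y (nabla g X Z) x
  - nabla g (bracket X Y) Z x.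

(* The coordinate vector field d/dx^i. *)
Definition coord_field (i : 'I_3) : space -> space := fun=> delta_mx 0 i.

(* Ric(Y, Z) is the trace of X |-> R(X, Y)Z. *)
Definition ricci (g : space -> 'M[R]_3) (x : space) : 'M[R]_3 :=
  \matrix_(j, k)
    \sum_i curvature g (coord_field i) (coord_field j) (coord_field k) x 0 i.

Definition scalar_curvature (g : space -> 'M[R]_3) (x : space) : R :=
  \tr (invmx (g x) *m ricci g x).

(* The 1-form metrically dual to the vector field X. *)
Definition dual (g : space -> 'M[R]_3) (X : space -> space) (x : space) : space :=
  X x *m g x.

(* The square (tensor product with itself) of a covector. *)
Definition sq (a : space) : 'M[R]_3 := a^T *m a.

(* The Lie derivative (L_X g)(Y, Z). *)
Definition lie_metric (g : space -> 'M[R]_3) (X Y Z : space -> space)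
    (x : space) : R :=
  act X (inner g Y Z) x - inner g (bracket X Y) Z x - inner g Y (bracket X Z) x.

Definition killing_on (U : set space) (g : space -> 'M[R]_3)
    (X : space -> space) : Prop :=
  forall Y Z, smooth_map U Y -> smooth_map U Z ->
    forall x, U x -> lie_metric g X Y Z x = 0.

Definition sasakian_on (U : set space) (g : space -> 'M[R]_3)
    (e0 : space -> space) : Prop :=
  [/\ smooth_map U e0,
      forall x, U x -> inner g e0 e0 x = 1,
      killing_on U g e0 &
      forall X Y, smooth_map U X -> smooth_map U Y -> forall x, U x ->
        curvature g X e0 Y x = inner g e0 Y x *: X x - inner g X Y x *: e0 x].

Definition eta_einstein_on (U : set space) (g : space -> 'M[R]_3)
    (e0 : space -> space) (a b : R) : Prop :=
  forall x, U x -> ricci g x = a *: g x + b *: sq (dual g e0 x).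

End LocalCalculus.

(** * Smooth 3-manifolds

  A chart consists of a domain and a coordinate map, whose values outside of
  the domain are irrelevant.  A smooth structure is a maximal atlas, so that
  its members are all the local coordinate systems of the manifold.  A tensor
  field is given by its components in all of these, subject to the usual
  transformation law; identities between tensor fields are required in every
  local coordinate system, the vector fields in them being arbitrary vector
  fields on the coordinate domain. *)

Section Manifolds.
Context {R : realType} {M : topologicalType}.
Notation space := 'rV[R]_3.

Record chart := Chart { chart_dom : set M ; chart_map : M -> space }.

Definition chart_im (c : chart) : set space := chart_map c @` chart_dom c.

(* The coordinate map is a homeomorphism of an open set onto an open set. *)
Definition is_chart (c : chart) : Prop :=
  [/\ open (chart_dom c),
      {in chart_dom c &, injective (chart_map c)},
      forall p, chart_dom c p -> {for p, continuous (chart_map c)} &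
      forall V, open V -> V `<=` chart_dom c -> open (chart_map c @` V)].

Definition overlap (c d : chart) : set M := chart_dom c `&` chart_dom d.

(* f is the change of coordinates from c to d; its values outside of the open
   set chart_map c @` overlap c d are irrelevant. *)
Definition is_transition (c d : chart) (f : space -> space) : Prop :=
  forall p, overlap c d p -> f (chart_map c p) = chart_map d p.

Definition compatible (c d : chart) : Prop :=
  exists2 f, is_transition c d f & smooth_map (chart_map c @` overlap c d) f.

Definition smooth_structure (A : set chart) : Prop :=
  [/\ A `<=` is_chart,
      forall p, exists2 c, A c & chart_dom c p,
      forall c d, A c -> A d -> compatible c d &
      forall c, is_chart c ->
        (forall d, A d -> compatible c d /\ compatible d c) -> A c].

Definition smooth_manifold (A : set chart) : Prop :=
  [/\ hausdorff_space M, @second_countable M & smooth_structure A].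

(* Tangent vectors are row vectors: v in c becomes v *m 'J f in d. *)
Definition vector_field (A : set chart) (X : chart -> space -> space) : Prop :=
  (forall c, A c -> smooth_map (chart_im c) (X c)) /\
  (forall c d f, A c -> A d -> is_transition c d f ->
     forall p, overlap c d p ->
       X d (chart_map d p) = X c (chart_map c p) *m 'J f (chart_map c p)).

Definition riemannian_metric (A : set chart) (g : chart -> space -> 'M[R]_3) :
    Prop :=
  (forall c, A c -> is_metric (chart_im c) (g c)) /\
  (forall c d f, A c -> A d -> is_transition c d f ->
     forall p, overlap c d p ->
       g c (chart_map c p) =
       'J f (chart_map c p) *m g d (chart_map d p) *m ('J f (chart_map c p))^T).

Definition sasakian (A : set chart) (g : chart -> space -> 'M[R]_3)
    (e0 : chart -> space -> space) : Prop :=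
  vector_field A e0 /\
  forall c, A c -> sasakian_on (chart_im c) (g c) (e0 c).

Definition eta_einstein (A : set chart) (g : chart -> space -> 'M[R]_3)
    (e0 : chart -> space -> space) : Prop :=
  exists a b, forall c, A c -> eta_einstein_on (chart_im c) (g c) (e0 c) a b.

End Manifolds.
Arguments chart : clear implicits.

(** * The three normal forms

  The coordinates 0, 1, 2 are (rho, theta, phi) when W <> 0 and (r, u, v) when
  W = 0. *)

Section Models.
Context {R : realType}.
Notation space := 'rV[R]_3.

Definition sinh (t : R) : R := (expR t - expR (- t)) / 2.
Definition cosh (t : R) : R := (expR t + expR (- t)) / 2.

Definition dom_pos : set space := [set x | 0 < x 0 1 < pi].

Definition g_pos (W : R) (x : space) : 'M[R]_3 :=
  let theta := x 0 1 in
  (1 / (2 * W)) *: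
    (sq (dx 1) + sin theta ^+ 2 *: sq (dx 2)
     + (2 / W) *: sq (dx 0 + cos theta *: dx 2)).

Definition alpha_pos (W : R) (x : space) : space :=
  let theta := x 0 1 in (1 / W) *: (dx 0 + cos theta *: dx 2).

Definition dom_zero : set space := setT.

Definition g_zero (x : space) : 'M[R]_3 :=
  let v := x 0 2 in
  sq (dx 0 + (2 * v) *: dx 1) + sq (dx 1) + sq (dx 2).

Definition alpha_zero (x : space) : space :=
  let v := x 0 2 in dx 0 + (2 * v) *: dx 1.

Definition dom_neg : set space := [set x | 0 < x 0 1].

Definition g_neg (W : R) (x : space) : 'M[R]_3 :=
  let theta := x 0 1 in
  - (1 / (2 * W)) *:
    (sq (dx 1) + sinh theta ^+ 2 *: sq (dx 2)
     - (2 / W) *: sq (dx 0 + cosh theta *: dx 2)).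

Definition alpha_neg (W : R) (x : space) : space :=
  let theta := x 0 1 in (1 / W) *: (dx 0 + cosh theta *: dx 2).

(* Around every point there are local coordinates with values in U in which
   the metric and the 1-form dual to e0 are gU and aU. *)
Definition has_local_form (M : topologicalType) (A : set (chart R M))
    (g : chart R M -> space -> 'M[R]_3) (e0 : chart R M -> space -> space)
    (U : set space) (gU : space -> 'M[R]_3) (aU : space -> space) : Prop :=
  forall p : M, exists c : chart R M,
    [/\ A c, chart_dom c p, chart_im c `<=` U &
        forall x, chart_im c x -> g c x = gU x /\ dual (g c) (e0 c) x = aU x].

(* On U, gU is a metric and aU is the dual of a vector field which makes it a
   Sasakian eta-Einstein structure of scalar curvature s. *)
Definition defines_sasakian_eta_einstein (U : set space)
    (gU : space -> 'M[R]_3) (aU : space -> space) (s : R) : Prop :=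
  is_metric U gU /\
  exists e0 : space -> space,
    [/\ sasakian_on U gU e0,
        exists a b, eta_einstein_on U gU e0 a b,
        forall x, U x -> dual gU e0 x = aU x &
        forall x, U x -> scalar_curvature gU x = s].

End Models.

(* Main.v *)
From HB Require Import structures.
Require Import Defs.
From mathcomp Require Import all_boot all_order all_algebra.
From mathcomp Require Import ring lra.
From mathcomp Require Import all_classical all_reals all_analysis.
(** Complete e0 to an orthonormal frame e0, e1, e2 and let al, th1, th2 be the
  dual coframe.  The Killing and curvature conditions say that, with w the
  connection form of the quotient by the flow of e0 and a sign s,
    d al = 2 s th1 /\ th2,   d th1 = w /\ th2,   d th2 = - w /\ th1,
  and eta-Einstein says that d w = - K th1 /\ th2 with the constant K = 2 W: the
  quotient surface has constant curvature K.  Hence the linear system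
    dz = z1 th1 + z2 th2,  dz1 = z2 w - K z th1,  dz2 = - z1 w - K z th2,
  satisfied by the heights on a surface of curvature K, is flat and therefore
  solvable with prescribed initial values.  Along a solution K z^2 + N is
  constant for N = z1^2 + z2^2, the form (z1 th2 - z2 th1) / N is closed, and
  subtracting z times a suitable multiple of it from a multiple of al gives a
  closed form.  The two primitives are phi and rho, and z is cos theta, cosh theta or v.
  Conversely each model has an explicit frame with these structure equations,
  and Koszul's formula turns its brackets into the curvature. *)

Set Implicit Arguments.
Unset Strict Implicit.
Unset Printing Implicit Defensive.
Import Order.TTheory GRing.Theory Num.Theory numFieldNormedType.Exports.
Local Open Scope classical_set_scope.
Local Open Scope ring_scope.

(** The analytic core is the solvability of flat linear systems. A solution is defined by transport
    along the rays from a base point, and the difficulty is its differentiability across the rays.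
    Instead of differentiating an ODE in its parameters, the transport to h + k is compared with its
    linear prediction from the transport to h: flatness leaves a linear ODE for the error whose
    forcing term has size |k|^2. The Poincare lemma is an instance with two unknowns, and smoothness
    is recovered by bootstrapping first-order equations. The value K = 2 W arises as follows.
    Ric(e0, e0) = 2 gives a + b = 2, so R = 3 a + b = 2 a + 2 and 2 W = a + 2. The plane orthogonal
    to e0 has sectional curvature a - 1, and O'Neill's formula adds 3 to it in the quotient. The
    initial values of z serve to normalise the first integral K z^2 + N while keeping dz nonzero at
    the point. *)

Lemma big_ord3 (V : nmodType) (F : 'I_3 -> V) : \sum_i F i = F 0 + F 1 + F 2.
Proof.
rewrite !big_ord_recl big_ord0 addr0 addrA; congr (F _ + F _ + F _); exact: val_inj.
Qed.

(** * Smooth functions on open subsets of R^3 *)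

Section Calculus.
Context {R : realType}.
Notation space := 'rV[R]_3.
Implicit Types (U V : set space) (f h : space -> R) (x : space).

Definition linear_form (a : space) : space -> R := fun k => \sum_i k 0 i * a 0 i.

Lemma linear_form_linear a : linear (linear_form a).
Proof.
move=> c u v; rewrite /linear_form scaler_sumr -big_split /=; apply: eq_bigr => i _.
by rewrite !mxE mulrDl -mulrA.
Qed.

Lemma continuous_linear_form a : continuous (linear_form a).
Proof.
move=> u; apply: differentiable_continuous; rewrite /linear_form -fct_sumE.
apply: differentiable_sum => i; apply: differentiableM => //.
exact: differentiable_coord.
Qed.

(** Differentiability with prescribed partial derivatives becomes one estimate. Functions controlled
    only by estimates, such as solutions of flat systems and inverse maps, are differentiated
    through the converse direction. *)
Lemma differentiable_epsP f x (a : space) :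
  (differentiable f x /\ forall i, partial i f x = a 0 i) <->
  forall e, 0 < e ->
    \forall k \near (0 : space), `|f (x + k) - f x - linear_form a k| <= e * `|k|.
Proof.
split=> [[df pf] e e0|H].
  have := diff_locally df => /eqaddoP/(_ _ e0).
  apply: filterS => k; rewrite !fctE /= [k + x]addrC.
  have -> : 'd f x k = linear_form a k.
    rewrite [k in LHS]row_sum_delta linear_sum; apply: eq_bigr => i _.
    by rewrite linearZ /= -pf /partial deriveE//.
  by rewrite opprD addrA.
pose L : {linear space -> R} := HB.pack (linear_form a)
  (GRing.isLinear.Build _ _ _ _ (linear_form a) (linear_form_linear a)).
have cL : continuous L by exact: continuous_linear_form.
have E : f \o shift x = cst (f x) + L +o_ (0 : space) id.
  apply/eqaddoP => e e0; near=> k.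
  rewrite !fctE /= [k + x]addrC opprD addrA.
  by near: k; exact: H.
have dE := diff_unique cL E.
have df : differentiable f x by apply/diff_locallyP; rewrite dE; split.
split => // i; rewrite /partial deriveE// dE /= /linear_form (bigD1 i)//= big1 ?addr0.
  by rewrite mxE !eqxx mul1r.
by move=> j ji; rewrite mxE eqxx /= (negPf ji) mul0r.
Unshelve. all: by end_near. Qed.

Lemma near0_add (P : space -> Prop) x :
  (\forall y \near x, P y) -> \forall k \near (0 : space), P (x + k).
Proof.
move=> /nbhs_ballP[e /= e0 eP]; apply/nbhs_ballP; exists e => //= k.
rewrite -ball_normE /= sub0r normrN => ke; apply: eP.
by rewrite -ball_normE /= opprD addrA subrr sub0r normrN.
Qed.

Lemma differentiable_near f h x : (\forall y \near x, f y = h y) ->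
  differentiable f x -> differentiable h x.
Proof.
move=> fh df; pose a := \row_i partial i f x.
have [//|+ _] := (@differentiable_epsP h x a).2 _; last by [].
have /(@differentiable_epsP f x a).1 H :
  differentiable f x /\ forall i, partial i f x = a 0 i.
  by split=> // i; rewrite mxE.
move=> e e0; move: (H e e0) (near0_add fh); apply: filterS2 => k + <-.
by rewrite (nbhs_singleton fh).
Qed.

Lemma eq_on_near U f h x : open U -> (forall x, U x -> f x = h x) -> U x ->
  \forall y \near x, f y = h y.
Proof.
move=> oU fh Ux; have : nbhs x U by exact: open_nbhs_nbhs.
by apply: filterS => y Uy; exact: fh.
Qed.

Lemma partial_eq_on U f h i : open U -> (forall x, U x -> f x = h x) ->
  forall x, U x -> partial i f x = partial i h x.
Proof.
move=> oU fh x Ux; apply: near_eq_derive; exact: eq_on_near fh Ux.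
Qed.

(** The iterated [partial] acts on functions on the whole space; openness of [U] makes the
    derivatives agree on [U] again, which carries the induction. *)
Lemma C_k_eq_on k U f h : open U -> (forall x, U x -> f x = h x) ->
  C_k k U f -> C_k k U h.
Proof.
elim: k f h => [|k IH] f h oU fh /=.
  move=> cf x Ux; rewrite /prop_for /continuous_at -(fh _ Ux).
  apply: cvg_trans (cf x Ux); apply: (@near_eq_cvg _ _ (nbhs x)).
  by apply: eq_on_near Ux => // y /fh.
move=> [df Cf]; split => [x Ux|i].
  by apply: differentiable_near (df x Ux); exact: eq_on_near fh Ux.
apply: IH (Cf i) => //; exact: partial_eq_on.
Qed.

Lemma C_kS k U f : C_k k.+1 U f -> C_k k U f.
Proof.
elim: k f => [|k IH] f /= [df Cf].
  by move=> x Ux; apply: differentiable_continuous; exact: df.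
by split=> // i; apply: IH; exact: Cf.
Qed.

Lemma C_k_sub k U V f : V `<=` U -> C_k k U f -> C_k k V f.
Proof.
move=> VU; elim: k f => [|k IH] f /=; first by move=> H x /VU; exact: H.
by move=> [df Cf]; split=> [x /VU/df//|i]; exact: IH.
Qed.

Lemma smooth_sub U V f : V `<=` U -> smooth U f -> smooth V f.
Proof. by move=> VU sf k; exact: C_k_sub VU (sf k). Qed.

Lemma smooth_eq_on U f h : open U -> (forall x, U x -> f x = h x) ->
  smooth U f -> smooth U h.
Proof. by move=> oU fh sf k; exact: C_k_eq_on fh (sf k). Qed.

Lemma smooth_continuous U f x : smooth U f -> U x -> {for x, continuous f}.
Proof. by move=> sf Ux; exact: (sf 0%N). Qed.

Lemma smooth_partial U f i : smooth U f -> smooth U (partial i f).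
Proof. by move=> sf k; have [_ H] := sf k.+1; exact: H. Qed.

Lemma partial_cst (c : R) i : partial i (fun=> c) = fun=> 0.
Proof. by apply/funext => x; rewrite /partial derive_cst. Qed.

Lemma partial_coord i j : partial i (fun x => x 0 j) = fun=> (i == j)%:R.
Proof.
apply/funext => x.
have E : forall y, linear_form (dx j) y = y 0 j.
  move=> y; rewrite /linear_form (bigD1 j)//= big1 ?addr0 ?mxE ?eqxx ?mulr1//.
  by move=> i' ij; rewrite mxE (negPf ij) mulr0.
have [|_ ->] := (@differentiable_epsP (fun x => x 0 j) x (dx j)).2 _.
  move=> e e0; near=> k; rewrite E mxE [x 0 j + _]addrC addrK subrr normr0.
  by rewrite mulr_ge0// ltW.
by rewrite mxE eqxx.
Unshelve. all: by end_near. Qed.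

Lemma partialD f h i x : differentiable f x -> differentiable h x ->
  partial i (fun y => f y + h y) x = partial i f x + partial i h x.
Proof. by move=> df dh; apply: deriveD; exact: diff_derivable. Qed.

Lemma partialN f i x : differentiable f x ->
  partial i (fun y => - f y) x = - partial i f x.
Proof. by move=> df; apply: deriveN; exact: diff_derivable. Qed.

Lemma partialB f h i x : differentiable f x -> differentiable h x ->
  partial i (fun y => f y - h y) x = partial i f x - partial i h x.
Proof. by move=> df dh; apply: deriveB; exact: diff_derivable. Qed.

Lemma partialV f i x : differentiable f x -> f x != 0 ->
  partial i (fun y => (f y)^-1) x = - (f x) ^- 2 * partial i f x.
Proof.
by move=> df f0; rewrite /partial deriveV//; exact: diff_derivable.
Qed.

Lemma partialM f h i x : differentiable f x -> differentiable h x ->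
  partial i (fun y => f y * h y) x = partial i f x * h x + f x * partial i h x.
Proof.
move=> df dh; rewrite /partial (_ : (fun y => _) = f * h)// deriveM.
- by rewrite /GRing.scale /= addrC mulrC.
- exact: diff_derivable.
- exact: diff_derivable.
Qed.

Lemma fun_big_cons (op : R -> R -> R) (idx : R) (I : Type) j (r : seq I)
    (P : pred I) (F : I -> space -> R) :
  (fun x => \big[op/idx]_(i <- j :: r | P i) F i x) =
  if P j then fun x => op (F j x) (\big[op/idx]_(i <- r | P i) F i x)
  else fun x => \big[op/idx]_(i <- r | P i) F i x.
Proof. by apply/funext => x; rewrite big_cons; case: ifP. Qed.

Lemma partial_sum (I : Type) (r : seq I) (P : pred I) (F : I -> space -> R) x :
  (forall j, P j -> differentiable (F j) x) ->
  differentiable (fun y => \sum_(j <- r | P j) F j y) x /\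
  forall i, partial i (fun y => \sum_(j <- r | P j) F j y) x =
    \sum_(j <- r | P j) partial i (F j) x.
Proof.
move=> dF; elim: r => [|j r [IH1 IH2]].
  under eq_fun do rewrite big_nil; split; first exact: differentiable_cst.
  by move=> i; rewrite big_nil partial_cst.
rewrite fun_big_cons; case: ifPn => Pj.
  split=> [|i]; first by apply: differentiableD => //; exact: dF.
  by rewrite big_cons Pj partialD// ?IH2//; exact: dF.
by split => // i; rewrite big_cons (negPf Pj).
Qed.

Lemma differentiable_comp1 (phi : R -> R) (l : R) f x :
  is_derive (f x) 1 phi l -> differentiable f x ->
  differentiable (fun y => phi (f y)) x.
Proof.
move=> [dphi _] df; apply: differentiable_comp => //.
exact/derivable1_diffP.
Qed.

Lemma partial_comp1 (phi : R -> R) (l : R) f i x :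
  is_derive (f x) 1 phi l -> differentiable f x ->
  partial i (fun y => phi (f y)) x = l * partial i f x.
Proof.
move=> [dphi phil] df; rewrite /partial deriveE; last first.
  by apply: differentiable_comp => //; exact/derivable1_diffP.
rewrite -[fun y => _]/(phi \o f) diff_comp//; last exact/derivable1_diffP.
by rewrite /= deriv1E// derive1E phil deriveE// /GRing.scale /= mulrC.
Qed.

Lemma C_k_cst k U (c : R) : C_k k U (fun=> c).
Proof.
elim: k c => [|k IH] c /=; first by move=> x _; exact: cst_continuous.
by split=> [x _|i]; [exact: differentiable_cst|rewrite partial_cst; exact: IH].
Qed.

Lemma C_k_coord k U j : C_k k U (fun x => x 0 j).
Proof.
case: k => [|k] /=.
  by move=> x _; apply: differentiable_continuous; exact: differentiable_coord.
split=> [x _|i]; first exact: differentiable_coord.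
by rewrite partial_coord; exact: C_k_cst.
Qed.

Lemma C_kD k U f h : open U ->
  C_k k U f -> C_k k U h -> C_k k U (fun x => f x + h x).
Proof.
move=> oU; elim: k f h => [|k IH] f h /=.
  by move=> cf ch x Ux; apply: continuousD; [exact: cf|exact: ch].
move=> [df Cf] [dh Ch]; split=> [x Ux|i].
  by apply: differentiableD; [exact: df|exact: dh].
apply: C_k_eq_on (IH _ _ (Cf i) (Ch i)) => // x Ux.
by rewrite partialD//; [exact: df|exact: dh].
Qed.

Lemma C_kM k U f h : open U ->
  C_k k U f -> C_k k U h -> C_k k U (fun x => f x * h x).
Proof.
move=> oU; elim: k f h => [|k IH] f h.
  by move=> cf ch x Ux; apply: continuousM; [exact: cf|exact: ch].
move=> Cf' Ch'; have [df Cf] := Cf'; have [dh Ch] := Ch'.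
split=> [x Ux|i].
  by apply: differentiableM; [exact: df|exact: dh].
apply: (@C_k_eq_on _ _ (fun x => partial i f x * h x + f x * partial i h x)) => //.
  by move=> x Ux; rewrite partialM//; [exact: df|exact: dh].
by apply: C_kD => //; apply: IH; (exact: C_kS) || (exact: Cf) || exact: Ch.
Qed.

Lemma C_k_sum k U (I : Type) (r : seq I) (P : pred I) (F : I -> space -> R) :
  open U -> (forall j, P j -> C_k k U (F j)) ->
  C_k k U (fun x => \sum_(j <- r | P j) F j x).
Proof.
move=> oU CF; elim: r => [|j r IH].
  by under eq_fun do rewrite big_nil; exact: C_k_cst.
rewrite fun_big_cons; case: ifPn => Pj //.
by apply: C_kD => //; exact: CF.
Qed.

Lemma C_k_prod k U (I : Type) (r : seq I) (P : pred I) (F : I -> space -> R) :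
  open U -> (forall j, P j -> C_k k U (F j)) ->
  C_k k U (fun x => \prod_(j <- r | P j) F j x).
Proof.
move=> oU CF; elim: r => [|j r IH].
  by under eq_fun do rewrite big_nil; exact: C_k_cst.
rewrite fun_big_cons; case: ifPn => Pj //.
by apply: C_kM => //; exact: CF.
Qed.

Lemma smooth_cst U (c : R) : smooth U (fun=> c).
Proof. by move=> k; exact: C_k_cst. Qed.

Lemma smooth_coord U j : smooth U (fun x => x 0 j).
Proof. by move=> k; exact: C_k_coord. Qed.

Lemma smoothD U f h : open U -> smooth U f -> smooth U h ->
  smooth U (fun x => f x + h x).
Proof. by move=> oU sf sh k; exact: C_kD. Qed.

Lemma smoothM U f h : open U -> smooth U f -> smooth U h ->
  smooth U (fun x => f x * h x).
Proof. by move=> oU sf sh k; exact: C_kM. Qed.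

Lemma smoothN U f : open U -> smooth U f -> smooth U (fun x => - f x).
Proof.
move=> oU sf; apply: (@smooth_eq_on _ (fun x => -1 * f x)) => //.
  by move=> x _; rewrite mulN1r.
by apply: smoothM => //; exact: smooth_cst.
Qed.

Lemma smoothB U f h : open U -> smooth U f -> smooth U h ->
  smooth U (fun x => f x - h x).
Proof. by move=> oU sf sh; apply: smoothD => //; exact: smoothN. Qed.

Lemma smooth_sum U (I : Type) (r : seq I) (P : pred I) (F : I -> space -> R) :
  open U -> (forall j, P j -> smooth U (F j)) ->
  smooth U (fun x => \sum_(j <- r | P j) F j x).
Proof. by move=> oU sF k; apply: C_k_sum => // j Pj; exact: sF. Qed.

Lemma smooth_prod U (I : Type) (r : seq I) (P : pred I) (F : I -> space -> R) :
  open U -> (forall j, P j -> smooth U (F j)) ->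
  smooth U (fun x => \prod_(j <- r | P j) F j x).
Proof. by move=> oU sF k; apply: C_k_prod => // j Pj; exact: sF. Qed.

(* A first-order system whose right-hand sides are as regular as F has smooth solutions. *)
Lemma smooth_bootstrap (I : Type) U (F : I -> space -> R)
    (H : I -> 'I_3 -> space -> R) : open U ->
  (forall a x, U x -> differentiable (F a) x) ->
  (forall a i x, U x -> partial i (F a) x = H a i x) ->
  (forall k, (forall a, C_k k U (F a)) -> forall a i, C_k k U (H a i)) ->
  forall a, smooth U (F a).
Proof.
move=> oU dF pF CH a k; elim: k a => [|k IH] a.
  by move=> x Ux; apply: differentiable_continuous; exact: dF.
split=> [x Ux|i]; first exact: dF.
by apply: C_k_eq_on (CH k IH a i) => // x Ux; rewrite pF.
Qed.

Lemma smooth_bootstrap1 U f (H : 'I_3 -> space -> R) : open U ->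
  (forall x, U x -> differentiable f x) ->
  (forall i x, U x -> partial i f x = H i x) ->
  (forall k, C_k k U f -> forall i, C_k k U (H i)) -> smooth U f.
Proof.
move=> oU df pf CH.
apply: (@smooth_bootstrap unit U (fun=> f) (fun=> H) oU _ _ _ tt) => //.
by move=> k Cf _; apply: CH; exact: Cf tt.
Qed.

(** The inverse u solves du = - u^2 df, whose right-hand side is as regular as u. *)
Lemma smoothV U f : open U -> smooth U f -> (forall x, U x -> f x != 0) ->
  smooth U (fun x => (f x)^-1).
Proof.
move=> oU sf f0; have df x Ux := smooth_differentiable sf (Ux : U x).
apply: (@smooth_bootstrap1 _ _ (fun i x => - partial i f x * ((f x)^-1 * (f x)^-1))) => //.
- by move=> x Ux; apply: differentiableV; [exact: df|exact: f0].
- move=> i x Ux; rewrite /partial deriveV; [|exact: f0|exact/diff_derivable/df].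
  by rewrite /GRing.scale /= -invfM -expr2 mulrC mulrN mulNr.
- move=> k Cf i; apply: C_kM => //; last exact: C_kM.
  by apply: smoothN => //; exact: smooth_partial.
Qed.

(** The derivative is written as df / (2 f) times the root, so that the root enters the right-hand
    side only as a factor and never inverted. *)
Lemma smooth_sqrt U f : open U -> smooth U f -> (forall x, U x -> 0 < f x) ->
  smooth U (fun x => Num.sqrt (f x)).
Proof.
move=> oU sf f0; have df x Ux := smooth_differentiable sf (Ux : U x).
have f0' x : U x -> f x != 0 by move=> /f0; exact: lt0r_neq0.
have ds x : U x -> is_derive (f x) 1 Num.sqrt (2 * Num.sqrt (f x))^-1.
  by move=> Ux; apply: is_derive1_sqrt; exact: f0.
apply: (@smooth_bootstrap1 _ _ (fun i x =>
  (2^-1 * (f x)^-1 * partial i f x) * Num.sqrt (f x))) => //.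
- by move=> x Ux; exact: differentiable_comp1 (ds _ Ux) (df _ Ux).
- move=> i x Ux; rewrite (partial_comp1 _ (ds _ Ux))//; last exact: df.
  have s0 : Num.sqrt (f x) != 0 by rewrite gt_eqF// sqrtr_gt0 f0.
  have -> : f x = Num.sqrt (f x) ^+ 2 by rewrite sqr_sqrtr ?ltW ?f0.
  rewrite sqrtr_sqr ger0_norm ?sqrtr_ge0//.
  by field.
- move=> k Cf i; apply: C_kM => //; apply: smoothM => //; last exact: smooth_partial.
  by apply: smoothM => //; [exact: smooth_cst|exact: smoothV].
Qed.

Lemma smooth_expR U f : open U -> smooth U f -> smooth U (fun x => expR (f x)).
Proof.
move=> oU sf; have df x Ux := smooth_differentiable sf (Ux : U x).
apply: (@smooth_bootstrap1 _ _ (fun i x => partial i f x * expR (f x))) => //.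
- by move=> x Ux; exact: differentiable_comp1 (is_derive_expR _) (df _ Ux).
- move=> i x Ux; rewrite (partial_comp1 _ (is_derive_expR _)) 1?mulrC//; exact: df.
- by move=> k Cf i; apply: C_kM => //; exact: smooth_partial.
Qed.

Lemma smooth_ln U f : open U -> smooth U f -> (forall x, U x -> 0 < f x) ->
  smooth U (fun x => ln (f x)).
Proof.
move=> oU sf f0; have df x Ux := smooth_differentiable sf (Ux : U x).
apply: (@smooth_bootstrap1 _ _ (fun i x => (f x)^-1 * partial i f x)) => //.
- by move=> x Ux; exact: differentiable_comp1 (is_derive1_ln (f0 _ Ux)) (df _ Ux).
- move=> i x Ux; rewrite (partial_comp1 _ (is_derive1_ln (f0 _ Ux)))//; exact: df.
- move=> k Cf i; apply: C_kM => //; last exact: smooth_partial.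
  by apply: smoothV => // x /f0; exact: lt0r_neq0.
Qed.

(** Neither function alone satisfies a first-order equation of the required kind, hence a system
    indexed by [bool]. *)
Lemma smooth_sin_cos U f : open U -> smooth U f ->
  smooth U (fun x => sin (f x)) /\ smooth U (fun x => cos (f x)).
Proof.
move=> oU sf; have df x Ux := smooth_differentiable sf (Ux : U x).
pose F (b : bool) x := if b then sin (f x) else cos (f x).
suff H b : smooth U (F b) by split; [exact: H true|exact: H false].
apply: (@smooth_bootstrap bool U F (fun b i x => partial i f x *
  (if b then F false x else -1 * F true x))) => //.
- move=> [] x Ux; first exact: differentiable_comp1 (is_derive_sin _) (df _ Ux).
  exact: differentiable_comp1 (is_derive_cos _) (df _ Ux).
- move=> [] i x Ux; rewrite mulrC.
    by rewrite (partial_comp1 _ (is_derive_sin _))//; exact: df.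
  by rewrite mulN1r (partial_comp1 _ (is_derive_cos _))//; exact: df.
- move=> k Cf [] i; apply: C_kM => //; try exact: smooth_partial.
  by apply: C_kM => //; exact: C_k_cst.
Qed.

Lemma smooth_acos U f : open U -> smooth U f -> (forall x, U x -> -1 < f x < 1) ->
  smooth U (fun x => acos (f x)).
Proof.
move=> oU sf f0; have df x Ux := smooth_differentiable sf (Ux : U x).
have da x (Ux : U x) := is_derive1_acos (f0 x Ux).
apply: (@smooth_bootstrap1 _ _ (fun i x => - (Num.sqrt (1 - f x ^+ 2))^-1 * partial i f x)) => //.
- by move=> x Ux; exact: differentiable_comp1 (da _ Ux) (df _ Ux).
- by move=> i x Ux; rewrite (partial_comp1 _ (da _ Ux))//; exact: df.
- move=> k Cf i; apply: C_kM => //; last exact: smooth_partial.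
  apply: smoothN => //.
  have p0 x : U x -> 0 < 1 - f x ^+ 2.
    by move=> Ux; rewrite subr_gt0 -[ltRHS](expr1n _ 2) -[f x ^+ 2]real_normK ?num_real// ltrXn2r// ?ltr_norml ?f0.
  apply: smoothV => //; last by move=> x Ux; rewrite gt_eqF// sqrtr_gt0 p0.
  apply: smooth_sqrt => //; apply: smoothB => //; first exact: smooth_cst.
  by apply: (@smooth_eq_on _ (fun x => f x * f x)) => //; exact: smoothM.
Qed.

Lemma continuous_map (G : space -> space) x :
  (forall j, {for x, continuous (fun y => G y 0 j)}) -> {for x, continuous G}.
Proof.
move=> cG A [P PG PA]; have : \forall y \near x, forall j, P 0 j (G y 0 j).
  by apply: (@filter_forall _ _ (fun j y => P 0 j (G y 0 j)) (nbhs x)) => j; exact: cG (PG 0 j).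
by apply: filterS => y Py; apply: PA => i j; rewrite ord1; exact: Py.
Qed.

Lemma coord_le_norm (x : space) j : `|x 0 j| <= `|x|.
Proof. by rewrite {2}/Num.norm /= mx_normrE (le_bigmax _ (fun ij => `|x ij.1 ij.2|) (0, j)). Qed.

Lemma norm_le_coord (x : space) (c : R) : 0 <= c -> (forall j, `|x 0 j| <= c) -> `|x| <= c.
Proof.
move=> c0 xc; rewrite /Num.norm /= mx_normrE; apply/bigmax_leP; split=> // -[i j] _ /=.
by rewrite ord1.
Qed.

Lemma differentiable_map (G : space -> space) x :
  (forall j, differentiable (fun y => G y 0 j) x) -> differentiable G x.
Proof.
move=> dG; have -> : G = fun y => \sum_j G y 0 j *: dx j.
  by apply/funext => y; exact: row_sum_delta.
rewrite -fct_sumE; apply: differentiable_sum => j; exact: differentiableZl.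
Qed.

Lemma jacobianE (G : space -> space) x i j :
  (forall j, differentiable (fun y => G y 0 j) x) ->
  'J G x i j = partial i (fun y => G y 0 j) x.
Proof.
move=> dG; have dG' := differentiable_map dG.
have := deriveEjacobian (dx i) dG'; rewrite derive_mx; last exact: diff_derivable.
move/matrixP/(_ 0 j); rewrite mxE /partial => ->.
by rewrite /dx -rowE [RHS]mxE.
Qed.

Lemma partial_comp f (G : space -> space) x i :
  (forall j, differentiable (fun y => G y 0 j) x) -> differentiable f (G x) ->
  differentiable (fun y => f (G y)) x /\
  partial i (fun y => f (G y)) x =
    \sum_j partial i (fun y => G y 0 j) x * partial j f (G x).
Proof.
move=> dG df; have dG' := differentiable_map dG.
split; first exact: differentiable_comp.
rewrite {1}/partial deriveE; last exact: differentiable_comp.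
rewrite -[fun y => _]/(f \o G) diff_comp//=.
have <- : 'D_(dx i) G x = 'd G x (dx i) by exact: deriveE.
rewrite derive_mx; last exact: diff_derivable.
rewrite [\matrix_(_, _) _]row_sum_delta linear_sum; apply: eq_bigr => j _.
by rewrite linearZ /= mxE /partial -deriveE.
Qed.

(** [f] is smooth rather than of class k, so that the induction hypothesis applies to its partial
    derivatives while [G] loses one order. *)
Lemma C_k_comp k U V f (G : space -> space) : open U -> smooth V f ->
  (forall j, C_k k U (fun y => G y 0 j)) -> (forall x, U x -> V (G x)) ->
  C_k k U (fun y => f (G y)).
Proof.
move=> oU + + UV; elim: k f => [|k IH] f sf.
  move=> CG x Ux; apply: continuous_comp; last exact: (sf 0%N _ (UV _ Ux)).
  by apply: continuous_map => j; exact: CG.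
move=> CG; have dG x j : U x -> differentiable (fun y => G y 0 j) x.
  by move=> Ux; have [+ _] := CG j; exact.
have df x (Ux : U x) := smooth_differentiable sf (UV _ Ux).
split=> [x Ux|i]; first by have [] := partial_comp 0 (dG x ^~ Ux) (df _ Ux).
apply: (@C_k_eq_on _ _ (fun x =>
  \sum_j partial i (fun y => G y 0 j) x * partial j f (G x))) => //.
  by move=> x Ux; have [_ ->] := partial_comp i (dG x ^~ Ux) (df _ Ux).
apply: C_k_sum => // j _; apply: C_kM => //; first by have [_ H] := CG j; exact: H.
apply: IH; first exact: smooth_partial.
by move=> j'; apply: C_kS; exact: CG.
Qed.

Lemma smooth_comp U V f (G : space -> space) : open U -> smooth V f ->
  smooth_map U G -> (forall x, U x -> V (G x)) -> smooth U (fun y => f (G y)).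
Proof. by move=> oU sf sG UV k; apply: C_k_comp UV => // j; exact: sG. Qed.

Lemma is_metric_sub U V (g : space -> 'M[R]_3) : V `<=` U -> is_metric U g -> is_metric V g.
Proof.
move=> VU [gs gsy gp]; split; first by move=> i j; exact: smooth_sub VU (gs i j).
  by move=> x /VU; exact: gsy.
by move=> x v /VU; exact: gp.
Qed.

End Calculus.

(** * Symmetry of second derivatives *)

Section MeanValue.
Context {R : realType}.
Notation space := 'rV[R]_3.
Implicit Types (U V : set space) (f h : space -> R) (x : space).

Lemma is_derive_line f x k (t : R) : differentiable f (x + t *: k) ->
  is_derive t 1 (fun s : R => f (x + s *: k))
    (\sum_i k 0 i * partial i f (x + t *: k)).
Proof.
move=> df.
have E : (fun u : R => u^-1 *: (f (x + (u *: (1 : R) + t) *: k) - f (x + t *: k))) =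
    (fun u : R => u^-1 *: ((f \o shift (x + t *: k)) (u *: k) - f (x + t *: k))).
  by apply/funext => u; rewrite /= [u%:A]mulr1 scalerDl addrCA.
have dk : derivable f (x + t *: k) k by exact: diff_derivable.
apply: DeriveDef; first by rewrite /derivable /= E.
rewrite {1}/derive /= E -[LHS]/('D_k f (x + t *: k)) deriveE//.
rewrite -[RHS]/(\sum_i k 0 i * 'D_(dx i) f (x + t *: k)).
under eq_bigr do rewrite deriveE//.
move: ('d f (x + t *: k)) => L; rewrite {1}[k]row_sum_delta linear_sum.
by apply: eq_bigr => i _; rewrite linearZ.
Qed.

Lemma mvt_line f x k : (forall t : R, 0 <= t <= 1 -> differentiable f (x + t *: k)) ->
  exists2 c : R, 0 <= c <= 1 &
    f (x + k) - f x = \sum_i k 0 i * partial i f (x + c *: k).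
Proof.
move=> df.
have [||] := @MVT_segment R (fun s : R => f (x + s *: k))
  (fun s : R => \sum_i k 0 i * partial i f (x + s *: k)) 0 1 ler01.
- move=> t; rewrite in_itv /= => /andP[t0 t1]; apply: is_derive_line.
  by apply: df; rewrite !ltW.
- apply: derivable_within_continuous => t; rewrite in_itv /= => t01.
  by have [] := is_derive_line (df t t01).
- move=> c; rewrite in_itv /= => c01 E; exists c => //.
  by move: E; rewrite scale1r scale0r addr0 subr0 mulr1.
Qed.

Lemma partial_shift f i v x : partial i (fun y => f (y + v)) x = partial i f (x + v).
Proof.
rewrite /partial /derive.
have -> // : (fun h : R => h^-1 *: (((fun y => f (y + v)) \o shift x) (h *: dx i) - f (x + v))) =
  (fun h : R => h^-1 *: ((f \o shift (x + v)) (h *: dx i) - f (x + v))).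
by apply/funext => u /=; rewrite addrA.
Qed.

Lemma differentiable_shift f v x : differentiable f (x + v) ->
  differentiable (fun y => f (y + v)) x.
Proof.
move=> df; apply: (@differentiable_comp _ _ _ _ (fun y => y + v)).
  by apply: differentiableD.
by [].
Qed.

Lemma lin_dx f i (c : R) x : \sum_j (c *: dx i : space) 0 j * partial j f x = c * partial i f x.
Proof.
rewrite (bigD1 i)//= big1 ?addr0 ?mxE ?eqxx ?mulr1//.
by move=> j ji; rewrite !mxE eqxx (negPf ji) mulr0 mul0r.
Qed.

Lemma norm_dx (c : R) i : 0 <= c -> `|c *: dx i : space| <= c.
Proof.
move=> c0; apply: norm_le_coord => // j; rewrite !mxE eqxx /=.
by case: (j == i); rewrite ?mulr1 ?mulr0 ?normr0 // ger0_norm.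
Qed.

(** The mean value theorem is applied to the increment of [f] in direction j, moved along direction
    i, and then to [partial i f] along direction j. *)
Lemma second_difference f x (r h : R) i j : smooth (ball x r) f -> 0 < h -> h + h < r ->
  exists2 y, ball x (h + h + h) y &
    f (x + h *: dx i + h *: dx j) - f (x + h *: dx j) - (f (x + h *: dx i) - f x) =
    h * (h * partial j (partial i f) y).
Proof.
move=> sf h0 hr.
have inb (s t : R) : 0 <= s <= 1 -> 0 <= t <= 1 ->
    `|s *: (h *: dx i) + t *: (h *: dx j) : space| <= h + h.
  move=> /andP[s0 s1] /andP[t0 t1]; rewrite (le_trans (ler_normD _ _))//.
  apply: lerD; rewrite scalerA.
    by apply: le_trans (norm_dx _ _) _; [exact: mulr_ge0 s0 (ltW h0)|rewrite ger_pMl].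
  by apply: le_trans (norm_dx _ _) _; [exact: mulr_ge0 t0 (ltW h0)|rewrite ger_pMl].
have inball (s t : R) : 0 <= s <= 1 -> 0 <= t <= 1 ->
    ball x r (x + s *: (h *: dx i) + t *: (h *: dx j)).
  move=> s01 t01; rewrite -ball_normE /= -addrA opprD addrA subrr sub0r normrN.
  exact: le_lt_trans (inb _ _ s01 t01) hr.
have i00 : (0 : R) <= (0 : R) <= (1 : R) by rewrite lexx ler01.
have i11 : (0 : R) <= (1 : R) <= (1 : R) by rewrite lexx ler01.
have df y : ball x r y -> differentiable f y := smooth_differentiable sf.
have df' y : ball x r y -> differentiable (partial i f) y.
  exact: smooth_differentiable (smooth_partial i sf).
pose F y := f (y + h *: dx j) - f y.
have [|s s01] := @mvt_line F x (h *: dx i).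
  move=> t t01; apply: differentiableB.
    by apply: differentiable_shift; apply: df; have := inball _ _ t01 i11; rewrite scale1r.
  by apply: df; have := inball _ _ t01 i00; rewrite scale0r addr0.
rewrite lin_dx partialB; last 2 first.
- by apply: differentiable_shift; apply: df; have := inball _ _ s01 i11; rewrite scale1r.
- by apply: df; have := inball _ _ s01 i00; rewrite scale0r addr0.
rewrite partial_shift.
have [|t t01] := @mvt_line (partial i f) (x + s *: (h *: dx i)) (h *: dx j).
  by move=> t t01; apply: df'; exact: inball.
move=> ->; rewrite lin_dx /F => E.
exists (x + s *: (h *: dx i) + t *: (h *: dx j)).
  rewrite -ball_normE /= -addrA opprD addrA subrr sub0r normrN.
  by rewrite (le_lt_trans (inb _ _ s01 t01))// ltrDl.
have sub4 (a b c d : R) : a - b - (c - d) = a - c - (b - d) by ring.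
by rewrite sub4; exact: E.
Qed.

Local Opaque partial.

(** The second difference is symmetric in i and j, so both mixed derivatives take a common value at
    points arbitrarily near x; continuity does the rest. *)
Lemma partial_sym U f i j x : open U -> smooth U f -> U x ->
  partial i (partial j f) x = partial j (partial i f) x.
Proof.
move=> oU sf Ux; have /nbhs_ballP[r /= r0 rU] : nbhs x U by exact: open_nbhs_nbhs.
have sfb := smooth_sub rU sf.
apply/eqP; rewrite -subr_eq0 -normr_le0; apply/ler_addgt0Pr => e e0; rewrite add0r.
have e20 : 0 < e / 2 by rewrite divr_gt0.
have cij a b : \forall y \near x, `|partial a (partial b f) x - partial a (partial b f) y| < e / 2.
  have c : {for x, continuous (partial a (partial b f))}.
    by apply: smooth_continuous Ux; do 2 apply: smooth_partial.
  by move/cvgrPdist_lt : c => /(_ _ e20).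
have : \forall y \near x,
    `|partial i (partial j f) x - partial i (partial j f) y| < e / 2 /\
    `|partial j (partial i f) x - partial j (partial i f) y| < e / 2.
  by apply: filterI; exact: cij.
move=> /nbhs_ballP[d /= d0 dP].
pose m := Num.min r d; have m0 : 0 < m by rewrite lt_min r0 d0.
(* The intermediate points lie within 3 h < m, where [f] is smooth and both mixed derivatives vary
   by less than e / 2. *)
pose h := m / 4; have h0 : 0 < h by rewrite divr_gt0.
have hm : h + h + h < m by rewrite /h; lra.
have [||y1 y1b E1] := @second_difference f x r h i j sfb => //.
  have : m <= r by rewrite ge_min lexx.
  by lra.
have [||y2 y2b E2] := @second_difference f x r h j i sfb => //.
  have : m <= r by rewrite ge_min lexx.
  by lra.
have md : m <= d by rewrite ge_min lexx orbT.
have [_ +] := dP y1 (le_ball (le_trans (ltW hm) md) y1b).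
have [+ _] := dP y2 (le_ball (le_trans (ltW hm) md) y2b).
have : partial j (partial i f) y1 = partial i (partial j f) y2.
  apply: (mulfI (lt0r_neq0 h0)); apply: (mulfI (lt0r_neq0 h0)).
  apply: etrans (esym E1) _; apply: etrans _ E2.
  have -> : x + h *: dx j + h *: dx i = x + h *: dx i + h *: dx j by exact: addrAC.
  have sub4 (a b c d' : R) : a - b - (c - d') = a - c - (b - d') by ring.
  exact: sub4.
move=> -> H1 H2.
move: (partial i _ x) (partial j _ x) (partial i _ y2) H1 H2 => a b c H1 H2.
have -> : a - b = (a - c) - (b - c) by ring.
by rewrite (le_trans (ler_normB _ _))// [leRHS]splitr lerD// ltW.
Qed.

End MeanValue.

(** * Linear differential equations *)

Section OneVariable.
Context {R : realType}.

Lemma primitive (f : R -> R) : continuous f ->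
  exists2 F : R -> R, F 0 = 0 & forall t : R, -1 < t -> is_derive t 1 F (f t).
Proof.
move=> cf.
(* Integrating from -1 makes 0 an interior point, so that the derivative there is two-sided. *)
pose F0 (x : R) := (\int[lebesgue_measure]_(t in `[(-1 : R), x]) (f t))%R.
exists (fun x : R => F0 x - F0 0); first by rewrite subrr.
move=> t t1.
have tt1 : t < t + 1 by rewrite ltrDl.
have intf : lebesgue_measure.-integrable `[-1, t + 1] (EFin \o f).
  apply: continuous_compact_integrable; first exact: segment_compact.
  by apply: continuous_subspaceT.
have [dF dFE] := @continuous_FTC1_closed R f (-1) t (t + 1) tt1 intf t1 (cf t).
have dF1 : derivable F0 t 1 by exact: dF.
have dF2 : F0^`()%classic t = f t by exact: dFE.
move: F0 (F0 0) {dF dFE} dF1 dF2 => G c dG dGE.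
have dF0 : is_derive t 1 G (f t) by apply: DeriveDef => //; rewrite -derive1E.
rewrite -[f t]subr0.
by apply: is_deriveB.
Qed.

Lemma bound_of_derivative (F f : R -> R) (m : R) : 0 <= m ->
  F 0 = 0 -> (forall t : R, 0 <= t <= 1 -> is_derive t 1 F (f t)) ->
  (forall t : R, 0 <= t <= 1 -> `|f t| <= m) -> forall t : R, 0 <= t <= 1 -> `|F t| <= m.
Proof.
move=> m0 F0 dF fm t /andP[t0 t1].
have sub s : s \in `[0, t]%R -> 0 <= s <= 1.
  by rewrite in_itv /= => /andP[-> st] /=; exact: le_trans st t1.
have [s sI| |c cI] := @MVT_segment R F f 0 t t0.
- by apply/dF/sub; exact: subset_itv_oo_cc sI.
- apply: derivable_within_continuous => s sI.
  by have [] := dF s (sub s sI).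
rewrite F0 !subr0 => ->; rewrite normrM (ger0_norm t0) -[leRHS]mulr1.
by apply: ler_pM => //; exact: fm (sub c cI).
Qed.

(** Gronwall's estimate without an exponential: at a maximum m of the sum, integration gives m <= n
    (L m + M), and n L <= 1/2 lets the first term be absorbed. *)
Lemma small_growth n (E E' : 'I_n -> R -> R) (L M : R) : 0 <= L -> 0 <= M ->
  n%:R * L <= 2^-1 ->
  (forall c, E c 0 = 0) ->
  (forall c (t : R), 0 <= t <= 1 -> is_derive t 1 (E c) (E' c t)) ->
  (forall c (t : R), 0 <= t <= 1 -> `|E' c t| <= L * (\sum_b `|E b t|) + M) ->
  forall t : R, 0 <= t <= 1 -> \sum_c `|E c t| <= 2 * (n%:R * M).
Proof.
move=> L0 M0 nL E0 dE E'le.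
have [|s sI smax] := @EVT_max R (fun t => \sum_c `|E c t|) 0 1 ler01.
  apply/continuous_in_subspaceT => z; rewrite inE /= in_itv /= => z01.
  apply: (@cvg_big _ _ +%R 0) => [|c _]; first exact: add_continuous.
  apply: (@continuous_comp _ _ _ (E c)); last exact: norm_continuous.
  by apply/differentiable_continuous/derivable1_diffP; have [] := dE c z z01.
move=> t t01; set m := \sum_c `|E c s| in smax *.
have tm : \sum_c `|E c t| <= m by apply: smax; rewrite in_itv.
suff : m <= 2 * (n%:R * M) by exact: le_trans.
have m0 : 0 <= m by apply: sumr_ge0.
have s01 : 0 <= s <= 1 by move: sI; rewrite in_itv.
have Ec c : `|E c s| <= L * m + M.
  apply: (@bound_of_derivative (E c) (E' c)) s01 => //.
    by rewrite addr_ge0// mulr_ge0.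
  move=> u u01; rewrite (le_trans (E'le c u u01))// lerD2r ler_wpM2l//.
  by apply: smax; rewrite in_itv.
have : m <= n%:R * (L * m + M).
  rewrite /m (le_trans (ler_sum _ (fun c _ => Ec c)))//.
  by rewrite sumr_const card_ord mulr_natl.
rewrite mulrDr mulrA; have := ler_wpM2r m0 nL.
by move: (n%:R * L * m) (n%:R * M) => a b; lra.
Qed.

(** The explicit rate stands in for uniform convergence: applied at each time or coordinate
    separately, it gives an error independent of that choice. *)
Lemma geometric_limit (u : nat -> R) (C : R) :
  (forall n, `|u n.+1 - u n| <= C * 2^-1 ^+ n) ->
  exists l, forall n, `|u n - l| <= 2 * C * 2^-1 ^+ n.
Proof.
move=> uC.
have C0 : 0 <= C by have := le_trans (normr_ge0 _) (uC 0%N); rewrite expr0 mulr1.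
have h0 n : 0 <= 2^-1 ^+ n :> R by rewrite exprn_ge0.
have ub n j : `|u (n + j)%N - u n| <= 2 * C * 2^-1 ^+ n * (1 - 2^-1 ^+ j).
  elim: j => [|j IH]; first by rewrite addn0 subrr normr0 expr0 subrr mulr0.
  have := lerD (uC (n + j)%N) IH; rewrite -addnS => /(le_trans (ler_normD _ _)).
  rewrite addrA subrK => /le_trans; apply.
  rewrite exprD exprS; move: (2^-1 ^+ n) (2^-1 ^+ j) => a b.
  by rewrite le_eqVlt; apply/orP; left; apply/eqP; field.
have : cvgn (series (telescope u)).
  apply: normed_cvg.
  apply: (@series_le_cvg _ _ (geometric C 2^-1)).
  - by move=> n; exact: normr_ge0.
  - by move=> n; exact: mulr_ge0.
  - exact: uC.
  - by apply: is_cvg_geometric_series; rewrite ger0_norm// invf_lt1// ltr1n.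
rewrite telescopeK => /cvg_ex[l ul]; exists (l + u 0%N) => n.
apply/ler_addgt0Pr => e e0.
move/cvgrPdist_lt : ul => /(_ e e0)[N _ /(_ (n + N)%N (leq_addl _ _))] /= H.
have -> : u n - (l + u 0%N) = - (u (n + N)%N - u n) - (l - (u (n + N)%N - u 0%N)) by ring.
rewrite (le_trans (ler_normB _ _))// normrN lerD//; last exact: ltW.
by rewrite (le_trans (ub n N))// ler_piMr ?mulr_ge0// lerBlDr lerDl.
Qed.

(* Coefficients evaluated at the clamped time are continuous and bounded on the whole line. *)
Definition clamp (t : R) : R := Num.max 0 (Num.min t 1).

Lemma clamp01 t : 0 <= clamp t <= 1.
Proof. by rewrite /clamp le_max lexx ge_max ler01 ge_min lexx orbT. Qed.

Lemma clamp_id t : 0 <= t <= 1 -> clamp t = t.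
Proof. by move=> /andP[t0 t1]; rewrite /clamp min_l// max_r. Qed.

Lemma continuous_clamp : continuous clamp.
Proof.
have c1 : continuous ((@id R) \min (fun=> 1)).
  by apply: min_fun_continuous; [by move=> ?; exact: cvg_id|exact: cst_continuous].
have : continuous ((fun=> 0 : R) \max ((@id R) \min (fun=> 1))).
  by apply: max_fun_continuous => //; exact: cst_continuous.
exact.
Qed.

(** Picard iteration. Since n L <= 1/2 the integral operator halves sup distances, and clamping the
    upper limit of integration makes this uniform on the whole line; the iterates thus converge on
    all of [0, 1] at once. *)
Lemma linear_ode n (a : 'I_n -> 'I_n -> R -> R) (L : R) (y0 : 'I_n -> R) :
  (forall b c, continuous (a b c)) -> (forall b c t, `|a b c t| <= L) ->
  n%:R * L <= 2^-1 ->
  exists y : 'I_n -> R -> R, (forall c, y c 0 = y0 c) /\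
    forall c (t : R), 0 <= t <= 1 -> is_derive t 1 (y c) (\sum_b y b t * a b c t).
Proof.
move=> ca aL nL.
have L0 (b : 'I_n) : 0 <= L by exact: le_trans (normr_ge0 _) (aL b b 0).
(* [P] selects a primitive vanishing at 0 for each continuous function; its value on other functions
   is arbitrary. *)
have /choice[P PP] : forall f : R -> R, exists F : R -> R, continuous f ->
    F 0 = 0 /\ forall t : R, -1 < t -> is_derive t 1 F (f t).
  move=> f; have [/primitive[F F0 dF]|nf] := pselect (continuous f); first by exists F.
  by exists f.
have m1 (t : R) : 0 <= t <= 1 -> -1 < t.
  by move=> /andP[t0 _]; apply: lt_le_trans t0; rewrite ltrN10.
have PB f g m t : continuous f -> continuous g -> 0 <= m ->
    (forall s, `|f s - g s| <= m) -> 0 <= t <= 1 -> `|P f t - P g t| <= m.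
  move=> cf cg m0 fg t01; have [F0 dF] := PP f cf; have [G0 dG] := PP g cg.
  apply: (@bound_of_derivative (fun t => P f t - P g t) (fun t => f t - g t)) => //.
    by rewrite F0 G0 subrr.
  by move=> s /m1 s1; apply: is_deriveB; [exact: dF|exact: dG].
pose S (u : 'I_n -> R -> R) c t := \sum_b u b t * a b c t.
pose T u c t := y0 c + P (S u c) (clamp t).
have cS u c : (forall b, continuous (u b)) -> continuous (S u c).
  move=> cu t; apply: (@cvg_big _ _ +%R 0) => [|b _]; first exact: add_continuous.
  by apply: continuousM; [exact: cu|exact: ca].
have cT u c : (forall b, continuous (u b)) -> continuous (T u c).
  move=> cu t; apply: continuousD; first exact: cst_continuous.
  apply: (@continuous_comp _ _ _ clamp); first exact: continuous_clamp.
  have [_ dF] := PP _ (cS u c cu).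
  apply/differentiable_continuous/derivable1_diffP.
  by have [] := dF (clamp t) (m1 _ (clamp01 t)).
have SB u v m : (forall b t, `|u b t - v b t| <= m) -> forall c t,
    `|S u c t - S v c t| <= m / 2.
  move=> uv c t; rewrite /S -sumrB.
  have m0 : 0 <= m by exact: le_trans (uv c t).
  apply: (@le_trans _ _ (\sum_(b < n) m * L)).
    rewrite (le_trans (ler_norm_sum _ _ _))//; apply: ler_sum => b _.
    by rewrite -mulrBl normrM; apply: ler_pM.
  by rewrite sumr_const card_ord -[_ *+ n]mulr_natl mulrCA ler_wpM2l.
have TB u v m : (forall b, continuous (u b)) -> (forall b, continuous (v b)) ->
    (forall b t, `|u b t - v b t| <= m) -> forall c t, `|T u c t - T v c t| <= m / 2.
  move=> cu cv uv c t; have m0 : 0 <= m by exact: le_trans (uv c t).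
  rewrite /T opprD addrACA subrr add0r; apply: PB (clamp01 t); try exact: cS.
    by rewrite divr_ge0.
  exact: SB.
pose u k := iter k T (fun c _ => y0 c).
have cu k c : continuous (u k c).
  elim: k c => [|k IH] c; first by move=> t; exact: cst_continuous.
  by apply: cT => b; exact: IH.
pose C : R := \sum_c `|y0 c|.
have yC c : `|y0 c| <= C by rewrite /C (bigD1 c)//= lerDl sumr_ge0.
have uC k : forall c t, `|u k.+1 c t - u k c t| <= C * 2^-1 ^+ k.
  elim: k => [|k IH] c t; last first.
    rewrite exprSr mulrA; exact: (TB (u k.+1) (u k) _ (cu k.+1) (cu k) IH).
  rewrite expr0 mulr1 /= /T addrAC subrr add0r.
  have C0 : 0 <= C by exact: sumr_ge0.
  have [F0 dF] := PP _ (cS (u 0%N) c (cu 0%N)).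
  apply: bound_of_derivative (clamp01 t) => //; first by move=> s /m1; exact: dF.
  move=> s _; have := SB (u 0%N) (fun _ _ => 0) C _ c s.
  rewrite {2}/S big1 ?subr0; last by move=> b _; rewrite mul0r.
  move=> /(_ _)/le_trans; apply; first by move=> b w; rewrite subr0; exact: yC.
  by rewrite ler_pdivrMr// ler_peMr// ler1n.
have /choice[Y YP] : forall ct : 'I_n * R, exists l, forall k,
    `|u k ct.1 ct.2 - l| <= 2 * C * 2^-1 ^+ k.
  by move=> [c t]; apply: geometric_limit => k; exact: uC.
pose y c t := Y (c, t).
have uy k c t : `|u k c t - y c t| <= 2 * C * 2^-1 ^+ k by exact: (YP (c, t)).
have small (e : R) : 0 < e -> exists k, 2 * C * 2^-1 ^+ k < e.
  move=> e0.
  have : geometric (2 * C) (2^-1 : R) @ \oo --> (0 : R).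
    by apply: cvg_geometric; rewrite ger0_norm// invf_lt1// ltr1n.
  move/cvgrPdist_lt => /(_ e e0)[k _ /(_ k (leqnn k))] /=.
  by rewrite sub0r normrN => H; exists k; exact: le_lt_trans (ler_norm _) H.
have cy c : continuous (y c).
  move=> t; apply/cvgrPdist_lt => e e0.
  have e30 : 0 < e / 3 by rewrite divr_gt0.
  have [k kP] := small _ e30.
  have := cu k c t; move/cvgrPdist_lt => /(_ _ e30); apply: filterS => s H.
  have -> : y c t - y c s = (u k c t - u k c s) - (u k c t - y c t) + (u k c s - y c s) by ring.
  have := le_lt_trans (uy k c t) kP; have := le_lt_trans (uy k c s) kP.
  move: (u k c t - u k c s) (u k c t - y c t) (u k c s - y c s) H => p q w H1 H2 H3.
  rewrite (le_lt_trans (ler_normD _ _))//.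
  rewrite (@le_lt_trans _ _ (`|p| + `|q| + `|w|)) ?lerD2r ?ler_normB//.
  by move: `|p| `|q| `|w| H1 H2 H3 => p' q' w'; clear; lra.
have yT c t : y c t = T y c t.
  apply/eqP; rewrite -subr_eq0 -normr_le0; apply/ler_addgt0Pr => e e0; rewrite add0r.
  have e20 : 0 < e / 2 by rewrite divr_gt0.
  have [k kP] := small _ e20.
  have -> : y c t - T y c t = (u k.+1 c t - T y c t) - (u k.+1 c t - y c t) by ring.
  rewrite (le_trans (ler_normB _ _))// [leRHS]splitr lerD//.
    have := TB (u k) y _ (cu k) cy (uy k) c t => /le_trans; apply.
    rewrite ltW// (le_lt_trans _ kP)// ler_pdivrMr// ler_peMr ?ler1n//.
    exact: le_trans (uy k c t).
  rewrite (le_trans (uy _ _ _))// ltW// (le_lt_trans _ kP)//.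
  rewrite exprSr mulrA ler_pdivrMr// ler_peMr ?ler1n//.
  exact: le_trans (uy k c t).
(* The fixed point y is constant outside [0, 1]. The integral with unclamped upper limit agrees with
   it on [0, 1] and has two-sided derivatives at both endpoints. *)
exists (fun c t => y0 c + P (S y c) t); split=> [c|c t t01].
  by have [-> _] := PP _ (cS y c cy); rewrite addr0.
have -> : \sum_b (y0 b + P (S y b) t) * a b c t = 0 + S y c t.
  rewrite add0r; apply: eq_bigr => b _; congr (_ * _).
  by rewrite yT /T clamp_id.
have [_ dF] := PP _ (cS y c cy).
by apply: is_deriveD; exact: dF (m1 t t01).
Qed.

End OneVariable.

(** * Flat overdetermined linear systems *)

Section FlatSystems.
Context {R : realType}.
Notation space := 'rV[R]_3.

Lemma row_mul_bound n (v : 'rV[R]_n) (A : 'M[R]_n) (a b : R) :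
  (forall j, `|v 0 j| <= a) -> (forall j k, `|A j k| <= b) ->
  forall k, `|(v *m A) 0 k| <= n%:R * (a * b).
Proof.
move=> va Ab k; rewrite mxE (le_trans (ler_norm_sum _ _ _))//.
apply: (@le_trans _ _ (\sum_(j < n) a * b)).
  by apply: ler_sum => j _; rewrite normrM ler_pM.
by rewrite sumr_const card_ord -[_ *+ n]mulr_natl.
Qed.

Lemma row_mul_bound1 n (v : 'rV[R]_n) (A : 'M[R]_n) (b : R) :
  (forall j k, `|A j k| <= b) ->
  forall k, `|(v *m A) 0 k| <= b * \sum_j `|v 0 j|.
Proof.
move=> Ab k; rewrite mxE (le_trans (ler_norm_sum _ _ _))// mulr_sumr.
by apply: ler_sum => j _; rewrite normrM mulrC ler_wpM2r.
Qed.

(* E is the error in predicting the transport along the ray to h + k from the one along the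
  ray to h; flatness cancels everything of first order in k. *)
Lemma transport_defect n (E Y : 'rV[R]_n) (a a' k b g r : 'M[R]_n) (t : R) :
  a' = a + k + t *: b + r -> b - g + k *m a - a *m k = 0 ->
  (E + Y + t *: (Y *m k)) *m a' - Y *m a - Y *m k - t *: (Y *m a *m k)
    - t *: (Y *m g) =
  E *m a' + (Y *m r + t *: (Y *m k *m (k + t *: b + r))).
Proof.
move=> -> fl.
have : Y *m b - Y *m g + Y *m k *m a - Y *m a *m k = 0.
  by rewrite -!mulmxA -mulmxBr -mulmxDr -mulmxBr fl mulmx0.
rewrite !(mulmxDl, mulmxDr) -!(scalemxAl, scalemxAr) ?(mulmxDl, mulmxDr)
  -?(scalemxAl, scalemxAr).
move: (Y *m b) (Y *m g) (Y *m a) (Y *m k) (E *m a)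
  (E *m k) (E *m b) (E *m r) (Y *m r) (Y *m k *m k) (Y *m k *m b) (Y *m k *m r)
  (Y *m k *m a) (Y *m a *m k).
move=> Yb Yg Ya Yk Ea Ek Eb Er Yr Ykk Ykb Ykr Yka Yak /rowP H.
apply/rowP => c; move: (H c); rewrite !mxE => Hc.
have -> : Yb 0 c = Yg 0 c - Yka 0 c + Yak 0 c.
  by apply/eqP; rewrite -subr_eq0 -[X in _ == X]Hc; apply/eqP; ring.
by ring.
Qed.

Lemma locally_bounded (I : finType) (F : I -> space -> R) p :
  (forall i, {for p, continuous (F i)}) ->
  exists2 B : R, 0 <= B & \forall x \near p, forall i, `|F i x| <= B.
Proof.
move=> cF; exists (\sum_i (`|F i p| + 1)); first by apply: sumr_ge0 => i _; exact: addr_ge0.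
apply: (@filter_forall _ _ (fun i x => `|F i x| <= \sum_i (`|F i p| + 1)) (nbhs p)) => i.
have /cvgrPdist_lt/(_ _ ltr01) := cF i; apply: filterS => x Fx.
apply: (@le_trans _ _ (`|F i p| + 1)); last first.
  by rewrite (bigD1 i)//= lerDl sumr_ge0// => j _; exact: addr_ge0.
rewrite -[F i x](subKr (F i p)) (le_trans (ler_normB _ _))// lerD2l.
exact: ltW.
Qed.

Lemma sum3_bound (k : space) (a : 'I_3 -> R) (B : R) : 0 <= B ->
  (forall i, `|a i| <= B) -> `|\sum_i k 0 i * a i| <= 3 * (`|k| * B).
Proof.
move=> B0 aB; rewrite (le_trans (ler_norm_sum _ _ _))//.
apply: (@le_trans _ _ (\sum_(i < 3) `|k| * B)).
  by apply: ler_sum => i _; rewrite normrM ler_pM// coord_le_norm.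
by rewrite sumr_const card_ord -[_ *+ 3]mulr_natl.
Qed.

Lemma ball_convex (p : space) (r t : R) x k : ball p r x -> ball p r (x + k) ->
  0 <= t <= 1 -> ball p r (x + t *: k).
Proof.
rewrite -!ball_normE /= => xr xkr /andP[t0 t1].
have -> : p - (x + t *: k) = (1 - t) *: (p - x) + t *: (p - (x + k)).
  rewrite !scalerDr !scalerBl !scale1r !scalerN !scalerDr !opprD.
  by apply/rowP => j; rewrite !mxE; ring.
rewrite (le_lt_trans (ler_normD _ _))// !normrZ.
rewrite (ger0_norm t0) ger0_norm ?subr_ge0//.
move: t1; rewrite le_eqVlt => /predU1P[->|t1].
  by rewrite subrr mul0r add0r mul1r.
have -> : r = (1 - t) * r + t * r by ring.
by rewrite ltr_leD// ?ltr_pM2l ?subr_gt0// ler_wpM2l// ltW.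
Qed.

Lemma lipschitz_ball f p (r B : R) : smooth (ball p r) f -> 0 <= B ->
  (forall x, ball p r x -> forall i, `|partial i f x| <= B) ->
  forall x k : space, ball p r x -> ball p r (x + k) ->
    `|f (x + k) - f x| <= 3 * (`|k| * B).
Proof.
move=> sf B0 fB x k xr xkr.
have [t t01|c c01 ->] := @mvt_line _ f x k.
  by apply: smooth_differentiable sf _; exact: ball_convex.
by apply: sum3_bound => // i; apply: fB; exact: ball_convex.
Qed.

(** The constant 9 is a factor 3 from the sum over directions in the mean value theorem for [f] and
    another 3 from the Lipschitz bound of each partial derivative. *)
Lemma taylor_ball f p (r B : R) : smooth (ball p r) f -> 0 <= B ->
  (forall x, ball p r x -> forall i j, `|partial j (partial i f) x| <= B) ->
  forall x k : space, ball p r x -> ball p r (x + k) ->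
    `|f (x + k) - f x - \sum_i k 0 i * partial i f x| <= 9 * B * `|k| ^+ 2.
Proof.
move=> sf B0 fB x k xr xkr.
have [t t01|c c01 ->] := @mvt_line _ f x k.
  by apply: smooth_differentiable sf _; exact: ball_convex.
rewrite -sumrB; under eq_bigr do rewrite -mulrBr.
have D i : `|partial i f (x + c *: k) - partial i f x| <= 3 * (`|k| * B).
  apply: (@le_trans _ _ (3 * (`|c *: k| * B))).
    apply: (@lipschitz_ball (partial i f) p r B) => //; first exact: smooth_partial.
    by move=> y yr j; exact: fB.
    exact: ball_convex.
  rewrite ler_wpM2l// ler_wpM2r// normrZ ler_piMl//.
  by case/andP: c01 => c0 c1; rewrite ger0_norm.
have := @sum3_bound k (fun i => partial i f (x + c *: k) - partial i f x) (3 * (`|k| * B)).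
move=> /(_ _ D)/le_trans; apply; first by rewrite !mulr_ge0.
by rewrite le_eqVlt; apply/orP; left; apply/eqP; move: `|k| => kk; ring.
Qed.

Lemma is_derive_mul1 (f g : R -> R) (a b t : R) : is_derive t 1 f a ->
  is_derive t 1 g b -> is_derive t 1 (fun s => f s * g s) (a * g t + f t * b).
Proof.
move=> df dg; apply: (@is_derive_eq _ _ _ (f * g)).
by rewrite /GRing.scale /= addrC mulrC.
Qed.

Lemma is_derive_sub1 (f g : R -> R) (a b t : R) : is_derive t 1 f a ->
  is_derive t 1 g b -> is_derive t 1 (fun s => f s - g s) (a - b).
Proof. by move=> df dg; exact: is_deriveB. Qed.

Lemma is_derive_sum1 n (f : 'I_n -> R -> R) (a : 'I_n -> R) (t : R) :
  (forall i, is_derive t 1 (f i) (a i)) ->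
  is_derive t 1 (fun s => \sum_i f i s) (\sum_i a i).
Proof. by move=> df; rewrite -fct_sumE; exact: is_derive_sum. Qed.

(** * Transport along the rays from a base point *)

Section Transport.
Variables (n : nat) (A : 'I_n -> 'I_n -> 'I_3 -> space -> R) (p : space).
Variables (r B : R) (y0 : 'I_n -> R).
Hypotheses (r0 : 0 < r) (B0 : 0 <= B) (rB : n%:R * (3 * (r * B)) <= 2^-1).
Hypothesis sA : forall a b i, smooth (ball p r) (A a b i).
Hypothesis A0 : forall x, ball p r x -> forall a b i, `|A a b i x| <= B.
Hypothesis A1 : forall x, ball p r x -> forall a b i j,
  `|partial j (A a b i) x| <= B.
Hypothesis A2 : forall x, ball p r x -> forall a b i j l,
  `|partial l (partial j (A a b i)) x| <= B.
Hypothesis flat : forall x, ball p r x -> forall a c i j,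
  partial i (A a c j) x + \sum_b A a b i x * A b c j x =
  partial j (A a c i) x + \sum_b A a b j x * A b c i x.

(** A bound for the coefficients along any ray of length below r; [rB] is then the smallness
    condition of [linear_ode] and [small_growth]. *)
Let L := 3 * (r * B).
Let C0 := \sum_c `|y0 c|.

Let L0 : 0 <= L. Proof. by rewrite /L !mulr_ge0// ltW. Qed.
Let C00 : 0 <= C0. Proof. exact: sumr_ge0. Qed.

Let ball_ray (h : space) (t : R) : `|h| < r -> 0 <= t <= 1 ->
  ball p r (p + t *: h).
Proof.
move=> hr t01; apply: ball_convex => //; first exact: ballxx.
by rewrite -ball_normE /= opprD addrA subrr sub0r normrN.
Qed.

Let al (h : space) (b c : 'I_n) (t : R) : R :=
  \sum_i h 0 i * A b c i (p + clamp t *: h).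

Let al_bound (h : space) b c t : `|h| < r -> `|al h b c t| <= L.
Proof.
move=> hr; have hb := ball_ray hr (clamp01 t).
apply: (@le_trans _ _ (3 * (`|h| * B))); first by apply: sum3_bound => // i; exact: A0.
by rewrite ler_wpM2l// ler_wpM2r// ltW.
Qed.

Let al_continuous (h : space) b c : `|h| < r -> continuous (al h b c).
Proof.
move=> hr t; apply: (@cvg_big _ _ +%R 0) => [|i _]; first exact: add_continuous.
apply: cvgMr.
apply: (@continuous_comp _ _ _ (fun t : R => p + clamp t *: h) (A b c i)); last first.
  exact: smooth_continuous (sA b c i) (ball_ray hr (clamp01 t)).
apply: (@cvgD _ _ _ _ _ (fun=> p)); first exact: cvg_cst.
by apply: cvgZr_tmp; exact: continuous_clamp.
Qed.

(** The bound comes from [small_growth] for the deviation of Y from y0, whose forcing term is at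
    most L * C0: the deviation is at most 2 n L C0 <= C0. *)
Lemma transport_exists : exists Y : space -> 'I_n -> R -> R, forall h : space, `|h| < r ->
  [/\ forall c, Y h c 0 = y0 c,
     forall c (t : R), 0 <= t <= 1 -> is_derive t 1 (Y h c)
       (\sum_b Y h b t * \sum_i h 0 i * A b c i (p + t *: h)) &
     forall c (t : R), 0 <= t <= 1 -> `|Y h c t| <= 2 * C0].
Proof.
pose Q (h : space) (Y : 'I_n -> R -> R) := `|h| < r ->
  [/\ forall c, Y c 0 = y0 c,
     forall c (t : R), 0 <= t <= 1 -> is_derive t 1 (Y c)
       (\sum_b Y b t * \sum_i h 0 i * A b c i (p + t *: h)) &
     forall c (t : R), 0 <= t <= 1 -> `|Y c t| <= 2 * C0].
have /choice[Y YP] : forall h, exists Y, Q h Y; last by exists Y.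
rewrite /Q {Q}.
move=> h; have [hr|_] := boolP (`|h| < r); last by exists (fun _ _ => 0).
have [Y [Y0 dY]] := @linear_ode _ n (al h) L y0
  (fun b c => al_continuous hr) (fun b c t => al_bound b c t hr) rB.
exists Y => _; split => // [c t t01|c t t01].
  have := dY c t t01; congr is_derive; apply: eq_bigr => b _.
  by rewrite /al clamp_id.
have := @small_growth _ n (fun c t => Y c t - y0 c)
  (fun c t => \sum_b Y b t * al h b c t) L (L * C0) L0 (mulr_ge0 L0 C00) rB.
have Z0 (c' : 'I_n) : Y c' 0 - y0 c' = 0 by rewrite Y0 subrr.
move=> /(_ Z0 _ _ t t01); set S := \sum_c0 _ => H.
have SC : S <= C0.
  apply: le_trans (H _ _) _.
  - move=> c' t' t01'; rewrite -[X in is_derive _ _ _ X]subr0.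
    by apply: is_derive_sub1; exact: dY.
  - move=> c' t' t01'; rewrite -mulrDr /C0 -big_split /=.
    rewrite (le_trans (ler_norm_sum _ _ _))// mulr_sumr ler_sum// => b _.
    rewrite normrM mulrC ler_pM// ?al_bound//.
    by rewrite -{1}[Y b t'](subrK (y0 b)) ler_normD.
  - rewrite mulrCA mulrA mulrA -[leRHS]mul1r ler_wpM2r//.
    by rewrite mulrAC -ler_pdivlMr// mul1r.
have : `|Y c t - y0 c| <= S by rewrite /S (bigD1 c)//= lerDl sumr_ge0.
have : `|y0 c| <= C0 by rewrite /C0 (bigD1 c)//= lerDl sumr_ge0.
move=> H1 H2; rewrite -[Y c t](subrK (y0 c)) (le_trans (ler_normD _ _))//.
by rewrite mulr_natl mulr2n lerD// (le_trans H2).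
Qed.

Variable Y : space -> 'I_n -> R -> R.
Hypothesis Y0 : forall h : space, `|h| < r -> forall c, Y h c 0 = y0 c.
Hypothesis dY : forall h : space, `|h| < r -> forall c (t : R), 0 <= t <= 1 ->
  is_derive t 1 (Y h c) (\sum_b Y h b t * \sum_i h 0 i * A b c i (p + t *: h)).
Hypothesis YC : forall h : space, `|h| < r -> forall c (t : R), 0 <= t <= 1 ->
  `|Y h c t| <= 2 * C0.

Section Pair.
Variables (h k : space).
Hypotheses (hr : `|h| < r) (hkr : `|h + k| < r).

(** Along the rays to h and h + k the equations are Y' = Y a and Y' = Y a'. In a' = a + ka + t be +
    rho the term t be is the first-order change of a due to the moved base point, and rho is
    quadratic in k. The time derivative of ka is ga, and E is the error of the prediction Y + t Y
    ka. *)
Let a t : 'M[R]_n := \matrix_(b, c) \sum_i h 0 i * A b c i (p + t *: h).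
Let a' t : 'M[R]_n := \matrix_(b, c) \sum_i (h + k) 0 i * A b c i (p + t *: (h + k)).
Let ka t : 'M[R]_n := \matrix_(b, c) \sum_i k 0 i * A b c i (p + t *: h).
Let be t : 'M[R]_n := \matrix_(b, c)
  \sum_i h 0 i * \sum_j k 0 j * partial j (A b c i) (p + t *: h).
Let ga t : 'M[R]_n := \matrix_(b, c)
  \sum_i k 0 i * \sum_j h 0 j * partial j (A b c i) (p + t *: h).
Let rho t : 'M[R]_n := a' t - (a t + ka t + t *: be t).
Let row t : 'rV[R]_n := \row_c Y h c t.
Let E c t := Y (h + k) c t - Y h c t - t * \sum_b Y h b t * ka t b c.
Let Erow t : 'rV[R]_n := \row_c E c t.

Let K := `|k|.
(** P bounds rho / K^2: 27 r B comes from the Taylor remainders of the coefficients, summed along h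
    + k, and 9 B from the product of k with the first-order change. Q bounds (ka + t be + rho) / K,
    one factor K of rho being estimated by 2 r. M bounds the forcing term of the error equation
    divided by K^2. *)
Let P := 27 * (r * B) + 9 * B.
Let Q := 3 * B + 9 * (r * B) + 2 * (r * P).
Let M := n%:R * (2 * C0 * P) + n%:R * (n%:R * (2 * C0 * (3 * B)) * Q).

Let le3 (x y X : R) : 0 <= X -> x <= y -> 3 * (x * X) <= 3 * (y * X).
Proof. by move=> X0 xy; rewrite ler_wpM2l// ler_wpM2r. Qed.

Let P0 : 0 <= P. Proof. by rewrite /P addr_ge0 ?mulr_ge0// ltW. Qed.
Let K0 : 0 <= K. Proof. exact: normr_ge0. Qed.
Let Q0 : 0 <= Q. Proof. by rewrite /Q !addr_ge0 ?mulr_ge0// ltW. Qed.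
Let M0 : 0 <= M. Proof. by rewrite /M addr_ge0 ?mulr_ge0. Qed.

Let K2r : K <= 2 * r.
Proof.
have -> : K = `|(h + k) - h| by rewrite addrC addKr.
by rewrite (le_trans (ler_normB _ _))// mulr_natl mulr2n lerD// ltW.
Qed.

Let ka_bound t b c : 0 <= t <= 1 -> `|ka t b c| <= 3 * (K * B).
Proof. by move=> t01; rewrite mxE; apply: sum3_bound => // i; exact/A0/ball_ray. Qed.

Let be_bound t b c : 0 <= t <= 1 -> `|be t b c| <= 9 * (r * B) * K.
Proof.
move=> t01; rewrite mxE; apply: (@le_trans _ _ (3 * (`|h| * (3 * (K * B))))).
  apply: sum3_bound; first by rewrite !mulr_ge0.
  by move=> i; apply: sum3_bound => // j; exact/A1/ball_ray.
have -> : 9 * (r * B) * K = 3 * (r * (3 * (K * B))) by ring.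
by apply: le3; [rewrite !mulr_ge0|exact: ltW].
Qed.

Let rho_bound t b c : 0 <= t <= 1 -> `|rho t b c| <= P * K ^+ 2.
Proof.
move=> t01; have [t0 t1] := andP t01.
pose u i := A b c i (p + t *: h + t *: k) - A b c i (p + t *: h)
  - \sum_j (t *: k) 0 j * partial j (A b c i) (p + t *: h).
have -> : rho t b c = \sum_i (h + k) 0 i * u i +
    t * \sum_i k 0 i * \sum_j k 0 j * partial j (A b c i) (p + t *: h).
  rewrite /rho !mxE mulr_sumr -!(sumrB, big_split) /= mulr_sumr -big_split /=.
  apply: eq_bigr => i _.
  rewrite /u !mxE [t *: (h + k)]scalerDr addrA.
  under [X in _ - _ - X]eq_bigr do rewrite mxE -mulrA.
  rewrite -mulr_sumr.
  move: (\sum_j _) (A b c i (p + t *: h)) (A b c i _) (h 0 i) (k 0 i) => S a1 a2 hi ki.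
  by ring.
rewrite /P mulrDl (le_trans (ler_normD _ _))// lerD//.
  apply: (@le_trans _ _ (3 * (`|h + k| * (9 * B * K ^+ 2)))).
    apply: sum3_bound; first by rewrite !mulr_ge0.
    move=> i; rewrite /u (le_trans (@taylor_ball _ p r B _ _ _ _ _ _ _))//.
    - by move=> x xr j l; exact: A2.
    - exact: ball_ray.
    - by rewrite -addrA -scalerDr; exact: ball_ray.
    - rewrite ler_wpM2l ?mulr_ge0// normrZ (ger0_norm t0) exprMn ler_piMl ?exprn_ge0//.
      by rewrite expr_le1.
  have -> : 27 * (r * B) * K ^+ 2 = 3 * (r * (9 * B * K ^+ 2)) by ring.
  by apply: le3; [rewrite !mulr_ge0|exact: ltW].
rewrite normrM (ger0_norm t0) (@le_trans _ _ (1 * (3 * (K * (3 * (K * B))))))//.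
  rewrite ler_pM//; apply: sum3_bound; first by rewrite !mulr_ge0.
  by move=> i; apply: sum3_bound => // j; exact/A1/ball_ray.
by rewrite le_eqVlt; apply/orP; left; apply/eqP; ring.
Qed.

(** The curvature of the connection with coefficients [A], evaluated on the pair of directions h,
    k. *)
Let flat_ray t : 0 <= t <= 1 ->
  be t - ga t + ka t *m a t - a t *m ka t = 0.
Proof.
move=> t01; have xb := ball_ray hr t01.
pose x := p + t *: h.
pose AA i : 'M[R]_n := \matrix_(b, c) A b c i x.
pose D i j : 'M[R]_n := \matrix_(b, c) partial j (A b c i) x.
have aE : a t = \sum_i h 0 i *: AA i.
  apply/matrixP => b c; rewrite !mxE summxE; apply: eq_bigr => i _.
  by rewrite !mxE.
have kE : ka t = \sum_i k 0 i *: AA i.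
  apply/matrixP => b c; rewrite !mxE summxE; apply: eq_bigr => i _.
  by rewrite !mxE.
have bE : be t = \sum_i \sum_j (h 0 i * k 0 j) *: D i j.
  apply/matrixP => b c; rewrite !mxE summxE; apply: eq_bigr => i _.
  by rewrite summxE mulr_sumr; apply: eq_bigr => j _; rewrite !mxE mulrA.
have gE : ga t = \sum_i \sum_j (h 0 i * k 0 j) *: D j i.
  rewrite exchange_big /=.
  apply/matrixP => b c; rewrite !mxE summxE; apply: eq_bigr => i _.
  rewrite summxE mulr_sumr; apply: eq_bigr => j _; rewrite !mxE mulrA.
  by rewrite [k 0 i * _]mulrC.
have kaE : ka t *m a t = \sum_i \sum_j (h 0 i * k 0 j) *: (AA j *m AA i).
  rewrite aE kE mulmx_sumr; apply: eq_bigr => i _.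
  rewrite mulmx_suml; apply: eq_bigr => j _.
  by rewrite -scalemxAl -scalemxAr scalerA mulrC.
have akE : a t *m ka t = \sum_i \sum_j (h 0 i * k 0 j) *: (AA i *m AA j).
  rewrite aE kE mulmx_suml; apply: eq_bigr => i _.
  rewrite mulmx_sumr; apply: eq_bigr => j _.
  by rewrite -scalemxAl -scalemxAr scalerA.
rewrite kaE akE bE gE -!(sumrB, big_split) /= big1// => i _.
rewrite -!(sumrB, big_split) /= big1// => j _.
rewrite -!(scalerBr, scalerDr).
suff -> : D i j - D j i + AA j *m AA i - AA i *m AA j = 0 by rewrite scaler0.
apply/matrixP => b c; rewrite !mxE.
have := flat xb b c i j.
rewrite -/x.
under [X in _ + X - _ = _]eq_bigr do rewrite !mxE.
under [X in _ + _ - X = _]eq_bigr do rewrite !mxE.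
move: (\sum_b0 A b b0 i x * _) (\sum_b0 A b b0 j x * _) (partial i _ x) (partial j _ x).
move=> s1 s2 d1 d2 H; have -> : d2 = d1 + s1 - s2 by rewrite H addrK.
by ring.
Qed.

Let M_bound t : 0 <= t <= 1 -> forall c,
  `|(row t *m rho t + t *: (row t *m ka t *m (ka t + t *: be t + rho t))) 0 c| <=
  M * K ^+ 2.
Proof.
move=> t01 c; have [t0 t1] := andP t01.
have rowB j : `|row t 0 j| <= 2 * C0 by rewrite mxE; exact: YC.
have C20 : 0 <= 2 * C0 by rewrite mulr_ge0.
rewrite mxE (le_trans (ler_normD _ _))// /M mulrDl lerD//.
  have -> : n%:R * (2 * C0 * P) * K ^+ 2 = n%:R * (2 * C0 * (P * K ^+ 2)) by ring.
  by apply: row_mul_bound => // j l; exact: rho_bound.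
rewrite mxE normrM (ger0_norm t0) -[leRHS]mul1r ler_pM//.
have -> : n%:R * (n%:R * (2 * C0 * (3 * B)) * Q) * K ^+ 2 =
  n%:R * (n%:R * (2 * C0 * (3 * (K * B))) * (Q * K)) by ring.
apply: row_mul_bound => [j|j l].
  by apply: row_mul_bound => // j' l'; exact: ka_bound.
have -> : (ka t + t *: be t + rho t) j l = ka t j l + t * be t j l + rho t j l.
  by rewrite [LHS]mxE [X in X + _]mxE [X in _ + X + _]mxE.
have -> : Q * K = 3 * B * K + 9 * (r * B) * K + 2 * (r * P) * K by rewrite /Q; ring.
rewrite (le_trans (ler_normD _ _))// lerD//.
  rewrite (le_trans (ler_normD _ _))// lerD//.
    have -> : 3 * B * K = 3 * (K * B) by ring.
    exact: ka_bound.
  by rewrite normrM (ger0_norm t0) -[leRHS]mul1r ler_pM// be_bound.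
apply: (le_trans (rho_bound _ _ t01)).
have -> : 2 * (r * P) * K = P * (2 * r * K) by ring.
by rewrite ler_wpM2l// expr2 ler_wpM2r.
Qed.

(** The error satisfies E(0) = 0 and E' = E a' + O(|k|^2), so [small_growth] keeps it quadratic in k
    up to time 1. Hence the endpoint of the transport is differentiable in h, with exactly the
    derivatives that the system prescribes. *)
Lemma transport_pair c :
  `|Y (h + k) c 1 - Y h c 1 - \sum_b Y h b 1 * \sum_i k 0 i * A b c i (p + h)| <=
  2 * (n%:R * M) * `|k| ^+ 2.
Proof.
have i1 : (0 : R) <= (1 : R) <= (1 : R) by rewrite ler01 lexx.
have := @small_growth _ n E (fun c t => (Erow t *m a' t +
  (row t *m rho t + t *: (row t *m ka t *m (ka t + t *: be t + rho t)))) 0 c)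
  L (M * K ^+ 2) L0 (mulr_ge0 M0 (exprn_ge0 _ K0)) rB.
move=> /(_ _ _ _ 1 i1) H.
have -> : Y (h + k) c 1 - Y h c 1 - \sum_b Y h b 1 * \sum_i k 0 i * A b c i (p + h) = E c 1.
  rewrite /E mul1r; congr (_ - _); apply: eq_bigr => b _.
  by rewrite mxE; congr (_ * _); apply: eq_bigr => i _; rewrite scale1r.
apply: (@le_trans _ _ (\sum_c `|E c 1|)).
  by rewrite [leRHS](bigD1 c)//= lerDl sumr_ge0.
rewrite -mulrA -[X in _ <= _ * X]mulrA; apply: H.
- by move=> c'; rewrite /E mul0r subr0 !Y0// subrr.
- move=> c' t t01.
  have dka b : is_derive t 1 (fun t => ka t b c') (ga t b c').
    rewrite [ga t b c']mxE /ka; under eq_fun do rewrite mxE.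
    apply: is_derive_sum1 => i; rewrite -[X in is_derive _ _ _ X]add0r -[X in X + _](mul0r (A b c' i (p + t *: h))).
    apply: is_derive_mul1; apply: is_derive_line.
    exact: smooth_differentiable (sA b c' i) (ball_ray hr t01).
  have tE := transport_defect (Erow t) (row t) (a' := a' t) (r := rho t) _ (flat_ray t01).
  rewrite -tE; last by rewrite /rho addrC subrK.
  have rowE : Erow t + row t + t *: (row t *m ka t) = \row_c Y (h + k) c t.
    apply/rowP => b; rewrite !mxE /E.
    under [X in _ + t * X]eq_bigr => b' _ do rewrite mxE.
    by ring.
  rewrite rowE.
  have D1 := dY hkr c' t01; have D2 := dY hr c' t01.
  have D3 := is_derive_mul1 (is_derive_id t 1)
    (is_derive_sum1 (fun b => is_derive_mul1 (dY hr b t01) (dka b))).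
  apply: (is_derive_eq (is_derive_sub1 (is_derive_sub1 D1 D2) D3)).
  rewrite !mxE -!addrA; congr (_ + _).
    by apply: eq_bigr => b _; rewrite !mxE.
  congr (_ + _); first by congr (- _); apply: eq_bigr => b _; rewrite !mxE.
  rewrite mul1r opprD; congr (_ + _); first by congr (- _); apply: eq_bigr => b _; rewrite !mxE.
  rewrite -opprD -mulrDr; congr (- (_ * _)); rewrite -big_split /=.
  apply: eq_bigr => b _; rewrite !mxE; congr (_ * _ + _).
  by apply: eq_bigr => b' _; rewrite !mxE.
- move=> c' t t01; rewrite mxE (le_trans (ler_normD _ _))// lerD//.
    have := @row_mul_bound1 n (Erow t) (a' t) L _ c'.
    under eq_bigr do rewrite mxE; apply.
    move=> b c0; rewrite mxE; apply: (@le_trans _ _ (3 * (`|h + k| * B))).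
      by apply: sum3_bound => // i; exact/A0/ball_ray.
    by apply: le3 => //; exact: ltW.
  exact: M_bound.
Qed.

End Pair.

End Transport.

Lemma nbhs_ball_ex (P : space -> Prop) p : (\forall x \near p, P x) ->
  exists2 r : R, 0 < r & forall x, ball p r x -> P x.
Proof. by move=> /nbhs_ballP[r /= r0 rP]; exists r. Qed.

(* F is obtained by solving a linear ODE along each ray from p; by transport_pair the result
  satisfies the system in every direction. *)
Theorem flat_system n (A : 'I_n -> 'I_n -> 'I_3 -> space -> R) (U : set space)
    (p : space) (y0 : 'I_n -> R) : open U -> U p ->
  (forall a b i, smooth U (A a b i)) ->
  (forall x, U x -> forall a c i j,
    partial i (A a c j) x + \sum_b A a b i x * A b c j x =
    partial j (A a c i) x + \sum_b A a b j x * A b c i x) ->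
  exists r : R, [/\ 0 < r, ball p r `<=` U &
    exists F : 'I_n -> space -> R,
    [/\ forall c, F c p = y0 c, forall c, smooth (ball p r) (F c) &
      forall x, ball p r x -> forall c i,
        partial i (F c) x = \sum_b F b x * A b c i x]].
Proof.
move=> oU Up sA flat.
pose I := ('I_n * 'I_n * 'I_3)%type.
have [B1 B10 nB1] := @locally_bounded _ (fun i : I => A i.1.1 i.1.2 i.2) p
  (fun i => smooth_continuous (sA _ _ _) Up).
have [B2 B20 nB2] := @locally_bounded (I * 'I_3)%type
  (fun i => partial i.2 (A i.1.1.1 i.1.1.2 i.1.2)) p
  (fun i => smooth_continuous (smooth_partial _ (sA _ _ _)) Up).
have [B3 B30 nB3] := @locally_bounded (I * 'I_3 * 'I_3)%type
  (fun i => partial i.2 (partial i.1.2 (A i.1.1.1.1 i.1.1.1.2 i.1.1.2))) p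
  (fun i => smooth_continuous (smooth_partial _ (smooth_partial _ (sA _ _ _))) Up).
pose B := B1 + B2 + B3.
have nU : \forall x \near p, U x by exact: open_nbhs_nbhs.
have [r1 r10 r1P] := nbhs_ball_ex (filterI nU (filterI nB1 (filterI nB2 nB3))).
have B0 : 0 <= B by rewrite !addr_ge0.
(* Chosen for n * 3 * r * B <= 1/2; the added 1 keeps the denominator positive. *)
pose r2 : R := (6 * (n%:R * B) + 1)^-1.
have d0 : 0 < 6 * (n%:R * B) + 1 by rewrite ltr_wpDl// !mulr_ge0.
pose r := Num.min r1 r2.
have r0 : 0 < r by rewrite lt_min r10 invr_gt0.
have rr1 : r <= r1 by rewrite ge_min lexx.
have rB : n%:R * (3 * (r * B)) <= 2^-1.
  have rr2 : r <= r2 by rewrite ge_min lexx orbT.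
  have -> : n%:R * (3 * (r * B)) = 2^-1 * (r * (6 * (n%:R * B))) by field.
  rewrite -[leRHS]mulr1 ler_wpM2l//.
  apply: (@le_trans _ _ (r2 * (6 * (n%:R * B) + 1))); last by rewrite mulVf// gt_eqF.
  by apply: ler_pM; [exact: ltW|rewrite !mulr_ge0|exact: rr2|rewrite lerDl].
have rU x : ball p r x -> U x by move=> /(le_ball rr1)/r1P[].
have sAr a b i : smooth (ball p r) (A a b i) by exact: smooth_sub (sA a b i).
have A0 x : ball p r x -> forall a b i, `|A a b i x| <= B.
  move=> /(le_ball rr1)/r1P[_ [H _]] a b i.
  by rewrite (le_trans (H (a, b, i)))// /B -addrA lerDl addr_ge0.
have A1 x : ball p r x -> forall a b i j, `|partial j (A a b i) x| <= B.
  move=> /(le_ball rr1)/r1P[_ [_ [H _]]] a b i j.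
  by rewrite (le_trans (H (a, b, i, j)))// /B addrAC lerDr addr_ge0.
have A2 x : ball p r x -> forall a b i j l, `|partial l (partial j (A a b i)) x| <= B.
  move=> /(le_ball rr1)/r1P[_ [_ [_ H]]] a b i j l.
  by rewrite (le_trans (H (a, b, i, j, l)))// /B lerDr addr_ge0.
have flatr x : ball p r x -> forall a c i j,
    partial i (A a c j) x + \sum_b A a b i x * A b c j x =
    partial j (A a c i) x + \sum_b A a b j x * A b c i x.
  by move=> /rU; exact: flat.
have [Y YP] := transport_exists y0 r0 B0 rB sAr A0.
have Y0 h : `|h| < r -> forall c, Y h c 0 = y0 c by move=> /YP[].
have dY (h : space) : `|h| < r -> forall c (t : R), 0 <= t <= 1 ->
  is_derive t 1 (Y h c) (\sum_b Y h b t * \sum_i h 0 i * A b c i (p + t *: h)).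
  by move=> /YP[].
have YC (h : space) : `|h| < r -> forall c (t : R), 0 <= t <= 1 ->
  `|Y h c t| <= 2 * \sum_c `|y0 c| by move=> /YP[].
pose F c x := Y (x - p) c 1.
have inb x : ball p r x -> `|x - p| < r by rewrite -ball_normE /= distrC.
have key c x : ball p r x -> differentiable (F c) x /\
    forall i, partial i (F c) x = (\row_i \sum_b F b x * A b c i x : space) 0 i.
  move=> xr; apply/differentiable_epsP => e e0.
  (* The constant of [transport_pair] is independent of k, so the quadratic error is o(|k|). *)
  have [M est] : exists M : R, forall k : space, `|x - p + k| < r ->
    `|Y (x - p + k) c 1 - Y (x - p) c 1
      - \sum_b Y (x - p) b 1 * \sum_i k 0 i * A b c i (p + (x - p))| <=
    2 * M * `|k| ^+ 2.
    eexists => k kr.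
    exact: (transport_pair r0 B0 rB sAr A0 A1 A2 flatr Y0 dY YC (inb _ xr) kr c).
  have M0 : 0 < `|2 * M| + 1 by rewrite ltr_wpDl.
  near=> k.
  have kb : ball p r (x + k).
    near: k; apply: near0_add; apply: open_nbhs_nbhs; split => //.
    exact: ball_open.
  have hk : `|x - p + k| < r by rewrite addrAC; exact: inb.
  have := est k hk.
  have -> : p + (x - p) = x by rewrite addrC subrK.
  have -> : \sum_b Y (x - p) b 1 * \sum_i k 0 i * A b c i x =
      linear_form (\row_i \sum_b F b x * A b c i x) k.
    rewrite /linear_form; under [RHS]eq_bigr do rewrite mxE mulr_sumr.
    rewrite exchange_big /=; apply: eq_bigr => b _; rewrite mulr_sumr.
    by apply: eq_bigr => i _; rewrite mulrCA.
  rewrite /F [x + k - p]addrAC => /le_trans; apply.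
  apply: (@le_trans _ _ ((`|2 * M| + 1) * `|k| ^+ 2)).
    by rewrite ler_wpM2r// (le_trans (ler_norm _))// lerDl.
  rewrite expr2 mulrA ler_wpM2r// -ler_pdivlMl//.
  near: k; rewrite mulrC; have e1 : 0 < e / (`|2 * M| + 1) by rewrite divr_gt0.
  exact: (@nbhs0_le _ space).
exists r; split => //; exists F.
have pF c x i : ball p r x -> partial i (F c) x = \sum_b F b x * A b c i x.
  by move=> /(key c)[_ ->]; rewrite mxE.
split => [c|c|x xr c i]; last exact: pF.
(* At the base point the ray is constant, hence so is the transport along it. *)
- rewrite /F subrr; have n0 : `|0 : space| < r by rewrite normr0.
  have := @bound_of_derivative _ (fun t => Y 0 c t - y0 c)
    (fun t => \sum_b Y 0 b t * (\sum_i (0 : space) 0 i * A b c i (p + t *: 0)) - 0) 0.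
  move=> /(_ _ _ _ _ 1) H; apply/eqP; rewrite -subr_eq0 -normr_le0; apply: H.
  + exact: lexx.
  + by rewrite Y0// subrr.
  + by move=> t t01; apply: is_derive_sub1; exact: dY.
  + move=> t t01; rewrite subr0 big1 ?normr0// => b _.
    by rewrite big1 ?mulr0// => i _; rewrite mxE mul0r.
  + by rewrite ler01 lexx.
- apply: (@smooth_bootstrap _ 'I_n (ball p r) F (fun c i x => \sum_b F b x * A b c i x)).
  + exact: ball_open.
  + by move=> c' x /(key c')[].
  + by move=> c' i x; exact: pF.
  + move=> k CF c' i; apply: C_k_sum => [|b _]; first exact: ball_open.
    by apply: C_kM; [exact: ball_open|exact: CF|exact: sAr].
Unshelve. all: by end_near. Qed.

End FlatSystems.

#[local] Opaque jacobian partial.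

(** * The inverse function theorem *)

Section InverseFunction.
Context {R : realType}.
Notation space := 'rV[R]_3.

Lemma smooth_det n (U : set space) (M : space -> 'M[R]_n) : open U ->
  (forall i j, smooth U (fun x => M x i j)) -> smooth U (fun x => \det (M x)).
Proof.
move=> oU sM; rewrite /determinant; apply: smooth_sum => // s _.
apply: smoothM => //; first exact: smooth_cst.
by apply: smooth_prod => // i _.
Qed.

Lemma smooth_invmx n (U : set space) (M : space -> 'M[R]_n) i j : open U ->
  (forall i j, smooth U (fun x => M x i j)) ->
  (forall x, U x -> M x \in unitmx) ->
  smooth U (fun x => invmx (M x) i j).
Proof.
move=> oU sM uM.
apply: (@smooth_eq_on _ _ (fun x => (\det (M x))^-1 * cofactor (M x) j i)) => //.
  by move=> x /uM Mx; rewrite /invmx Mx !mxE.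
apply: smoothM => //.
  apply: smoothV => //; first exact: smooth_det.
  by move=> x /uM; rewrite unitmxE unitfE.
apply: smoothM => //; first exact: smooth_cst.
apply: smooth_det => // a b.
by apply: (@smooth_eq_on _ _ (fun x => M x (lift j a) (lift i b))) => // x _; rewrite !mxE.
Qed.

Lemma unitmx_ker0 n (M : 'M[R]_n) : (forall v : 'rV_n, v *m M = 0 -> v = 0) -> M \in unitmx.
Proof.
move=> H; rewrite -row_free_unit -kermx_eq0; apply/eqP/row_matrixP => i.
by rewrite row0; apply: H; rewrite -row_mul mulmx_ker row0.
Qed.

Lemma mulmx_norm_bound (M : 'M[R]_3) : exists2 m : R, 0 < m &
  forall v : space, `|v *m M| <= m * `|v|.
Proof.
pose b := \sum_i \sum_j `|M i j|.
have b0 : 0 <= b by apply: sumr_ge0 => i _; apply: sumr_ge0.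
have Mb i j : `|M i j| <= b.
  rewrite /b (bigD1 i)//= (bigD1 j)//= -addrA lerDl addr_ge0//; apply: sumr_ge0 => // k _.
  exact: sumr_ge0.
exists (3 * b + 1) => [|v]; first by rewrite ltr_wpDl// mulr_ge0.
apply: norm_le_coord => [|j]; first by rewrite mulr_ge0// addr_ge0// mulr_ge0.
apply: (le_trans (row_mul_bound (coord_le_norm v) Mb j)).
by rewrite mulrA mulrAC ler_wpM2r// lerDl.
Qed.

(** Strict differentiability: near p, [f] minus its linear part at p has partial derivatives below e
    / 3, and summing over three directions gives the Lipschitz constant e. *)
Lemma linear_approx (f : space -> space) U p (e : R) : open U -> U p ->
  smooth_map U f -> 0 < e -> exists r : R, [/\ 0 < r, ball p r `<=` U,
    forall x (k : space), ball p r x -> ball p r (x + k) ->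
      `|f (x + k) - f x - k *m 'J f p| <= e * `|k| &
    forall x (v : space), ball p r x -> `|v *m 'J f x - v *m 'J f p| <= e * `|v|].
Proof.
move=> oU Up sf e0; pose d := e / 3; have d0 : 0 < d by rewrite divr_gt0.
have df x j (Ux : U x) := smooth_differentiable (sf j) Ux.
have : \forall x \near p, U x /\ forall ij : 'I_3 * 'I_3,
    `|partial ij.1 (fun y => f y 0 ij.2) p - partial ij.1 (fun y => f y 0 ij.2) x| < d.
  apply: filterI; first exact: open_nbhs_nbhs.
  apply: (@filter_forall _ _ (fun (ij : 'I_3 * 'I_3) x =>
    `|partial ij.1 (fun y => f y 0 ij.2) p - partial ij.1 (fun y => f y 0 ij.2) x| < d) (nbhs p)).
  move=> [i j].
  have : {for p, continuous (partial i (fun y => f y 0 j))}.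
    by apply: smooth_continuous Up; exact: smooth_partial.
  by move/cvgrPdist_lt/(_ _ d0).
move=> /nbhs_ball_ex[r r0 rP]; exists r.
have rU x : ball p r x -> U x by move=> /rP[].
split => // [x k xr xkr|x v xr].
  apply: norm_le_coord => [|j]; first by rewrite mulr_ge0// ltW.
  pose u y := f y 0 j - linear_form (\row_i 'J f p i j) y.
  have su : smooth (ball p r) u.
    apply: smoothB; first exact: ball_open.
    - by apply: smooth_sub (sf j).
    - apply: smooth_sum => [|i _]; first exact: ball_open.
      by apply: smoothM; [exact: ball_open|exact: smooth_coord|exact: smooth_cst].
  have dlf y : differentiable (linear_form (\row_i 'J f p i j)) y /\
      forall i, partial i (linear_form (\row_i 'J f p i j)) y = 'J f p i j.
    have [|dlf pf] := (@differentiable_epsP _ (linear_form (\row_i 'J f p i j)) y (\row_i 'J f p i j)).2.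
      move=> e' e'0; near=> k'; rewrite /linear_form -!sumrB big1 ?normr0 => [|i _].
        by rewrite mulr_ge0// ltW.
      by rewrite [(y + k') 0 i]mxE; ring.
    by split => // i; rewrite pf mxE.
  have := @lipschitz_ball _ u p r d su (ltW d0) _ x k xr xkr.
  have -> : u (x + k) - u x = (f (x + k) - f x - k *m 'J f p) 0 j.
    rewrite /u !mxE.
    have -> : linear_form (\row_i 'J f p i j) (x + k) =
      linear_form (\row_i 'J f p i j) x + \sum_i k 0 i * 'J f p i j.
      rewrite /linear_form -big_split /=; apply: eq_bigr => i _; rewrite !mxE mulrDl.
      by [].
    move: (f (x + k) 0 j) (f x 0 j) (linear_form _ x) (\sum_i _) => a b c d'; ring.
  move=> H; apply: (le_trans (H _)); last first.
    by rewrite /d le_eqVlt; apply/orP; left; apply/eqP; field.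
  move=> y yr i; rewrite partialB; [|exact: df (rU _ yr)|by have [] := dlf y].
  have [_ ->] := dlf y.
  rewrite (jacobianE _ _ (fun j => df p j Up)) distrC.
  by have [_ /(_ (i, j))/ltW] := rP y yr.
rewrite -mulmxBr; apply: norm_le_coord => [|j]; first by rewrite mulr_ge0// ltW.
have -> : e * `|v| = 3%:R * (`|v| * d) by rewrite /d; field.
apply: row_mul_bound => [i|i l]; first exact: coord_le_norm.
rewrite [X in `|X|]mxE [X in `|_ + X|]mxE.
have Jx : 'J f x i l = partial i (fun y => f y 0 l) x.
  by apply: jacobianE => j'; exact: df (rU _ xr).
have Jp : 'J f p i l = partial i (fun y => f y 0 l) p.
  by apply: jacobianE => j'; exact: df Up.
have -> : 'J f x i l - 'J f p i l =
    partial i (fun y => f y 0 l) x - partial i (fun y => f y 0 l) p.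
  exact: (congr2 (fun a b => a - b) Jx Jp).
by rewrite distrC; have [_ /(_ (i, l))/ltW] := rP x xr.
Unshelve. all: by end_near. Qed.

(** Banach's fixed point theorem on a closed ball with ratio 1/2; the limit of the iterates is taken
    coordinate by coordinate. *)
Lemma contraction_point (T : space -> space) (x0 : space) (rho : R) : 0 < rho ->
  (forall x, `|x - x0| <= rho -> `|T x - x0| <= rho) ->
  (forall x y, `|x - x0| <= rho -> `|y - x0| <= rho -> `|T x - T y| <= 2^-1 * `|x - y|) ->
  exists2 x, `|x - x0| <= rho & T x = x.
Proof.
move=> rho0 Tb Tc.
pose x n := iter n T x0.
have [n0|C0] := leP (`|T x0 - x0|) 0.
  exists x0; first by rewrite subrr normr0 ltW.
  by move: n0; rewrite normr_le0 subr_eq0 => /eqP.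
have xb n : `|x n - x0| <= rho.
  by elim: n => [|n IH]; [rewrite subrr normr0 ltW|exact: Tb].
have xC n : `|x n.+1 - x n| <= `|T x0 - x0| * 2^-1 ^+ n.
  elim: n => [|n IH]; first by rewrite expr0 mulr1.
  apply: (le_trans (Tc _ _ (xb n.+1) (xb n))).
  by rewrite exprS mulrCA ler_wpM2l.
pose C := `|T x0 - x0|.
have /choice[l lP] : forall j, exists l, forall n, `|x n 0 j - l| <= 2 * C * 2^-1 ^+ n.
  move=> j; apply: geometric_limit => n; rewrite (le_trans _ (xC n))//.
  by have := coord_le_norm (x n.+1 - x n) j; rewrite !mxE.
pose z : space := \row_j l j.
have xz n : `|x n - z| <= 2 * C * 2^-1 ^+ n.
  apply: norm_le_coord => [|j]; first by rewrite !mulr_ge0 ?exprn_ge0// ltW.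
  by rewrite !mxE; exact: lP.
have small (e : R) : 0 < e -> exists n, 2 * C * 2^-1 ^+ n < e.
  move=> e0; have : geometric (2 * C) (2^-1 : R) @ \oo --> (0 : R).
    by apply: cvg_geometric; rewrite ger0_norm// invf_lt1// ltr1n.
  move/cvgrPdist_lt => /(_ e e0)[k _ /(_ k (leqnn k))] /=.
  by rewrite sub0r normrN => H; exists k; exact: le_lt_trans (ler_norm _) H.
have zb : `|z - x0| <= rho.
  apply/ler_addgt0Pr => e /small[n ne].
  have sub (a b c : space) : a - c = (b - c) - (b - a).
    by apply/rowP => j; rewrite !mxE; ring.
  rewrite (sub z (x n) x0).
  by rewrite (le_trans (ler_normB _ _))// lerD// (le_trans (xz n))// ltW.
exists z => //; apply/eqP; rewrite -subr_eq0 -normr_le0; apply/ler_addgt0Pr => e e0.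
rewrite add0r; have e20 : 0 < e / 2 by rewrite divr_gt0.
have [n ne] := small _ e20.
have -> : T z - z = (x n.+1 - z) - (T (x n) - T z).
  have sub (a b c : space) : a - b = (c - b) - (c - a).
    by apply/rowP => j; rewrite !mxE; ring.
  exact: sub.
rewrite (le_trans (ler_normB _ _))// [leRHS]splitr.
have hn k : 2 * C * 2^-1 ^+ k.+1 <= 2 * C * 2^-1 ^+ k.
  rewrite exprS ler_wpM2l ?mulr_ge0 ?ltW//.
  by rewrite gtr_pMl ?exprn_gt0// invf_lt1// ltr1n.
apply: lerD; first by rewrite (le_trans (xz _))// (le_trans (hn _))// ltW.
apply: (le_trans (Tc _ _ (xb n) zb)).
apply: (@le_trans _ _ (1 * `|x n - z|)); first by rewrite ler_wpM2r// invf_le1// ler1n.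
by rewrite mul1r (le_trans (xz n))// ltW.
Qed.

(** Openness is asserted for every open subset of [V], because a chart has to map every open subset
    of its domain onto an open set. *)
Theorem inverse_function (f : space -> space) U p : open U -> U p ->
  smooth_map U f -> 'J f p \in unitmx -> exists V : set space,
  [/\ open V, V p, V `<=` U, forall W, open W -> W `<=` V -> open (f @` W) &
    exists2 g : space -> space, forall x, V x -> g (f x) = x &
      smooth_map (f @` V) g].
Proof.
move=> oU Up sf uJ; pose J0 := 'J f p; pose Ji := invmx J0.
have df x j (Ux : U x) := smooth_differentiable (sf j) Ux.
have [m m0 Jm] := mulmx_norm_bound Ji.
(* As m bounds the inverse Jacobian at p, [f] followed by that inverse differs from the identity by
   a map with Lipschitz constant m e = 1/2. *)
pose e := (2 * m)^-1; have e0 : 0 < e by rewrite invr_gt0 mulr_gt0.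
have me : m * e = 2^-1 by rewrite /e; field; rewrite gt_eqF.
have [r [r0 rU fJ JJ]] := linear_approx oU Up sf e0.
have phi x y : ball p r x -> ball p r y ->
    `|(f y - f x) *m Ji - (y - x)| <= 2^-1 * `|y - x|.
  move=> xr yr; have yE : y = x + (y - x) by rewrite addrC subrK.
  have := fJ x (y - x) xr; rewrite -yE => /(_ yr) H.
  have -> : (f y - f x) *m Ji - (y - x) = (f y - f x - (y - x) *m J0) *m Ji.
    by rewrite [RHS]mulmxBl mulmxK.
  rewrite (le_trans (Jm _))// -me -mulrA ler_wpM2l// ltW//.
have inv_lip x y : ball p r x -> ball p r y -> `|y - x| <= 2 * m * `|f y - f x|.
  move=> xr yr; have := phi x y xr yr; have := Jm (f y - f x).
  have := ler_normB ((f y - f x) *m Ji) ((f y - f x) *m Ji - (y - x)).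
  rewrite subKr; move: `|y - x| `|_ *m _| `|f y - f x| `|_ - _| => a b c d; clear; lra.
have uJx x : ball p r x -> 'J f x \in unitmx.
  move=> xr; apply: unitmx_ker0 => v v0; apply/eqP; rewrite -normr_eq0.
  move: (JJ x v xr) v0; move: ('J f x) => A + A0; rewrite A0 sub0r normrN -/J0 => H1.
  have := Jm (v *m J0); rewrite mulmxK//.
  have := ler_wpM2l (ltW m0) H1; rewrite mulrA me.
  move: `|v| (normr_ge0 v) (m * `|v *m J0|) => a a0 b H2 H3.
  by rewrite eq_le a0 andbT; move: a0 H2 H3; clear; lra.
have opn W : open W -> W `<=` ball p r -> open (f @` W).
  move=> oW Wr; rewrite openE => _ [x0 Wx0 <-].
  have [rho2 rho20 rhoW] : exists2 rho2 : R, 0 < rho2 & forall x, ball x0 rho2 x -> W x.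
    by apply: nbhs_ball_ex; exact: open_nbhs_nbhs.
  pose rho := rho2 / 2; have rho0 : 0 < rho by rewrite divr_gt0.
  have inW x : `|x - x0| <= rho -> W x.
    move=> xrho; apply: rhoW; rewrite -ball_normE /= distrC (le_lt_trans xrho)//.
    by rewrite /rho ltr_pdivrMr// ltr_pMr// ltr1n.
  apply/nbhs_ballP; exists (rho * e); first by rewrite /= mulr_gt0.
  move=> y; rewrite -ball_normE /= => ye.
  (* A Newton map with frozen Jacobian: its fixed points are the preimages of y. *)
  pose T x := x + (y - f x) *m Ji.
  have xr x : `|x - x0| <= rho -> ball p r x by move=> /inW/Wr.
  have x0r : ball p r x0 by exact: Wr.
  have [x xrho|x x' xrho x'rho|x xrho Tx] := @contraction_point T x0 rho rho0.
  - have -> : T x - x0 = (y - f x0) *m Ji - ((f x - f x0) *m Ji - (x - x0)).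
      rewrite /T !mulmxBl; move: (y *m Ji) (f x *m Ji) (f x0 *m Ji) => a b c.
      by apply/rowP => j; rewrite !mxE; ring.
    rewrite (le_trans (ler_normB _ _))//.
    have := phi _ _ x0r (xr _ xrho); have := Jm (y - f x0).
    rewrite distrC in ye.
    have := ler_wpM2l (ltW m0) (ltW ye); rewrite mulrCA me.
    move: xrho; move: `|x - x0| `|y - f x0| => a b.
    move: `|(y - _) *m Ji| `|_ - (x - x0)| => c d; clear; lra.
  - have -> : T x - T x' = - ((f x - f x') *m Ji - (x - x')).
      rewrite /T !mulmxBl; move: (y *m Ji) (f x *m Ji) (f x' *m Ji) => a b c.
      by apply/rowP => j; rewrite !mxE; ring.
    by rewrite normrN; apply: phi; exact: xr.
  - exists x; first exact: inW.
    have : (y - f x) *m Ji = 0 by move/eqP: Tx; rewrite /T addrC -subr_eq0 addrK => /eqP.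
    move/(congr1 (fun v => v *m J0)); rewrite mulmxKV// mul0mx.
    by move/eqP; rewrite subr_eq0 => /eqP.
exists (ball p r); split=> //; [exact: ball_open|exact: ballxx|].
have /choice[g gP] : forall y, exists x, (f @` ball p r) y -> ball p r x /\ f x = y.
  move=> y; have [[x xr <-]|ny] := pselect ((f @` ball p r) y); first by exists x.
  by exists 0.
have gf x : ball p r x -> g (f x) = x.
  move=> xr; have [gr gE] : ball p r (g (f x)) /\ f (g (f x)) = f x by apply: gP; exists x.
  have := inv_lip _ _ xr gr; rewrite gE subrr normr0 mulr0 normr_le0 subr_eq0.
  by move/eqP.
exists g => //.
have oV : open (f @` ball p r) by apply: opn => //; exact: ball_open.
(* With h = g (y + k) - g y, the expansion of [f] at g y is solved for h; the bound |h| <= 2 m |k|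
   turns o(|h|) into o(|k|). *)
have dg y j : (f @` ball p r) y -> differentiable (fun y => g y 0 j) y /\
    forall i, partial i (fun y => g y 0 j) y = (\row_i invmx ('J f (g y)) i j : space) 0 i.
  move=> yV; have [gr gE] := gP _ yV; apply/differentiable_epsP => ep ep0.
  pose x := g y; pose Jx := 'J f x; have uJ' : Jx \in unitmx by exact: uJx.
  have [n n0 Jn] := mulmx_norm_bound (invmx Jx).
  pose e1 := ep / (n * (2 * m)).
  have e10 : 0 < e1 by rewrite divr_gt0// !mulr_gt0.
  have fx : \forall h \near (0 : space), forall l, `|f (x + h) 0 l - f x 0 l - (h *m Jx) 0 l| <= e1 * `|h|.
    apply: (@filter_forall _ _ (fun l (h : space) =>
      `|f (x + h) 0 l - f x 0 l - (h *m Jx) 0 l| <= e1 * `|h|) (nbhs (0 : space))) => l.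
    have lE h : (h *m Jx) 0 l = linear_form (\row_i Jx i l) h.
      by rewrite mxE /linear_form; apply: eq_bigr => i _; congr (_ * _); rewrite [RHS]mxE.
    have dfl : differentiable (fun x => f x 0 l) x /\
        forall i, partial i (fun x => f x 0 l) x = (\row_i Jx i l : space) 0 i.
      split=> [|i]; first by apply: df; exact: rU.
      rewrite mxE; apply/esym; apply: jacobianE => j'; apply: df; exact: rU.
    have := (@differentiable_epsP _ (fun x => f x 0 l) x (\row_i Jx i l)).1 dfl _ e10.
    by apply: filterS => h; rewrite lE.
  have [d d0 dP] := nbhs_ball_ex fx.
  near=> k.
  have kV : (f @` ball p r) (y + k).
    by near: k; apply: near0_add; exact: open_nbhs_nbhs.
  have [gkr gkE] := gP _ kV; pose h := g (y + k) - x.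
  have hk : `|h| <= 2 * m * `|k|.
    by have := inv_lip _ _ gr gkr; rewrite gE gkE addrAC subrr add0r.
  have hd : ball 0 d h.
    rewrite -ball_normE /= sub0r normrN (le_lt_trans hk)// -ltr_pdivlMl ?mulr_gt0//.
    by near: k; apply: (@nbhs0_lt _ space); rewrite mulr_gt0// invr_gt0 mulr_gt0.
  have xh : x + h = g (y + k) by rewrite /h addrC subrK.
  have : `|k - h *m Jx| <= e1 * `|h|.
    apply: norm_le_coord => [|l]; first by rewrite mulr_ge0// ltW.
    have := dP h hd l; rewrite xh gkE /x gE.
    have -> // : (k - h *m Jx) 0 l = (y + k) 0 l - y 0 l - (h *m Jx) 0 l.
    by move: (h *m Jx) => w; rewrite !mxE; ring.
  have -> : linear_form (\row_i invmx ('J f (g y)) i j) k = (k *m invmx Jx) 0 j.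
    by rewrite mxE /linear_form; apply: eq_bigr => i _; rewrite mxE.
  have -> : g (y + k) 0 j - g y 0 j - (k *m invmx Jx) 0 j = - ((k - h *m Jx) *m invmx Jx) 0 j.
    rewrite mulmxBl mulmxK// /h; move: (k *m invmx Jx) => w; rewrite !mxE /x; ring.
  move=> H; rewrite normrN; apply: le_trans (coord_le_norm _ _) _.
  apply: le_trans (Jn _) _.
  apply: (@le_trans _ _ (n * (e1 * (2 * m * `|k|)))).
    apply: ler_wpM2l; first exact: ltW.
    by apply: le_trans H _; apply: ler_wpM2l hk; exact: ltW.
  by rewrite /e1 le_eqVlt; apply/orP; left; apply/eqP; field; rewrite !gt_eqF.
have pg y i j : (f @` ball p r) y -> partial i (fun y => g y 0 j) y = invmx ('J f (g y)) i j.
  by move=> /(dg y j)[_ ->]; rewrite mxE.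
(* The partial derivatives of g are smooth functions of g itself, namely entries of the inverse
   Jacobian. *)
apply: (@smooth_bootstrap _ 'I_3 _ (fun j y => g y 0 j) (fun j i y => invmx ('J f (g y)) i j)) => //.
- by move=> j y /(dg y j)[].
- by move=> j i y; exact: pg.
- move=> k Cg j i; apply: (@C_k_comp _ _ _ (ball p r) (fun x => invmx ('J f x) i j)) => //.
    apply: smooth_invmx => //; first exact: ball_open.
    move=> a b; apply: (@smooth_eq_on _ _ (partial a (fun y => f y 0 b))); first exact: ball_open.
      by move=> x xr; apply/esym; apply: jacobianE => j'; apply: df; exact: rU.
    by apply: smooth_partial; exact: smooth_sub (sf b).
  by move=> y /gP[].
Unshelve. all: by end_near. Qed.

End InverseFunction.

(** * Curvature in orthonormal frames *)

Section Frames.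
Context {R : realType}.
Notation space := 'rV[R]_3.
Variables (U : set space) (g : space -> 'M[R]_3).
Hypotheses (oU : open U) (gm : is_metric U g).

Lemma metric_smooth i j : smooth U (fun x => g x i j).
Proof. by have [+ _ _] := gm; exact. Qed.

Lemma metric_sym x i j : U x -> g x i j = g x j i.
Proof. by move=> Ux; have [_ gs _] := gm; rewrite -[in LHS](gs _ Ux) mxE. Qed.

Lemma smooth_christoffel i j k : smooth U (christoffel g i j k).
Proof.
apply: smoothM => //; first exact: smooth_cst.
apply: smooth_sum => // l _; apply: smoothM => //.
  apply: smooth_invmx => //; first exact: metric_smooth.
  by move=> x Ux; exact: is_metric_unit gm Ux.
by apply: smoothB => //; [apply: smoothD => //|]; exact/smooth_partial/metric_smooth.
Qed.

Lemma smooth_act X f : smooth_map U X -> smooth U f -> smooth U (act X f).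
Proof.
move=> sX sf; apply: smooth_sum => // i _; apply: smoothM => //.
exact: smooth_partial.
Qed.

Lemma smooth_inner X Y : smooth_map U X -> smooth_map U Y -> smooth U (inner g X Y).
Proof.
move=> sX sY; have -> : inner g X Y = fun x => \sum_i \sum_j X x 0 i * (g x i j * Y x 0 j).
  by apply/funext => x; rewrite innerE.
do 2 (apply: smooth_sum => // ? _); apply: smoothM => //; apply: smoothM => //.
exact: metric_smooth.
Qed.

Lemma smooth_nabla X Y : smooth_map U X -> smooth_map U Y -> smooth_map U (nabla g X Y).
Proof.
move=> sX sY k; apply: (@smooth_eq_on _ _ (fun x => act X (fun y => Y y 0 k) x
  + \sum_i \sum_j X x 0 i * Y x 0 j * christoffel g i j k x)) => //.
  by move=> x _; rewrite mxE.
apply: smoothD => //; first exact: smooth_act.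
do 2 (apply: smooth_sum => // ? _); apply: smoothM => //; first exact: smoothM.
exact: smooth_christoffel.
Qed.

Lemma act_coord i (f : space -> R) : act (coord_field i) f = partial i f.
Proof.
apply/funext => x; rewrite /act (bigD1 i)//= big1 => [|j ji].
  by rewrite mxE !eqxx mul1r addr0.
by rewrite mxE eqxx (negPf ji) mul0r.
Qed.

Lemma act_cst X (c : R) x : act X (fun=> c) x = 0.
Proof. by rewrite /act big1// => i _; rewrite partial_cst mulr0. Qed.

Lemma act_eq_on X (f h : space -> R) x : (forall y, U y -> f y = h y) -> U x ->
  act X f x = act X h x.
Proof.
move=> fh Ux; rewrite /act; apply: eq_bigr => i _; congr (_ * _).
exact: partial_eq_on fh _ Ux.
Qed.

Lemma act_locally_cst X (c : R) (f : space -> R) x : (forall y, U y -> f y = c) -> U x ->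
  act X f x = 0.
Proof. by move=> fc Ux; rewrite (@act_eq_on X _ (fun=> c))// act_cst. Qed.

Lemma sum_coord (F : 'I_3 -> R) i x : \sum_j (coord_field i : space -> space) x 0 j * F j = F i.
Proof.
rewrite (bigD1 i)//= big1 => [|j ji]; first by rewrite mxE !eqxx mul1r addr0.
by rewrite mxE eqxx (negPf ji) mul0r.
Qed.

Lemma smooth_coord_field i : smooth_map U (coord_field i).
Proof. by move=> j; exact: smooth_cst. Qed.

Lemma nabla_coordE a Z x l : nabla g (coord_field a) Z x 0 l =
  partial a (fun y => Z y 0 l) x + \sum_c Z x 0 c * christoffel g a c l x.
Proof.
rewrite mxE act_coord; congr (_ + _).
have := sum_coord (fun i => \sum_c Z x 0 c * christoffel g i c l x) a x.
move=> <-; apply: eq_bigr => i _; rewrite mulr_sumr; apply: eq_bigr => c _.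
by rewrite mulrA.
Qed.

Lemma nabla_lin X Z x l : nabla g X Z x 0 l =
  \sum_a X x 0 a * nabla g (coord_field a) Z x 0 l.
Proof.
under eq_bigr do rewrite nabla_coordE mulrDr; rewrite big_split mxE /=.
congr (_ + _); apply: eq_bigr => i _; rewrite mulr_sumr; apply: eq_bigr => c _.
by rewrite mulrA.
Qed.

(** The first sum is tensorial in X and Y. The second is the part that the bracket term of the
    curvature cancels after antisymmetrisation. *)
Lemma nabla_nabla X Y Z x l : smooth_map U X -> smooth_map U Y -> smooth_map U Z ->
  U x -> nabla g X (nabla g Y Z) x 0 l =
  \sum_a \sum_b X x 0 a * Y x 0 b *
     nabla g (coord_field a) (nabla g (coord_field b) Z) x 0 l
  + \sum_b act X (fun y => Y y 0 b) x * nabla g (coord_field b) Z x 0 l.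
Proof.
move=> sX sY sZ Ux; rewrite nabla_lin.
have sD b := smooth_nabla (smooth_coord_field b) sZ.
have -> : \sum_b act X (fun y => Y y 0 b) x * nabla g (coord_field b) Z x 0 l =
  \sum_a \sum_b X x 0 a * (partial a (fun y => Y y 0 b) x * nabla g (coord_field b) Z x 0 l).
  rewrite exchange_big /=; apply: eq_bigr => b _; rewrite /act mulr_suml.
  by apply: eq_bigr => a _; rewrite mulrA.
rewrite -big_split /=; apply: eq_bigr => a _; rewrite -big_split /=.
rewrite nabla_coordE.
have -> : (fun y => nabla g Y Z y 0 l) = fun y => \sum_b Y y 0 b * nabla g (coord_field b) Z y 0 l.
  by apply/funext => y; exact: nabla_lin.
have dY b := smooth_differentiable (sY b) Ux.
have dD b := smooth_differentiable (sD b l) Ux.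
have [_ ->] := @partial_sum _ _ (index_enum 'I_3) xpredT
  (fun b y => Y y 0 b * nabla g (coord_field b) Z y 0 l) x
  (fun b _ => differentiableM (dY b) (dD b)).
under [X in _ * (_ + X)]eq_bigr do rewrite nabla_lin mulr_suml.
rewrite [X in _ * (_ + X)]exchange_big /= -big_split /= mulr_sumr.
apply: eq_bigr => b _; rewrite partialM//
  (nabla_coordE a (nabla g (coord_field b) Z) x l).
under [X in _ * (_ + X)]eq_bigr do rewrite -mulrA.
rewrite -mulr_sumr.
move: (\sum_c _) (partial a (fun x0 => nabla g (coord_field b) Z x0 0 l) x)
  (partial a (fun y => Y y 0 b) x) (nabla g (coord_field b) Z x 0 l) => p1 p2 p3 p4.
by ring.
Qed.

Lemma bracketE (X Y : space -> space) x k :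
  bracket X Y x 0 k = act X (fun y => Y y 0 k) x - act Y (fun y => X y 0 k) x.
Proof. by rewrite mxE. Qed.

(** The l-th component of R(d_a, d_b) d_c for the coordinate fields. *)
Definition riem a b c l (x : space) : R :=
  partial a (christoffel g b c l) x - partial b (christoffel g a c l) x
  + \sum_m (christoffel g b c m x * christoffel g a m l x
            - christoffel g a c m x * christoffel g b m l x).

Lemma curvature_commute X Y Z x l : smooth_map U X -> smooth_map U Y -> smooth_map U Z ->
  U x -> curvature g X Y Z x 0 l = \sum_a \sum_b X x 0 a * Y x 0 b *
    (nabla g (coord_field a) (nabla g (coord_field b) Z) x 0 l
     - nabla g (coord_field b) (nabla g (coord_field a) Z) x 0 l).
Proof.
move=> sX sY sZ Ux; rewrite [LHS]mxE [X in X + _]mxE [X in _ + X]mxE [X in _ + X + _]mxE.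
rewrite (nabla_nabla _ sX sY sZ Ux) (nabla_nabla _ sY sX sZ Ux) nabla_lin.
under [X in _ - X]eq_bigr do rewrite bracketE mulrBl.
rewrite sumrB [X in _ - (X + _) - _]exchange_big /=.
have -> (a b c d : R) : a + b - (c + d) - (b - d) = a - c by ring.
rewrite -sumrB; apply: eq_bigr => a _; rewrite -sumrB; apply: eq_bigr => b _.
by rewrite mulrBr [Y x 0 b * _]mulrC.
Qed.

Lemma nabla_coord_comm a b Z x l : smooth_map U Z -> U x ->
  nabla g (coord_field a) (nabla g (coord_field b) Z) x 0 l
     - nabla g (coord_field b) (nabla g (coord_field a) Z) x 0 l =
  \sum_c Z x 0 c * riem a b c l x.
Proof.
move=> sZ Ux.
have E a' b' : nabla g (coord_field a') (nabla g (coord_field b') Z) x 0 l =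
    partial a' (partial b' (fun y => Z y 0 l)) x
    + \sum_c (partial a' (fun y => Z y 0 c) x * christoffel g b' c l x
              + partial b' (fun y => Z y 0 c) x * christoffel g a' c l x)
    + \sum_c Z x 0 c * (partial a' (christoffel g b' c l) x
              + \sum_m christoffel g b' c m x * christoffel g a' m l x).
  rewrite nabla_coordE.
  have -> : (fun y => nabla g (coord_field b') Z y 0 l) = fun y =>
    partial b' (fun y => Z y 0 l) y + \sum_c Z y 0 c * christoffel g b' c l y.
    by apply/funext => y; rewrite nabla_coordE.
  have dZ c := smooth_differentiable (sZ c) Ux.
  have dG c := smooth_differentiable (smooth_christoffel b' c l) Ux.
  have [dS pS] := @partial_sum _ _ (index_enum 'I_3) xpredT
    (fun c y => Z y 0 c * christoffel g b' c l y) x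
    (fun c _ => differentiableM (dZ c) (dG c)).
  rewrite partialD//; last exact: smooth_differentiable (smooth_partial _ (sZ l)) Ux.
  rewrite pS; under [X in _ + X + _ = _]eq_bigr do rewrite partialM//.
  under [X in _ + _ + X = _]eq_bigr do rewrite nabla_coordE mulrDl mulr_suml.
  rewrite [X in _ + _ + X = _]big_split /= [X in _ + _ + (_ + X) = _]exchange_big /=.
  rewrite -!addrA; congr (_ + _); rewrite big_split /= [in RHS]big_split /=.
  rewrite -!addrA; congr (_ + _); rewrite addrCA; congr (_ + _).
  rewrite -big_split /=; apply: eq_bigr => c _; rewrite mulrDr; congr (_ + _).
  by rewrite mulr_sumr; apply: eq_bigr => m _; rewrite mulrA.
rewrite !E (partial_sym a b oU (sZ l) Ux).
set p := partial b _ x; set s1 := \sum_c _; set t1 := \sum_c _; set s2 := \sum_c _; set t2 := \sum_c _.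
have -> : s1 = s2 by apply: eq_bigr => c _; rewrite addrC.
have -> (w1 w2 w3 w4 : R) : w1 + w2 + w3 - (w1 + w2 + w4) = w3 - w4 by ring.
rewrite /t1 /t2 -sumrB; apply: eq_bigr => c _; rewrite -mulrBr; congr (_ * _).
rewrite /riem sumrB.
by move: (partial a _ x) (partial b _ x) (\sum_m _) (\sum_m _) => w1 w2 w3 w4; ring.
Qed.

(** Tensoriality of the curvature: of the three fields only the values at x enter. *)
Lemma curvatureE X Y Z x l : smooth_map U X -> smooth_map U Y -> smooth_map U Z ->
  U x -> curvature g X Y Z x 0 l =
  \sum_a \sum_b \sum_c X x 0 a * Y x 0 b * Z x 0 c * riem a b c l x.
Proof.
move=> sX sY sZ Ux; rewrite (curvature_commute _ sX sY sZ Ux).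
apply: eq_bigr => a _; apply: eq_bigr => b _.
rewrite (nabla_coord_comm _ _ _ sZ Ux) mulr_sumr; apply: eq_bigr => c _.
by rewrite mulrA.
Qed.

Variable e : 'I_3 -> space -> space.
Hypothesis se : forall a, smooth_map U (e a).
Hypothesis on : forall x, U x -> forall a b, inner g (e a) (e b) x = (a == b)%:R.

Definition frame_mx x : 'M[R]_3 := \matrix_(i, j) e i x 0 j.

Lemma frame_mxE x : U x -> frame_mx x *m g x *m (frame_mx x)^T = 1%:M.
Proof.
move=> Ux; apply/matrixP => a b; rewrite [RHS]mxE -(on Ux) /inner.
have rE c : e c x = row c (frame_mx x) by apply/rowP => j; rewrite !mxE.
rewrite !rE tr_row -row_mul !mxE; apply: eq_bigr => i _; rewrite !mxE.
by congr (_ * _).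
Qed.

Lemma frame_mxE' x : U x -> g x *m (frame_mx x)^T *m frame_mx x = 1%:M.
Proof. by move=> Ux; apply: mulmx1C; rewrite mulmxA frame_mxE. Qed.

Lemma frame_expand (v : space) x : U x -> v = \sum_k (v *m g x *m (e k x)^T) 0 0 *: e k x.
Proof.
move=> Ux; rewrite -[LHS]mulmx1 -(frame_mxE' Ux) !mulmxA.
rewrite [LHS]mulmx_sum_row; apply: eq_bigr => k _.
have -> : row k (frame_mx x) = e k x by apply/rowP => j; rewrite !mxE.
congr (_ *: _); rewrite !mxE; apply: eq_bigr => i _; rewrite !mxE.
by congr (_ * _).
Qed.

Lemma inner_sym X Y x : U x -> inner g X Y x = inner g Y X x.
Proof.
move=> Ux; rewrite /inner.
transitivity ((X x *m g x *m (Y x)^T)^T 0 0); first by rewrite [RHS]mxE.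
by have [_ gs _] := gm; rewrite !trmx_mul trmxK gs// mulmxA.
Qed.

Lemma frame_inner X Y x : U x ->
  inner g X Y x = \sum_k inner g X (e k) x * inner g Y (e k) x.
Proof.
move=> Ux; rewrite {1}/inner {1}(frame_expand (X x) Ux) !mulmx_suml summxE.
apply: eq_bigr => k _; rewrite -!scalemxAl mxE; congr (_ * _).
exact: inner_sym.
Qed.

Lemma frame_eq (v w : space) x : U x ->
  (forall k, (v *m g x *m (e k x)^T) 0 0 = (w *m g x *m (e k x)^T) 0 0) -> v = w.
Proof.
move=> Ux H; rewrite (frame_expand v Ux) (frame_expand w Ux).
by apply: eq_bigr => k _; rewrite H.
Qed.

(** Ricci's rotation coefficients. *)
Definition rot a b c (x : space) : R := inner g (nabla g (e a) (e b)) (e c) x.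

Lemma smooth_rot a b c : smooth U (rot a b c).
Proof. by apply: smooth_inner => //; exact: smooth_nabla. Qed.

Lemma rot_skew a b c x : U x -> rot a b c x = - rot a c b x.
Proof.
move=> Ux; apply/eqP; rewrite -addr_eq0; apply/eqP.
have := nabla_metric (e a) oU gm (se b) (se c) Ux.
have -> : act (e a) (inner g (e b) (e c)) x = 0.
  by apply: (@act_locally_cst _ (b == c)%:R) => // y /on.
by rewrite /rot [inner g (e b) _ x]inner_sym// => <-.
Qed.

Lemma bracket_rot a b c x : U x ->
  inner g (bracket (e a) (e b)) (e c) x = rot a b c x - rot b a c x.
Proof.
move=> Ux; rewrite /inner -(nabla_torsion_free _ _ oU gm Ux) !mulmxBl mxE.
by rewrite [X in _ + X]mxE.
Qed.

Lemma nabla_frame X Y Z x : U x -> inner g (nabla g X Y) Z x =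
  \sum_k inner g X (e k) x * inner g (nabla g (e k) Y) Z x.
Proof.
move=> Ux; have E : nabla g X Y x = \sum_k inner g X (e k) x *: nabla g (e k) Y x.
  apply/rowP => l; rewrite nabla_lin summxE.
  under [RHS]eq_bigr => k _ do rewrite mxE nabla_lin mulr_sumr.
  rewrite exchange_big /=; apply: eq_bigr => a _.
  rewrite {1}(frame_expand (X x) Ux) summxE mulr_suml; apply: eq_bigr => k _.
  by rewrite mxE mulrA.
rewrite /inner E !mulmx_suml summxE; apply: eq_bigr => k _.
by rewrite -!scalemxAl mxE.
Qed.

Lemma nabla_compat X Y Z x : smooth_map U X -> smooth_map U Y -> U x ->
  inner g (nabla g Z X) Y x = act Z (inner g X Y) x
    - \sum_k inner g X (e k) x * inner g (nabla g Z Y) (e k) x.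
Proof.
move=> sX sY Ux; rewrite (nabla_metric _ oU gm sX sY Ux) [X in _ + X - _]frame_inner//.
by rewrite addrK.
Qed.

(** Cartan's second structure equation on the frame. Metric compatibility moves the outer covariant
    derivative onto [e d], so that second derivatives become derivatives of [rot]. *)
Lemma curvature_rot a b c d x : U x ->
  inner g (curvature g (e a) (e b) (e c)) (e d) x =
  act (e a) (rot b c d) x - act (e b) (rot a c d) x
  - \sum_k rot b c k x * rot a d k x + \sum_k rot a c k x * rot b d k x
  - \sum_k (rot a b k x - rot b a k x) * rot k c d x.
Proof.
move=> Ux; have sn a' b' : smooth_map U (nabla g (e a') (e b')) by exact: smooth_nabla.
rewrite /inner /curvature !mulmxBl [LHS]mxE [X in X + _]mxE [X in _ + X + _]mxE [X in _ + X]mxE.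
rewrite -/(inner g (nabla g (e a) (nabla g (e b) (e c))) (e d) x).
rewrite -/(inner g (nabla g (e b) (nabla g (e a) (e c))) (e d) x).
rewrite -/(inner g (nabla g (bracket (e a) (e b)) (e c)) (e d) x).
rewrite (nabla_compat (e a) (sn b c) (se d) Ux) (nabla_compat (e b) (sn a c) (se d) Ux).
rewrite (nabla_frame (bracket (e a) (e b)))//.
under [X in _ - _ - X = _]eq_bigr do rewrite bracket_rot//.
rewrite /rot; move: (act _ _ _) (act _ _ _) (\sum_k _) (\sum_k _) (\sum_k _).
by move=> *; ring.
Qed.

(** The defining trace is taken in the coordinate basis. The frame matrix has inverse g times its
    transpose, and conjugating by it turns this into a trace over the frame. *)
Lemma ricci_rot b c x : U x -> (e b x *m ricci g x *m (e c x)^T) 0 0 =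
  \sum_a inner g (curvature g (e a) (e b) (e c)) (e a) x.
Proof.
move=> Ux.
pose N : 'M[R]_3 := \matrix_(i, l) \sum_j \sum_k e b x 0 j * e c x 0 k * riem i j k l x.
have curvN a : curvature g (e a) (e b) (e c) x = e a x *m N.
  apply/rowP => l; rewrite curvatureE// mxE; apply: eq_bigr => i _.
  rewrite mxE mulr_sumr; apply: eq_bigr => j _; rewrite mulr_sumr.
  by apply: eq_bigr => k _; rewrite !mulrA.
have ricE j k : ricci g x j k = \sum_i riem i j k i x.
  rewrite mxE; apply: eq_bigr => i _; rewrite curvatureE//; try exact: smooth_coord_field.
  under eq_bigr => a' _.
    under eq_bigr => b' _.
      under eq_bigr => c' _ do rewrite -!mulrA.
      rewrite -mulr_sumr -mulr_sumr sum_coord; over.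
    rewrite -mulr_sumr sum_coord; over.
  by rewrite sum_coord.
transitivity (\tr N).
  rewrite mxE /mxtrace.
  transitivity (\sum_k \sum_j \sum_i e b x 0 j * e c x 0 k * riem i j k i x).
    apply: eq_bigr => k _; rewrite !mxE mulr_suml; apply: eq_bigr => j _.
    by rewrite ricE mulrAC mulr_sumr.
  under eq_bigr do rewrite exchange_big /=.
  rewrite exchange_big /=; apply: eq_bigr => i _; rewrite mxE exchange_big /=.
  by [].
have -> : \tr N = \tr (frame_mx x *m N *m (g x *m (frame_mx x)^T)).
  by rewrite mxtrace_mulC mulmxA frame_mxE' // mul1mx.
apply: eq_bigr => a _; rewrite /inner curvN.
have -> : e a x = row a (frame_mx x) by apply/rowP => j; rewrite !mxE.
rewrite tr_row -!row_mul mulmxA !mxE; apply: eq_bigr => i _; rewrite !mxE.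
by congr (_ * _); rewrite ?mxE.
Qed.

End Frames.

(** * Coframes over a surface of constant curvature *)

Section CovectorCalculus.
Context {R : realType}.
Notation space := 'rV[R]_3.
Implicit Types (b c : space -> space) (U : set space).

Definition grad (f : space -> R) (x : space) : space := \row_i partial i f x.

Definition dext b (i j : 'I_3) (x : space) : R :=
  partial i (fun y => b y 0 j) x - partial j (fun y => b y 0 i) x.

Definition wedge (v w : space) (i j : 'I_3) : R := v 0 i * w 0 j - v 0 j * w 0 i.

Lemma ord3_ind (P : 'I_3 -> Prop) : P 0 -> P 1 -> P 2 -> forall a, P a.
Proof.
move=> P0 P1 P2 [[|[|[|//]]] i3].
- by rewrite (_ : Ordinal i3 = 0)//; apply: val_inj.
- by rewrite (_ : Ordinal i3 = 1)//; apply: val_inj.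
- by rewrite (_ : Ordinal i3 = 2)//; apply: val_inj.
Qed.

Lemma const_on_ball (f : space -> R) p r x :
  (forall y, ball p r y -> differentiable f y) ->
  (forall y i, ball p r y -> partial i f y = 0) -> ball p r x -> f x = f p.
Proof.
move=> df f0 xr; have pr : ball p r p.
  apply: ballxx; move: xr; rewrite -ball_normE /=; exact: le_lt_trans.
have xE : x = p + (x - p) by rewrite addrC subrK.
have cv t : 0 <= t <= 1 -> ball p r (p + t *: (x - p)).
  by move=> t01; apply: ball_convex => //; rewrite -xE.
have [t /cv/df//|t t01] := @mvt_line _ f p (x - p).
rewrite -xE big1 => [/eqP|i _]; first by rewrite subr_eq0 => /eqP.
by rewrite f0 ?mulr0//; exact: cv.
Qed.

Lemma poincare b U p (f0 : R) : open U -> U p -> smooth_map U b ->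
  (forall x i j, U x -> dext b i j x = 0) ->
  exists r : R, [/\ 0 < r, ball p r `<=` U & exists f : space -> R,
    [/\ f p = f0, smooth (ball p r) f & forall x, ball p r x -> grad f x = b x]].
Proof.
move=> oU Up sb db.
(* The inhomogeneous equation df = b becomes linear with an auxiliary unknown that is constantly 1:
   dF 0 = 0 and dF 1 = F 0 b. Flatness is then closedness of b. *)
pose A (a c : 'I_2) i (x : space) : R := if (a == 0) && (c == 1) then b x 0 i else 0.
pose y0 (a : 'I_2) : R := if a == 0 then 1 else f0.
have sum2 (F : 'I_2 -> R) : \sum_a F a = F 0 + F 1.
  rewrite !big_ord_recl big_ord0 addr0; congr (_ + _); congr F; exact: val_inj.
have [||r [r0 rU [F [F0 sF dF]]]] := @flat_system R 2 A U p y0 oU Up.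
- move=> a c i; have [E|E] := boolP ((a == 0) && (c == 1)).
    by have -> : A a c i = fun x => b x 0 i by apply/funext => x; rewrite /A E.
  have -> : A a c i = fun=> 0 by apply/funext => x; rewrite /A (negPf E).
  exact: smooth_cst.
- move=> x Ux a c i j; rewrite !sum2 /A /= ?andbF ?mulr0 ?mul0r ?addr0.
  case: (_ && _); last by rewrite !partial_cst.
  by apply/eqP; rewrite -subr_eq0; apply/eqP; exact: db.
exists r; split => //; exists (F 1); split => //.
have F01 x : ball p r x -> F 0 x = 1.
  move=> xr; rewrite (@const_on_ball (F 0) p r x) ?F0//.
    by move=> y yr; exact: smooth_differentiable (sF 0) yr.
  by move=> y i yr; rewrite dF// sum2 /A /= !mulr0 addr0.
move=> x xr; apply/rowP => i; rewrite mxE dF// sum2 /A /= mulr0 addr0.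
by rewrite F01// mul1r.
Qed.

Lemma smooth_mapM (V : set space) f b : open V -> smooth V f -> smooth_map V b ->
  smooth_map V (fun x => f x *: b x).
Proof.
move=> oV sf sb j; rewrite (_ : (fun x => _) = fun x => f x * b x 0 j).
  exact: smoothM.
by apply/funext => x; rewrite mxE.
Qed.

Lemma smooth_mapB (V : set space) b c : open V -> smooth_map V b -> smooth_map V c ->
  smooth_map V (fun x => b x - c x).
Proof.
move=> oV sb sc j; rewrite (_ : (fun x => _) = fun x => b x 0 j - c x 0 j).
  exact: smoothB.
by apply/funext => x; rewrite !mxE.
Qed.

(* The system dz = z1 th1 + z2 th2, dz1 = z2 w - K z th1, dz2 = - z1 w - K z th2. *)
Definition height_form (th1 th2 w : space -> space) (K : R) (a c : 'I_3)
    (x : space) : space :=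
  match nat_of_ord a, nat_of_ord c with
  | 0, 1 => - K *: th1 x | 0, 2 => - K *: th2 x
  | 1, 0 => th1 x | 2, 0 => th2 x | 1, 2 => - w x | 2, 1 => w x
  | _, _ => 0
  end.

Section Coframe.
Variables (U : set space) (th1 th2 w al : space -> space) (K s : R).
Hypotheses (oU : open U) (s1 : smooth_map U th1) (s2 : smooth_map U th2).
Hypotheses (sw : smooth_map U w) (sal : smooth_map U al).
Hypothesis d1 : forall x i j, U x -> dext th1 i j x = wedge (w x) (th2 x) i j.
Hypothesis d2 : forall x i j, U x -> dext th2 i j x = - wedge (w x) (th1 x) i j.
Hypothesis dw : forall x i j, U x -> dext w i j x = - K * wedge (th1 x) (th2 x) i j.
Hypothesis da : forall x i j, U x -> dext al i j x = 2 * s * wedge (th1 x) (th2 x) i j.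

Let A (a c : 'I_3) i (x : space) := height_form th1 th2 w K a c x 0 i.

Lemma partialZ (k : R) b i j x : smooth_map U b -> U x ->
  partial i (fun y => (k *: b y) 0 j) x = k * partial i (fun y => b y 0 j) x.
Proof.
move=> sb Ux; rewrite (_ : (fun y => _) = fun y => k * b y 0 j).
  rewrite partialM //; first by rewrite partial_cst mul0r add0r.
  exact: smooth_differentiable (sb j) Ux.
by apply/funext => y; rewrite mxE.
Qed.

(** The system is flat because of the structure equations: the mixed derivatives of z agree by those
    of th1 and th2, and the ones of z1 and z2 need in addition that w has curvature K. *)
Lemma height_function p (z0 z10 z20 : R) : U p -> exists r : R,
  [/\ 0 < r, ball p r `<=` U & exists z z1 z2 : space -> R,
  [/\ [/\ z p = z0, z1 p = z10 & z2 p = z20],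
    [/\ smooth (ball p r) z, smooth (ball p r) z1 & smooth (ball p r) z2] &
    forall x, ball p r x ->
    [/\ grad z x = z1 x *: th1 x + z2 x *: th2 x,
      grad z1 x = z2 x *: w x - (K * z x) *: th1 x &
      grad z2 x = - z1 x *: w x - (K * z x) *: th2 x]]].
Proof.
move=> Up.
have A00 : height_form th1 th2 w K 0 0 = fun=> 0 by [].
have A11 : height_form th1 th2 w K 1 1 = fun=> 0 by [].
have A22 : height_form th1 th2 w K 2 2 = fun=> 0 by [].
have A01 : height_form th1 th2 w K 0 1 = fun x => - K *: th1 x by [].
have A02 : height_form th1 th2 w K 0 2 = fun x => - K *: th2 x by [].
have A10 : height_form th1 th2 w K 1 0 = th1 by [].
have A20 : height_form th1 th2 w K 2 0 = th2 by [].
have A12 : height_form th1 th2 w K 1 2 = fun x => -1 *: w x.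
  by apply/funext => x; rewrite scaleN1r.
have A21 : height_form th1 th2 w K 2 1 = w by [].
pose y0 (a : 'I_3) := match nat_of_ord a with 0 => z0 | 1 => z10 | _ => z20 end.
have [||r [r0 rU [F [F0 sF dF]]]] := @flat_system R 3 A U p y0 oU Up.
- move=> a c; rewrite -/(smooth_map U (height_form th1 th2 w K a c)).
  have s0 : smooth_map U (fun=> 0 : space) by move=> i; exact: smooth_cst.
  move: a c; apply: ord3_ind; apply: ord3_ind;
    rewrite ?(A00, A11, A22, A01, A02, A10, A20, A12, A21) //;
    by apply: smooth_mapM => //; exact: smooth_cst.
{ move=> x Ux a c i j; rewrite !big_ord3 /A.
  have := d1 i j Ux; have := d2 i j Ux; have := dw i j Ux.
  rewrite /dext /wedge.
  have pz i' j' : partial i' (fun y => (0 : space) 0 j') x = 0.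
    by rewrite partial_cst.
  move: a c; apply: ord3_ind; apply: ord3_ind;
    rewrite ?(A00, A11, A22, A01, A02, A10, A20, A12, A21) ?partialZ // ?pz ?mxE.
  all: move: (w x 0 i) (w x 0 j) (th1 x 0 i) (th1 x 0 j) (th2 x 0 i) (th2 x 0 j);
    move: (partial i (fun y => w y 0 j) x) (partial j (fun y => w y 0 i) x);
    move: (partial i (fun y => th1 y 0 j) x) (partial j (fun y => th1 y 0 i) x);
    move: (partial i (fun y => th2 y 0 j) x) (partial j (fun y => th2 y 0 i) x);
    move=> a1 a2 b1 b2 c1 c2 wi wj xi xj yi yj;
    move=> /(canRL (subrK _)) E1 /(canRL (subrK _)) E2 /(canRL (subrK _)) E3; subst; ring. }
exists r; split => //; exists (F 0), (F 1), (F 2); split => //.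
move=> x xr.
split; apply/rowP => i; rewrite mxE dF// big_ord3 /A
  ?(A00, A11, A22, A01, A02, A10, A20, A12, A21) !mxE; ring.
Qed.

Lemma dextZ (f : space -> R) b (i j : 'I_3) (x : space) : differentiable f x ->
  (forall j, differentiable (fun y => b y 0 j) x) ->
  dext (fun y => f y *: b y) i j x = wedge (grad f x) (b x) i j + f x * dext b i j x.
Proof.
move=> df db.
have E l : (fun y => (f y *: b y) 0 l) = fun y => f y * b y 0 l.
  by apply/funext => y; rewrite mxE.
rewrite /dext !E !partialM// /wedge !mxE; ring.
Qed.

Lemma dextB b c (i j : 'I_3) (x : space) : (forall j, differentiable (fun y => b y 0 j) x) ->
  (forall j, differentiable (fun y => c y 0 j) x) ->
  dext (fun y => b y - c y) i j x = dext b i j x - dext c i j x.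
Proof.
move=> db dc.
have E l : (fun y => (b y - c y) 0 l) = fun y => b y 0 l - c y 0 l.
  by apply/funext => y; rewrite !mxE.
rewrite /dext !E !partialB//; ring.
Qed.

Lemma sqE (a : space) i j : sq a i j = a 0 i * a 0 j.
Proof. by rewrite mxE big_ord1 !mxE. Qed.

(** In terms of dz and its rotation by a right angle, th1^2 + th2^2 = (dz^2 + (z1 th2 - z2 th1)^2) /
    N. The constants c0 and nu set the scales of rho and phi: the normal forms use c0 = W, nu = 1 in
    the curved cases and c0 = 1, nu = 1/2 in the flat one. *)
Lemma polar_coordinates p (z0 z10 z20 c0 nu : R) : U p -> 0 < z10 ^+ 2 + z20 ^+ 2 ->
  c0 != 0 -> nu != 0 -> s * s = 1 -> exists r : R,
  [/\ 0 < r, ball p r `<=` U & exists N z phi rho : space -> R,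
  [/\ z p = z0, [/\ smooth (ball p r) z, smooth (ball p r) phi & smooth (ball p r) rho],
    forall x, ball p r x -> 0 < N x /\
       N x = z10 ^+ 2 + z20 ^+ 2 + K * (z0 ^+ 2 - z x ^+ 2) &
    forall x, ball p r x ->
    sq (th1 x) + sq (th2 x) = (N x)^-1 *: sq (grad z x)
       + (N x / (2 * c0 * nu) ^+ 2) *: sq (grad phi x) /\
    al x = c0^-1 *: (grad rho x + (z x / nu) *: grad phi x)]].
Proof.
move=> Up N0 c00 nu0 ss.
have [r [r0 rU [z [z1 [z2 [[zp z1p z2p] [sz sz1 sz2] dz]]]]]] := height_function z0 z10 z20 Up.
have oB (q : R) : open (ball p q : set space) by exact: ball_open.
pose N x := z1 x * z1 x + z2 x * z2 x.
have sN : smooth (ball p r) N by apply: smoothD => //; exact: smoothM.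
have pr : ball p r p by exact: ballxx.
have [r' r'0 Npos] : exists2 r' : R, 0 < r' & forall x, ball p r' x -> 0 < N x.
  apply: nbhs_ball_ex; have : nbhs (N p) [set y | 0 < y].
    apply: open_nbhs_nbhs; split; first exact: open_gt.
    by rewrite /= /N z1p z2p -!expr2.
  exact: (smooth_continuous sN pr).
pose q := Num.min r r'.
have q0 : 0 < q by rewrite lt_min r0.
have qr : ball p q `<=` (ball p r : set space) by apply: le_ball; rewrite ge_min lexx.
have qr' : ball p q `<=` (ball p r' : set space) by apply: le_ball; rewrite ge_min lexx orbT.
have qU x : ball p q x -> U x by move=> /qr/rU.
have pq : ball p q p by exact: ballxx.
have dfd f x : smooth (ball p r) f -> ball p q x -> differentiable f x.
  by move=> sf /qr; exact: smooth_differentiable.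
have dz0 i x : ball p q x -> partial i z x = z1 x * th1 x 0 i + z2 x * th2 x 0 i.
  by move=> /qr/dz[+ _ _] => /rowP/(_ i); rewrite !mxE.
have dz1 i x : ball p q x -> partial i z1 x = z2 x * w x 0 i - K * z x * th1 x 0 i.
  by move=> /qr/dz[_ + _] => /rowP/(_ i); rewrite !mxE.
have dz2 i x : ball p q x -> partial i z2 x = - z1 x * w x 0 i - K * z x * th2 x 0 i.
  by move=> /qr/dz[_ _ +] => /rowP/(_ i); rewrite !mxE.
have dN i x : ball p q x -> partial i N x = - (2 * K * z x) * partial i z x.
  move=> xq; rewrite partialD ?partialM//; try exact: dfd; try by apply: dfd => //; exact: smoothM.
  rewrite dz0// dz1// dz2//.
  move: (th1 x 0 i) (th2 x 0 i) (w x 0 i) (z x) (z1 x) (z2 x) => *; ring.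
have NE x : ball p q x -> N x = z10 ^+ 2 + z20 ^+ 2 + K * (z0 ^+ 2 - z x ^+ 2).
  move=> xq; have szz : smooth (ball p r) (fun x => K * (z x * z x)).
    by apply: smoothM => //; [exact: smooth_cst|exact: smoothM].
  have szz' : smooth (ball p r) (fun x => z x * z x) by exact: smoothM.
  have : N x + K * (z x * z x) = N p + K * (z p * z p).
    apply: (@const_on_ball (fun x => N x + K * (z x * z x)) p q x) => //.
      by move=> y yq; apply: dfd => //; exact: smoothD.
    move=> y i yq; rewrite partialD; [|exact: dfd|exact: dfd].
    rewrite partialM; [|exact: differentiable_cst|exact: dfd].
    rewrite partialM; [|exact: dfd|exact: dfd].
    rewrite partial_cst dN//; move: (partial i z y) (z y) => a b; ring.
  move=> /(canRL (addrK _)) ->; rewrite zp {1}/N z1p z2p; ring.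
have sth1 : smooth_map (ball p q) th1 by move=> j; apply: smooth_sub (s1 j).
have sth2 : smooth_map (ball p q) th2 by move=> j; apply: smooth_sub (s2 j).
have sal' : smooth_map (ball p q) al by move=> j; apply: smooth_sub (sal j).
have [szq sz1q sz2q sNq] : [/\ smooth (ball p q) z, smooth (ball p q) z1,
   smooth (ball p q) z2 & smooth (ball p q) N] by split; apply: smooth_sub qr _.
pose u x := (N x)^-1.
have su : smooth (ball p q) u.
  by apply: smoothV => // x /qr'/Npos; exact: lt0r_neq0.
have uN x : ball p q x -> u x * N x = 1.
  by move=> /qr'/Npos/lt0r_neq0; exact: mulVf.
have dfq f x : smooth (ball p q) f -> ball p q x -> differentiable f x.
  exact: smooth_differentiable.
have du i x : ball p q x -> partial i u x = u x * u x * (2 * K * z x) * partial i z x.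
  move=> xq.
  have : partial i (fun x => u x * N x) x = 0.
    by rewrite (@partial_eq_on _ (ball p q) _ (fun=> 1) i (oB q) uN x xq) partial_cst.
  rewrite partialM; [|exact: dfq|exact: dfq].
  rewrite dN// => E.
  have -> : partial i u x = (u x * N x) * partial i u x by rewrite uN// mul1r.
  have -> : u x * N x * partial i u x = u x * (partial i u x * N x
     + u x * (- (2 * K * z x) * partial i z x)) - u x * (u x * (- (2 * K * z x) * partial i z x)).
    by move: (u x) (N x) (z x) (partial i u x) (partial i z x) => *; ring.
  by rewrite E; move: (u x) (z x) (partial i z x) => *; ring.
(* Since dz /\ eta0 = th1 /\ th2, this factor gives c0 al and (z / nu) eta the same exterior
   derivative 2 c0 s th1 /\ th2. *)
pose m := 2 * c0 * s * nu.
pose F1 x := u x * z1 x; pose F2 x := u x * z2 x.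
pose eta0 x := F1 x *: th2 x - F2 x *: th1 x.
pose eta x := m *: eta0 x.
have sF1 : smooth (ball p q) F1 by exact: smoothM.
have sF2 : smooth (ball p q) F2 by exact: smoothM.
have seta0 : smooth_map (ball p q) eta0.
  by apply: smooth_mapB => //; exact: smooth_mapM.
have seta : smooth_map (ball p q) eta.
  by apply: smooth_mapM => //; exact: smooth_cst.
(* The w terms cancel in d (z1 th2 - z2 th1) = - 2 K z th1 /\ th2, and the derivative of 1 / N
   contributes the opposite term. *)
have deta0 x i j : ball p q x -> dext eta0 i j x = 0.
  move=> xq; have Ux := qU _ xq.
  rewrite dextB; try by move=> l; apply: dfq => //; exact: smooth_mapM.
  rewrite !dextZ; try exact: dfq; try by move=> l; exact: dfq.
  rewrite d1// d2// /wedge !mxE.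
  rewrite ![partial _ F1 x]partialM; try exact: dfq.
  rewrite ![partial _ F2 x]partialM; try exact: dfq.
  rewrite !du// !dz1// !dz2// !dz0// /F1 /F2.
  have := uN x xq; rewrite /N.
  move: (th1 x 0 i) (th2 x 0 i) (w x 0 i) (th1 x 0 j) (th2 x 0 j) (w x 0 j).
  move: (z x) (z1 x) (z2 x) (u x) => za zb zc v a1 a2 a3 b1 b2 b3 E.
  transitivity (2 * K * za * v * (a1 * b2 - a2 * b1) * (v * (zb * zb + zc * zc) - 1)); first by ring.
  by rewrite E subrr mulr0.
have deta x i j : ball p q x -> dext eta i j x = 0.
  move=> xq; rewrite dextZ; [|exact: differentiable_cst|by move=> l; exact: dfq].
  rewrite deta0// mulr0 addr0 /wedge !mxE !partial_cst; ring.
have [q1 [q10 q1q [phi [_ sphi dphi]]]] := poincare 0 (oB q) pq seta deta.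
pose be x := c0 *: al x - (nu^-1 * z x) *: eta x.
have snz : smooth (ball p q) (fun x => nu^-1 * z x).
  by apply: smoothM => //; exact: smooth_cst.
have sc : smooth (ball p q) (fun=> c0) by exact: smooth_cst.
have sbe : smooth_map (ball p q) be.
  by apply: smooth_mapB => //; exact: smooth_mapM.
have dbe x i j : ball p q x -> dext be i j x = 0.
  move=> xq; have Ux := qU _ xq.
  rewrite dextB; try by move=> l; apply: dfq => //; exact: smooth_mapM.
  rewrite (@dextZ (fun=> c0) al) ?(@dextZ (fun x => nu^-1 * z x) eta);
    try exact: dfq; try by move=> l; exact: dfq.
  rewrite deta// da// /wedge !mxE !partial_cst.
  rewrite ![partial _ (fun x => nu^-1 * z x) x]partialM; try exact: dfq;
    try exact: differentiable_cst.
  rewrite !partial_cst !dz0// /m /F1 /F2.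
  have := uN x xq; rewrite /N.
  move: (al x 0 i) (al x 0 j) (th1 x 0 i) (th2 x 0 i) (th1 x 0 j) (th2 x 0 j).
  move: (z x) (z1 x) (z2 x) (u x) => za zb zc v a0 b0 a1 a2 b1 b2 E.
  transitivity (2 * c0 * s * (a1 * b2 - a2 * b1) * (1 - nu^-1 * nu * (v * (zb * zb + zc * zc)))); first by ring.
  by rewrite E mulVf// mulr1 subrr mulr0.
have [q2 [q20 q2q [rho [_ srho drho]]]] := poincare 0 (oB q) pq sbe dbe.
pose t := Num.min q1 q2.
have tq1 : ball p t `<=` (ball p q1 : set space) by apply: le_ball; rewrite ge_min lexx.
have tq2 : ball p t `<=` (ball p q2 : set space) by apply: le_ball; rewrite ge_min lexx orbT.
have tq x : ball p t x -> ball p q x by move=> /tq1/q1q.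
exists t; split; [by rewrite lt_min q10| by move=> x /tq/qU|].
exists N, z, phi, rho; split => //.
- by split; [apply: smooth_sub szq => x /tq|apply: smooth_sub sphi|apply: smooth_sub srho].
- by move=> x /tq xq; split; [exact/Npos/qr'|exact: NE].
move=> x xt; have xq := tq _ xt; split.
  apply/matrixP => i j; rewrite !mxE !big_ord1 !mxE !dz0//.
  have := dphi x (tq1 _ xt) => /rowP E; have := E j; have := E i; rewrite !mxE => -> ->.
  rewrite /F1 /F2 -/(u x) /m.
  have := uN x xq.
  have -> (y : R) : y / (2 * c0 * nu) ^+ 2 = y * (s * s) / (2 * c0 * s * nu) ^+ 2.
    by rewrite ss mulr1 !exprMn [s ^+ 2]expr2 ss mulr1.
  have : 2 * c0 * s * nu != 0.
    rewrite !mulf_neq0// ?pnatr_eq0//; apply/eqP => s0; move/eqP: ss.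
    by rewrite s0 mulr0 eq_sym oner_eq0.
  rewrite ss mulr1; move: (2 * c0 * s * nu) => M M0.
  rewrite /N; move: (z1 x) (z2 x) (u x) => zb zc v E'.
  move: (th1 x 0 i) (th2 x 0 i) (th1 x 0 j) (th2 x 0 j) => a1 a2 b1 b2.
  transitivity ((a1 * b1 + a2 * b2) * (v * (zb * zb + zc * zc))); first by rewrite E' mulr1.
  have -> : (zb * zb + zc * zc) / M ^+ 2 * (M * (v * zb * a2 - v * zc * a1) * (M * (v * zb * b2 - v * zc * b1))) =
      (v * (zb * zb + zc * zc)) * v * ((zb * a2 - zc * a1) * (zb * b2 - zc * b1)).
    by field.
  by rewrite [in RHS]E'; ring.
rewrite drho ?dphi//; try exact: tq1; try exact: tq2.
rewrite /be mulrC subrK scalerA mulVf// scale1r//.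
Qed.

End Coframe.

End CovectorCalculus.

(** * Frames adapted to a Killing field *)

Section GramSchmidt.
Context {R : realType}.
Notation space := 'rV[R]_3.
Variables (g : space -> 'M[R]_3).

(** Otherwise the identity matrix of size 3 would factor through dimension m. *)
Lemma outside_span m (E : 'I_m -> space) (C : 'I_3 -> 'I_m -> R) : (m < 3)%N ->
  exists i, dx i - \sum_k C i k *: E k != 0.
Proof.
move=> m3; apply: contrapT => H.
have E0 i : dx i = \sum_k C i k *: E k.
  by apply/eqP; rewrite -subr_eq0; apply: contra_notT H => ?; exists i.
have : 1%:M = (\matrix_(i, k) C i k) *m (\matrix_k E k) :> 'M[R]_3.
  apply/row_matrixP => i; rewrite row_mul mulmx_sum_row row1 -/(dx i) E0.
  by apply: eq_bigr => k _; rewrite rowK !mxE.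
move=> /(congr1 mxrank); rewrite mxrank1 => /eqP; apply/negP.
rewrite neq_ltn; apply/orP; right.
exact: leq_ltn_trans (mxrankM_maxr _ _) (leq_ltn_trans (rank_leq_row _) m3).
Qed.

Lemma innerZl (f : space -> R) X Y x : inner g (fun x => f x *: X x) Y x = f x * inner g X Y x.
Proof. by rewrite /inner -!scalemxAl mxE. Qed.

Lemma innerZr (f : space -> R) X Y x : inner g X (fun x => f x *: Y x) x = f x * inner g X Y x.
Proof. by rewrite /inner linearZ /= -scalemxAr mxE. Qed.

(** A coordinate field minus its projection onto the given vectors is nonzero at p for a suitable
    coordinate; its length stays positive on a ball, where it can be normalised smoothly. *)
Lemma gram_schmidt_step U m (E : 'I_m -> space -> space) p :
  open U -> is_metric U g -> U p -> (m < 3)%N ->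
  (forall k, smooth_map U (E k)) ->
  (forall x, U x -> forall k l, inner g (E k) (E l) x = (k == l)%:R) ->
  exists r : R, [/\ 0 < r, ball p r `<=` U & exists2 Y, smooth_map (ball p r) Y &
    forall x, ball p r x -> inner g Y Y x = 1 /\ forall k, inner g Y (E k) x = 0].
Proof.
move=> oU gm Up m3 sE oE.
pose C x i k := inner g (coord_field i) (E k) x.
have [i v0] := outside_span (fun k => E k p) (C p) m3.
pose Y x := dx i - \sum_k C x i k *: E k x.
have sC k : smooth U (fun x => C x i k).
  by apply: (smooth_inner oU gm) => //; exact: smooth_coord_field.
have sY : smooth_map U Y.
  move=> j; rewrite (_ : (fun x => _) = fun x => dx i 0 j - \sum_k C x i k * E k x 0 j).
    apply: smoothB => //; first exact: smooth_cst.
    by apply: smooth_sum => // k _; apply: smoothM => //; exact: sE.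
  by apply/funext => x; rewrite !mxE summxE; congr (_ - _); apply: eq_bigr => k _; rewrite mxE.
have YE x k : U x -> inner g Y (E k) x = 0.
  move=> Ux; rewrite /inner mulmxBl mulmxBl mxE [X in _ + X]mxE.
  have ip l : (C x i l *: E l x *m g x *m (E k x)^T) 0 0 = C x i l * inner g (E l) (E k) x.
    by rewrite /inner -!scalemxAl mxE.
  rewrite !mulmx_suml summxE (bigD1 k)//= big1 => [|l lk].
    by rewrite addr0 ip oE// eqxx mulr1 subrr.
  by rewrite ip oE// (negPf lk) mulr0.
have sYY : smooth U (inner g Y Y) by exact: smooth_inner.
have YYp : 0 < inner g Y Y p by have [_ _] := gm; apply.
have [r r0 rY] : exists2 r : R, 0 < r & forall x, ball p r x -> U x /\ 0 < inner g Y Y x.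
  apply: nbhs_ball_ex; apply: filterI; first exact: open_nbhs_nbhs.
  have : nbhs (inner g Y Y p) [set y | 0 < y].
    by apply: open_nbhs_nbhs; split=> //; exact: open_gt.
  exact: (smooth_continuous sYY Up).
exists r; split => //; first by move=> x /rY[].
pose f x := (Num.sqrt (inner g Y Y x))^-1.
have oB : open (ball p r : set space) by exact: ball_open.
have sq0 x : ball p r x -> Num.sqrt (inner g Y Y x) != 0.
  by move=> /rY[_ Y0]; rewrite sqrtr_eq0 -ltNge.
have sf : smooth (ball p r) f.
  apply: smoothV => //; apply: smooth_sqrt => //; last by move=> x /rY[].
  by apply: smooth_sub sYY => x /rY[].
exists (fun x => f x *: Y x).
  by apply: smooth_mapM => // j; apply: smooth_sub (sY j) => x /rY[].
move=> x xr; have [Ux Y0] := rY _ xr; split; last by move=> k; rewrite innerZl YE ?mulr0.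
rewrite innerZl innerZr; have /= E2 := sqr_sqrtr (ltW Y0).
have -> : inner g Y Y x = Num.sqrt (inner g Y Y x) * Num.sqrt (inner g Y Y x).
  by rewrite -expr2 E2.
by rewrite /f; move: (sq0 _ xr); move: (Num.sqrt _) => t t0; field.
Qed.

Lemma extend_to_frame U (xi : space -> space) p : open U -> is_metric U g -> U p ->
  smooth_map U xi -> (forall x, U x -> inner g xi xi x = 1) ->
  exists r : R, [/\ 0 < r, ball p r `<=` U & exists e : 'I_3 -> space -> space,
    [/\ e 0 = xi, forall a, smooth_map (ball p r) (e a) &
    forall x, ball p r x -> forall a b, inner g (e a) (e b) x = (a == b)%:R]].
Proof.
move=> oU gm Up sxi xi1.
have oB (q : R) : open (ball p q : set space) by exact: ball_open.
have [|x Ux k l|r1 [r10 r1U [e1 se1 e1E]]] :=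
  @gram_schmidt_step U 1 (fun=> xi) p oU gm Up isT.
- by move=> k.
- by rewrite xi1// !ord1.
have sE2 (k : 'I_2) : smooth_map (ball p r1) (if k == 0 then xi else e1).
  by case: ifP => // _ j; exact: smooth_sub (sxi j).
have [|r [r0 rr1 [e2 se2 e2E]]] := @gram_schmidt_step (ball p r1) 2
   (fun k => if k == 0 then xi else e1) p (oB _) (is_metric_sub r1U gm) (ballxx _ r10) isT sE2.
  have e10 x : ball p r1 x -> inner g xi e1 x = 0.
    move=> xr; have Ux := r1U _ xr; rewrite (inner_sym gm)//.
    by have [_ H] := e1E x xr; exact: H 0.
  move=> x xr; have Ux := r1U _ xr; have [e11 /(_ 0) e1x] := e1E x xr.
  case=> [[|[|//]] k2] [[|[|//]] l2]; rewrite ?xi1// ?e11 ?e1x ?e10//.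
exists r; split => //; first by move=> x /rr1/r1U.
pose e (a : 'I_3) := match nat_of_ord a with 0 => xi | 1 => e1 | _ => e2 end.
exists e; split => //.
  apply: ord3_ind; rewrite /e /=.
  - by move=> j; apply: smooth_sub (sxi j) => x /rr1/r1U.
  - by move=> j; apply: smooth_sub (se1 j).
  - exact: se2.
move=> x xr; have xr1 := rr1 _ xr; have Ux := r1U _ xr1.
have [e11 /(_ 0) e1x] := e1E x xr1; have [e22 e2x] := e2E x xr.
have e20 := e2x 0; have e21 := e2x 1; rewrite /= in e20 e21.
have S X Y : inner g X Y x = inner g Y X x by exact: inner_sym gm _ _ _ Ux.
apply: ord3_ind; apply: ord3_ind; rewrite /e /= ?xi1 ?e11 ?e22 ?e1x ?e20 ?e21 //.
- by rewrite S e1x.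
- by rewrite S e20.
- by rewrite S e21.
Qed.

End GramSchmidt.

(** * Structure equations of a frame whose first vector is the Sasakian field *)

Section AdaptedFrame.
Context {R : realType}.
Notation space := 'rV[R]_3.
Variables (U : set space) (g : space -> 'M[R]_3).
Hypotheses (oU : open U) (gm : is_metric U g).
Variable e : 'I_3 -> space -> space.
Hypothesis se : forall a, smooth_map U (e a).
Hypothesis on : forall x, U x -> forall a b, inner g (e a) (e b) x = (a == b)%:R.

Definition pair_cov (b X : space -> space) (x : space) : R := \sum_j X x 0 j * b x 0 j.

(** Cartan's invariant formula; it allows exterior derivatives to be computed from the brackets of a
    moving frame. *)
Lemma dext_eval b X Y x : smooth_map U b -> smooth_map U X -> smooth_map U Y -> U x ->
  \sum_i \sum_j X x 0 i * Y x 0 j * dext b i j x =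
  act X (pair_cov b Y) x - act Y (pair_cov b X) x - pair_cov b (bracket X Y) x.
Proof.
move=> sb sX sY Ux.
have aE X' Y' : smooth_map U Y' -> act X' (pair_cov b Y') x =
    \sum_j act X' (fun y => Y' y 0 j) x * b x 0 j
    + \sum_i \sum_j X' x 0 i * Y' x 0 j * partial i (fun y => b y 0 j) x.
  move=> sY'; rewrite [in LHS]/pair_cov act_sum3; last first.
    move=> i; apply: differentiableM; exact: smooth_differentiable Ux.
  rewrite [X in _ = _ + X]exchange_big -big_split; apply: eq_bigr => j _ /=.
  rewrite actM; [|exact: smooth_differentiable (sY' j) Ux|exact: smooth_differentiable (sb j) Ux].
  congr (_ + _); rewrite /act mulr_sumr; apply: eq_bigr => i _; by rewrite mulrCA mulrA.
rewrite !aE//.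
have -> : pair_cov b (bracket X Y) x = \sum_j act X (fun y => Y y 0 j) x * b x 0 j
    - \sum_j act Y (fun y => X y 0 j) x * b x 0 j.
  by rewrite -sumrB; apply: eq_bigr => j _; rewrite mxE mulrBl.
have -> : \sum_i \sum_j X x 0 i * Y x 0 j * dext b i j x =
   \sum_i \sum_j X x 0 i * Y x 0 j * partial i (fun y => b y 0 j) x
   - \sum_i \sum_j Y x 0 i * X x 0 j * partial i (fun y => b y 0 j) x.
  rewrite [X in _ - X]exchange_big -sumrB; apply: eq_bigr => i _ /=.
  by rewrite -sumrB; apply: eq_bigr => j _; rewrite /dext mulrBr [Y x 0 j * _]mulrC.
move: (\sum_j _) (\sum_i _) (\sum_j _) (\sum_i _) => a1 a2 a3 a4; ring.
Qed.

Lemma frame_mx_unit x : U x -> frame_mx e x \in unitmx.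
Proof.
move=> Ux; have := frame_mxE' on Ux => /mulmx1_unit[_].
by [].
Qed.

(** Stated for arbitrary bilinear forms, so that it also serves for the Ricci tensor and for the
    curvature as a form in two of its arguments. *)
Lemma two_form_eq (F G : 'I_3 -> 'I_3 -> R) x : U x ->
  (forall a b, \sum_i \sum_j e a x 0 i * e b x 0 j * F i j =
               \sum_i \sum_j e a x 0 i * e b x 0 j * G i j) ->
  forall i j, F i j = G i j.
Proof.
move=> Ux H i j; have uE := frame_mx_unit Ux.
pose MF := \matrix_(i, j) F i j : 'M[R]_3; pose MG := \matrix_(i, j) G i j : 'M[R]_3.
have E (K : 'I_3 -> 'I_3 -> R) a b : (frame_mx e x *m \matrix_(i, j) K i j *m (frame_mx e x)^T) a b =
    \sum_i \sum_j e a x 0 i * e b x 0 j * K i j.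
  rewrite mxE exchange_big; apply: eq_bigr => l _ /=; rewrite !mxE mulr_suml.
  by apply: eq_bigr => k _; rewrite !mxE mulrAC.
have : frame_mx e x *m MF *m (frame_mx e x)^T = frame_mx e x *m MG *m (frame_mx e x)^T.
  by apply/matrixP => a b; rewrite !E.
have uT : (frame_mx e x)^T \in unitmx by rewrite unitmx_tr.
move/(can_inj (mulmxK uT))/(can_inj (mulKmx uE)) => /matrixP/(_ i j).
by rewrite !mxE.
Qed.

Lemma pair_dual X Y x : pair_cov (dual g X) Y x = inner g X Y x.
Proof.
rewrite /inner mxE; apply: eq_bigr => j _.
by rewrite !mxE mulrC.
Qed.

Lemma smooth_dual X : smooth_map U X -> smooth_map U (dual g X).
Proof.
move=> sX j; rewrite (_ : (fun x => _) = fun x => \sum_k X x 0 k * g x k j).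
  by apply: smooth_sum => // k _; apply: smoothM => //; exact: (metric_smooth gm).
by apply/funext => x; rewrite mxE.
Qed.

Lemma metric_dual x : U x -> g x = sq (dual g (e 0) x) + sq (dual g (e 1) x) + sq (dual g (e 2) x).
Proof.
move=> Ux; have gs : (g x)^T = g x by have [_ -> ] := gm.
have : frame_mx e x *m (g x *m (frame_mx e x)^T) = 1%:M by rewrite mulmxA (frame_mxE on).
move/mulmx1C => E; rewrite -[LHS]mul1mx -E -mulmxA.
apply/matrixP => i j; rewrite mxE big_ord3.
have -> : (sq (dual g (e 0) x) + sq (dual g (e 1) x) + sq (dual g (e 2) x)) i j =
    sq (dual g (e 0) x) i j + sq (dual g (e 1) x) i j + sq (dual g (e 2) x) i j.
  by rewrite mxE [X in X + _]mxE.
rewrite !sqE.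
have F a : (g x *m (frame_mx e x)^T) i a = dual g (e a) x 0 i.
  rewrite !mxE; apply: eq_bigr => k _.
  by rewrite !mxE mulrC (metric_sym gm i k Ux).
have G a : (frame_mx e x *m g x) a j = dual g (e a) x 0 j.
  by rewrite !mxE; apply: eq_bigr => k _; rewrite !mxE.
by rewrite !F !G.
Qed.

(** Inner products of frame vectors are constant, so only the bracket terms of the Lie derivative
    survive; they say that nabla e0 is skew. *)
Lemma rot_killing x a b : killing_on U g (e 0) -> U x -> rot g e a 0 b x = - rot g e b 0 a x.
Proof.
move=> Kil Ux; have := Kil _ _ (se a) (se b) x Ux; rewrite /lie_metric.
have -> : act (e 0) (inner g (e a) (e b)) x = 0.
  by apply: (@act_locally_cst _ U oU _ (a == b)%:R) => // y /on.
rewrite (bracket_rot oU gm)// [inner g (e a) _ x](inner_sym gm)// (bracket_rot oU gm)//.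
rewrite (rot_skew oU gm se on 0 a b)//.
move: (rot g e 0 b a x) (rot g e a 0 b x) (rot g e b 0 a x) => u v w.
rewrite sub0r opprB => H.
by apply/eqP; rewrite -subr_eq0 opprK -[X in _ == X]H; apply/eqP; ring.
Qed.

(* Rotation coefficients of an orthonormal frame whose first vector is Killing. *)
Definition killing_rot (s q0 q1 q2 : R) (a b c : 'I_3) : R :=
  match nat_of_ord a, nat_of_ord b, nat_of_ord c with
  | 0, 1, 2 => q0 | 0, 2, 1 => - q0
  | 1, 0, 2 => s  | 1, 2, 0 => - s | 1, 1, 2 => q1 | 1, 2, 1 => - q1
  | 2, 0, 1 => - s | 2, 1, 0 => s | 2, 1, 2 => q2 | 2, 2, 1 => - q2
  | _, _, _ => 0
  end.

(** Skewness in the last two arguments and skewness of nabla e0 together leave four coefficients: e0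
    is geodesic, nabla e0 is s times a quarter turn of the horizontal plane, and the q's record how
    e1 and e2 turn about e0. *)
Lemma killing_rotP x a b c : killing_on U g (e 0) -> U x -> rot g e a b c x =
  killing_rot (rot g e 1 0 2 x) (rot g e 0 1 2 x) (rot g e 1 1 2 x) (rot g e 2 1 2 x) a b c.
Proof.
move=> Kil Ux.
have sk a' b' c' : rot g e a' b' c' x = - rot g e a' c' b' x by exact: (rot_skew oU gm se on).
have kil a' b' : rot g e a' 0 b' x = - rot g e b' 0 a' x by exact: rot_killing.
have dg a' b' : rot g e a' b' b' x = 0 by move: (sk a' b' b') => /=; lra.
have d0 a' : rot g e a' 0 a' x = 0 by move: (kil a' a') => /=; lra.
have z0 c' : rot g e 0 0 c' x = 0 by rewrite kil sk dg oppr0 oppr0.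
move: a b c; apply: ord3_ind; apply: ord3_ind; apply: ord3_ind;
  rewrite /killing_rot /= ?dg ?d0 ?z0//; rewrite sk ?d0 ?z0 ?oppr0//.
all: by rewrite ?opprK kil ?opprK.
Qed.

Variables s q0 q1 q2 : space -> R.
Hypotheses (ss : smooth U s) (sq0 : smooth U q0) (sq1 : smooth U q1) (sq2 : smooth U q2).
Hypothesis T : forall x, U x -> forall a b c,
  rot g e a b c x = killing_rot (s x) (q0 x) (q1 x) (q2 x) a b c.

Lemma actN X (f : space -> R) x : differentiable f x -> act X (fun y => - f y) x = - act X f x.
Proof.
by move=> df; rewrite /act -sumrN; apply: eq_bigr => i _; rewrite partialN// mulrN.
Qed.

Lemma act_rot X x a b c : U x -> act X (rot g e a b c) x =
  killing_rot (act X s x) (act X q0 x) (act X q1 x) (act X q2 x) a b c.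
Proof.
move=> Ux; rewrite (@act_eq_on _ U oU X _ (fun y => killing_rot (s y) (q0 y) (q1 y) (q2 y) a b c))//;
  last by move=> y Uy; exact: T.
have a0 : act X (fun=> 0) x = 0 by exact: act_cst.
have dd f : smooth U f -> differentiable f x by move=> sf; exact: smooth_differentiable sf Ux.
move: a b c; apply: ord3_ind; apply: ord3_ind; apply: ord3_ind;
  rewrite /killing_rot /= ?a0 ?actN//; exact: dd.
Qed.

(** The right-hand side of [curvature_rot] with the derivatives of the coefficients as independent
    data [D], so that curvature identities become polynomial ones. *)
Definition rot_curvature (k : 'I_3 -> 'I_3 -> 'I_3 -> R)
    (D : 'I_3 -> 'I_3 -> 'I_3 -> 'I_3 -> R) a b c d : R :=
  D a b c d - D b a c d
  - \sum_l k b c l * k a d l + \sum_l k a c l * k b d l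
  - \sum_l (k a b l - k b a l) * k l c d.

Lemma curvature_killing_rot a b c d x : U x ->
  inner g (curvature g (e a) (e b) (e c)) (e d) x = rot_curvature
  (killing_rot (s x) (q0 x) (q1 x) (q2 x))
  (fun i => killing_rot (act (e i) s x) (act (e i) q0 x) (act (e i) q1 x) (act (e i) q2 x))
  a b c d.
Proof.
move=> Ux; rewrite (curvature_rot oU gm se on)// !act_rot//.
by do ![congr (_ - _) | congr (_ + _)|congr (- _)]; apply: eq_bigr => l _; rewrite !T.
Qed.

Ltac frame_lra e s q0 q1 q2 x :=
  move: (act (e 0) q1 x) (act (e 1) q1 x) (act (e 2) q1 x);
  move: (act (e 0) q2 x) (act (e 1) q2 x) (act (e 2) q2 x);
  move: (act (e 0) q0 x) (act (e 1) q0 x) (act (e 2) q0 x);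
  move: (s x) (q0 x) (q1 x) (q2 x); clear; move=> *; lra.

(** The curvature condition on e0 expressed by the coefficients. The last two equations say that the
    exterior derivative of [connection_form] vanishes on pairs containing e0. *)
Definition sasaki_equations x :=
  [/\ s x * s x = 1, forall a, act (e a) s x = 0,
  act (e 1) q0 x - act (e 0) q1 x - (s x - q0 x) * q2 x = 0 &
  act (e 2) q0 x - act (e 0) q2 x - (q0 x - s x) * q1 x = 0].

Lemma sasaki_equationsP x : U x ->
  (forall X Y, smooth_map U X -> smooth_map U Y -> forall x, U x ->
     curvature g X (e 0) Y x = inner g (e 0) Y x *: X x - inner g X Y x *: e 0 x) ->
  sasaki_equations x.
Proof.
move=> Ux H.
have E a c d y : U y -> inner g (curvature g (e a) (e 0) (e c)) (e d) y =
    (0 == c)%:R * (a == d)%:R - (a == c)%:R * (0 == d)%:R.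
  move=> Uy; rewrite {1}/inner H// mulmxBl mulmxBl -!scalemxAl [LHS]mxE [X in X + _]mxE
    [X in _ + X]mxE [X in _ - X]mxE.
  by congr (_ * _ - _ * _); rewrite -(on Uy).
(* The component of R(e1, e0)e0 along e1 is s^2, the terms in q0 cancelling. *)
have s2 y : U y -> s y * s y = 1.
  move=> Uy; have := E 1 0 1 y Uy; rewrite curvature_killing_rot// /rot_curvature !big_ord3 /killing_rot /=.
  by rewrite !mulr0 !mul0r; move: (s y) (q0 y) (q1 y) (q2 y) => *; lra.
split; first exact: s2.
- move=> a; have : act (e a) (fun y => s y * s y) x = 0.
    exact: (act_locally_cst oU _ s2).
  have ds : differentiable s x by exact: smooth_differentiable ss Ux.
  rewrite actM// => H2.
  have -> : act (e a) s x = (s x * s x) * act (e a) s x by rewrite s2// mul1r.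
  have -> : s x * s x * act (e a) s x = 2^-1 * s x * (act (e a) s x * s x + s x * act (e a) s x).
    by field.
  by rewrite H2 mulr0.
all: [> have := E 1 1 2 x Ux | have := E 2 1 2 x Ux];
  rewrite curvature_killing_rot// /rot_curvature !big_ord3 /killing_rot /= !mulr0 !mul0r;
  by move: (act _ _ _) (act _ _ _) (s x) (q0 x) (q1 x) (q2 x) => *; lra.
Qed.

Lemma sasaki_curvature a c d x : U x -> sasaki_equations x ->
  inner g (curvature g (e a) (e 0) (e c)) (e d) x =
    (0 == c)%:R * (a == d)%:R - (a == c)%:R * (0 == d)%:R.
Proof.
move=> Ux [E1 E2 E3 E4]; rewrite curvature_killing_rot// /rot_curvature.
move: E1 E3 E4; rewrite !E2.
move: a c d; apply: ord3_ind; apply: ord3_ind; apply: ord3_ind;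
  rewrite !big_ord3 /killing_rot /= !mulr0 ?mul0r;
  frame_lra e s q0 q1 q2 x.
Qed.

(** For a Sasakian frame this is minus the sectional curvature of the plane of e1 and e2; the
    quotient surface has curvature 3 minus this quantity. *)
Definition gauss_curvature x := act (e 1) q2 x - act (e 2) q1 x + s x * s x
  + 2 * s x * q0 x + q1 x * q1 x + q2 x * q2 x.

Lemma sasaki_ricci b c x : U x -> sasaki_equations x ->
  (e b x *m ricci g x *m (e c x)^T) 0 0 =
  (b == c)%:R * (if b == 0 then 2 else 1 - gauss_curvature x).
Proof.
move=> Ux [E1 E2 E3 E4]; rewrite (ricci_rot oU gm se on b c Ux) big_ord3.
apply: etrans (congr2 +%R (congr2 +%R (curvature_killing_rot 0 b c 0 Ux)
  (curvature_killing_rot 1 b c 1 Ux)) (curvature_killing_rot 2 b c 2 Ux)) _.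
rewrite /gauss_curvature; move: E1 E3 E4.
move: b c; apply: ord3_ind; apply: ord3_ind;
  rewrite /rot_curvature !E2 !big_ord3 /killing_rot /= !mulr0 ?mul0r;
  frame_lra e s q0 q1 q2 x.
Qed.

(** Cartan's first structure equation: dual forms are constant on the frame, so only the bracket
    term of [dext_eval] remains. *)
Lemma dext_dual a b c x : U x ->
  \sum_i \sum_j e b x 0 i * e c x 0 j * dext (dual g (e a)) i j x =
  rot g e c b a x - rot g e b c a x.
Proof.
move=> Ux; rewrite (dext_eval (smooth_dual (se a)) (se b) (se c) Ux).
have c0 X b' : act X (pair_cov (dual g (e a)) (e b')) x = 0.
  by apply: (@act_locally_cst _ U oU _ (a == b')%:R) => // y Uy; rewrite pair_dual on.
rewrite !c0 pair_dual (inner_sym gm _ _ Ux) (bracket_rot oU gm)//.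
by rewrite subr0 sub0r opprB.
Qed.

Lemma wedge_eval (v w : space -> space) b c x :
  \sum_i \sum_j e b x 0 i * e c x 0 j * wedge (v x) (w x) i j =
  pair_cov v (e b) x * pair_cov w (e c) x - pair_cov v (e c) x * pair_cov w (e b) x.
Proof.
rewrite /pair_cov !big_ord3 /wedge.
move: (e b x 0 0) (e b x 0 1) (e b x 0 2) (e c x 0 0) (e c x 0 1) (e c x 0 2).
move: (v x 0 0) (v x 0 1) (v x 0 2) (w x 0 0) (w x 0 1) (w x 0 2) => *; ring.
Qed.

Lemma pair_expand (b X : space -> space) x : U x ->
  pair_cov b X x = \sum_k inner g X (e k) x * pair_cov b (e k) x.
Proof.
move=> Ux; rewrite /pair_cov; have E := frame_expand on (X x) Ux.
under eq_bigr => j _ do rewrite {1}E summxE mulr_suml.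
rewrite exchange_big; apply: eq_bigr => k _ /=; rewrite mulr_sumr.
by apply: eq_bigr => j _; rewrite mxE mulrA.
Qed.

Lemma actB X (f h : space -> R) x : differentiable f x -> differentiable h x ->
  act X (fun y => f y - h y) x = act X f x - act X h x.
Proof.
move=> df dh; rewrite /act -sumrB; apply: eq_bigr => i _.
by rewrite partialB// mulrBr.
Qed.

Hypothesis sas : forall x, U x -> sasaki_equations x.

(* The connection form of the quotient of U by the flow of e 0. *)
Definition connection_form x : space :=
  (q0 x - s x) *: dual g (e 0) x + q1 x *: dual g (e 1) x + q2 x *: dual g (e 2) x.

Lemma row_comb3E (a b c : R) (u v w : space) j :
  (a *: u + b *: v + c *: w) 0 j = a * u 0 j + b * v 0 j + c * w 0 j.
Proof. by rewrite !mxE. Qed.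

Lemma smooth_connection_form : smooth_map U connection_form.
Proof.
move=> j; have sd a := smooth_dual (se a) j.
rewrite (_ : (fun x => _) = fun x => (q0 x - s x) * dual g (e 0) x 0 j
   + q1 x * dual g (e 1) x 0 j + q2 x * dual g (e 2) x 0 j).
  apply: smoothD => //; [apply: smoothD => //|]; apply: smoothM => //.
  exact: smoothB.
by apply/funext => x; exact: row_comb3E.
Qed.

Lemma pair_connection_form a x : U x -> pair_cov connection_form (e a) x =
  match nat_of_ord a with 0 => q0 x - s x | 1 => q1 x | _ => q2 x end.
Proof.
move=> Ux.
have -> : pair_cov connection_form (e a) x = (q0 x - s x) * pair_cov (dual g (e 0)) (e a) x
   + q1 x * pair_cov (dual g (e 1)) (e a) x + q2 x * pair_cov (dual g (e 2)) (e a) x.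
  rewrite /pair_cov !mulr_sumr -!big_split; apply: eq_bigr => j _ /=.
  rewrite row_comb3E.
  move: (dual g (e 0) x 0 j) (dual g (e 1) x 0 j) (dual g (e 2) x 0 j) => *; ring.
rewrite !pair_dual !on//.
by move: a; apply: ord3_ind; rewrite /= !mulr0 mulr1 ?addr0 ?add0r.
Qed.

(** On e0, e2 the derivative is [rot] 2 0 1 minus [rot] 0 2 1, that is q0 - s: this is the origin of
    the first coefficient of [connection_form]. *)
Lemma dext_theta1 x i j : U x ->
  dext (dual g (e 1)) i j x = wedge (connection_form x) (dual g (e 2) x) i j.
Proof.
move=> Ux; move: i j; apply: (two_form_eq Ux) => b c.
rewrite dext_dual// wedge_eval !pair_dual !pair_connection_form// !on// !T//.
move: (s x) (q0 x) (q1 x) (q2 x) => S Q0 Q1 Q2.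
by move: b c; apply: ord3_ind; apply: ord3_ind; rewrite /killing_rot /=; ring.
Qed.

Lemma dext_theta2 x i j : U x ->
  dext (dual g (e 2)) i j x = - wedge (connection_form x) (dual g (e 1) x) i j.
Proof.
move=> Ux; move: i j.
apply: (two_form_eq (F := fun i j => dext (dual g (e 2)) i j x)
  (G := fun i j => - wedge (connection_form x) (dual g (e 1) x) i j) Ux) => b c.
under [RHS]eq_bigr do under eq_bigr do rewrite mulrN.
under [RHS]eq_bigr do rewrite sumrN.
rewrite sumrN.
rewrite dext_dual// wedge_eval !pair_dual !pair_connection_form// !on// !T//.
move: (s x) (q0 x) (q1 x) (q2 x) => S Q0 Q1 Q2.
by move: b c; apply: ord3_ind; apply: ord3_ind; rewrite /killing_rot /=; ring.
Qed.

Lemma two_formZ (k : R) b c x (F : 'I_3 -> 'I_3 -> R) :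
  \sum_i \sum_j e b x 0 i * e c x 0 j * (k * F i j) =
  k * \sum_i \sum_j e b x 0 i * e c x 0 j * F i j.
Proof.
rewrite mulr_sumr; apply: eq_bigr => i _; rewrite mulr_sumr; apply: eq_bigr => j _.
by rewrite mulrCA.
Qed.

Lemma dext_theta0 x i j : U x ->
  dext (dual g (e 0)) i j x = 2 * s x * wedge (dual g (e 1) x) (dual g (e 2) x) i j.
Proof.
move=> Ux; move: i j.
apply: (two_form_eq (F := fun i j => dext (dual g (e 0)) i j x)
  (G := fun i j => 2 * s x * wedge (dual g (e 1) x) (dual g (e 2) x) i j) Ux) => b c.
rewrite two_formZ dext_dual// wedge_eval !pair_dual !on// !T//.
move: (s x) (q0 x) (q1 x) (q2 x) => S Q0 Q1 Q2.
by move: b c; apply: ord3_ind; apply: ord3_ind; rewrite /killing_rot /=; ring.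
Qed.

(** On pairs containing e0 this is the content of the last two Sasakian equations. On e1, e2 it is
    O'Neill's formula, the correction 3 being 3 s^2. *)
Lemma dext_connection x i j : U x -> dext connection_form i j x =
  (gauss_curvature x - 3) * wedge (dual g (e 1) x) (dual g (e 2) x) i j.
Proof.
move=> Ux; move: i j; set k := _ - 3.
apply: (two_form_eq (F := fun i j => dext connection_form i j x)
  (G := fun i j => k * wedge (dual g (e 1) x) (dual g (e 2) x) i j) Ux) => b c.
rewrite two_formZ (dext_eval smooth_connection_form (se b) (se c) Ux) wedge_eval.
rewrite !pair_dual !on//.
have aW X a : act X (pair_cov connection_form (e a)) x =
    match nat_of_ord a with 0 => act X q0 x - act X s x | 1 => act X q1 x | _ => act X q2 x end.
  rewrite (@act_eq_on _ U oU X _ (fun y =>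
    match nat_of_ord a with 0 => q0 y - s y | 1 => q1 y | _ => q2 y end))//.
    move: a; apply: ord3_ind => //=; apply: actB; exact: smooth_differentiable Ux.
  by move=> y Uy; rewrite pair_connection_form.
rewrite !aW (pair_expand _ _ Ux) big_ord3 !pair_connection_form// !(bracket_rot oU gm)// !T//.
have [E1 E2 E3 E4] := sas Ux; rewrite /k /gauss_curvature.
move: E1 E3 E4.
move: b c; apply: ord3_ind; apply: ord3_ind; rewrite /killing_rot /= ?E2;
  frame_lra e s q0 q1 q2 x.
Qed.

End AdaptedFrame.

(** * Local normal forms *)

Section Hyperbolic.
Context {R : realType}.

Lemma is_derive_expRN (t : R) : is_derive t 1 (fun t => expR (- t)) (- expR (- t)).
Proof.
have := @is_derive1_comp R expR -%R t (expR (- t)) (-1) _ _.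
by rewrite mulrN1; apply.
Qed.

Lemma is_derive_cosh (t : R) : is_derive t 1 cosh (sinh t).
Proof.
have h1 := is_deriveD (is_derive_expR t) (is_derive_expRN t).
have := is_deriveZ 2^-1 h1.
rewrite /sinh (_ : 2^-1 \*: _ = cosh); last first.
  by apply/funext => u; rewrite /cosh /GRing.scale /= mulrC.
by rewrite /GRing.scale /= mulrC.
Qed.

Lemma is_derive_sinh (t : R) : is_derive t 1 sinh (cosh t).
Proof.
have h1 := is_deriveB (is_derive_expR t) (is_derive_expRN t).
have := is_deriveZ 2^-1 h1.
rewrite /cosh (_ : 2^-1 \*: _ = sinh); last first.
  by apply/funext => u; rewrite /sinh /GRing.scale /= mulrC.
by rewrite /GRing.scale /= mulrC opprK.
Qed.

End Hyperbolic.

Section LocalNormalForm.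
Context {R : realType}.
Notation space := 'rV[R]_3.
Implicit Types (g : space -> 'M[R]_3) (U V : set space).

(** In this form only the values of Y and Z at x enter, so the Killing condition is pointwise in
    them. *)
Lemma lie_metric_nabla U g (X Y Z : space -> space) x : open U -> is_metric U g ->
  smooth_map U Y -> smooth_map U Z -> U x ->
  lie_metric g X Y Z x = inner g (nabla g Y X) Z x + inner g Y (nabla g Z X) x.
Proof.
move=> oU gm sY sZ Ux; rewrite /lie_metric (nabla_metric X oU gm sY sZ Ux).
have B A C : inner g (bracket X A) C x = inner g (nabla g X A) C x - inner g (nabla g A X) C x.
  rewrite /inner -(nabla_torsion_free _ _ oU gm Ux) mulmxBl mulmxBl mxE.
  by rewrite [X in _ + X]mxE.
rewrite (inner_sym gm Y (bracket X Z) Ux) !B (inner_sym gm Y _ Ux) (inner_sym gm Y _ Ux).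
move: (inner _ _ _ _) (inner _ _ _ _) (inner _ _ _ _) (inner _ _ _ _) => *; ring.
Qed.

(* Both defining conditions are tensorial, so it suffices to test them on constant fields. *)
Lemma sasakian_sub U V g xi : open U -> is_metric U g -> open V -> V `<=` U ->
  sasakian_on U g xi -> sasakian_on V g xi.
Proof.
move=> oU gm oV VU [sxi xi1 Kil Cur]; have gmV := is_metric_sub VU gm.
have cst (v : space) : smooth_map U (fun=> v) by move=> j; exact: smooth_cst.
have cstV (v : space) : smooth_map V (fun=> v) by move=> j; exact: smooth_cst.
have sxiV : smooth_map V xi by move=> j; exact: smooth_sub (sxi j).
split => //; first by move=> x /VU; exact: xi1.
- move=> Y Z sY sZ x Vx; have := Kil _ _ (cst (Y x)) (cst (Z x)) x (VU _ Vx).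
  by rewrite (lie_metric_nabla xi oV gmV sY sZ Vx)
    (lie_metric_nabla xi oV gmV (cstV (Y x)) (cstV (Z x)) Vx).
- move=> X Y sX sY x Vx; have := Cur _ _ (cst (X x)) (cst (Y x)) x (VU _ Vx).
  have -> : inner g xi (fun=> Y x) x = inner g xi Y x by [].
  have -> : inner g (fun=> X x) (fun=> Y x) x = inner g X Y x by [].
  move=> <-; apply/rowP => l.
  exact: etrans (curvatureE oV gmV l sX sxiV sY Vx)
    (esym (curvatureE oV gmV l (cstV _) sxiV (cstV _) Vx)).
Qed.

(** The trace of eta^2 with respect to g is the squared length of xi, which is 1. *)
Lemma scalar_curvature_eta_einstein U g xi (a b : R) x : is_metric U g ->
  eta_einstein_on U g xi a b -> U x -> inner g xi xi x = 1 ->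
  scalar_curvature g x = 3 * a + b.
Proof.
move=> gm ee Ux xi1; rewrite /scalar_curvature ee// mulmxDr -!scalemxAr mxtraceD !mxtraceZ.
have gu := is_metric_unit gm Ux.
have gs : (g x)^T = g x by have [_ -> ] := gm.
rewrite mulVmx// mxtrace1 /sq /dual trmx_mul gs -mulmxA mulKmx// mxtrace_mulC.
rewrite /mxtrace big_ord1 -[X in _ + _ * X]/(inner g xi xi x) xi1.
by rewrite mulr1 mulrC.
Qed.

Lemma sasaki_coframe U g xi (a b : R) p : open U -> is_metric U g ->
  sasakian_on U g xi -> eta_einstein_on U g xi a b -> U p ->
  a + b = 2 /\ exists r : R, [/\ 0 < r, ball p r `<=` U &
    exists th1 th2 w : space -> space, exists s : R,
    [/\ [/\ smooth_map (ball p r) th1, smooth_map (ball p r) th2,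
          smooth_map (ball p r) w & smooth_map (ball p r) (dual g xi)],
    s * s = 1,
    forall x, ball p r x -> g x = sq (th1 x) + sq (th2 x) + sq (dual g xi x),
    forall x i j, ball p r x -> dext th1 i j x = wedge (w x) (th2 x) i j /\
       dext th2 i j x = - wedge (w x) (th1 x) i j &
    forall x i j, ball p r x ->
       dext w i j x = - (a + 2) * wedge (th1 x) (th2 x) i j /\
       dext (dual g xi) i j x = 2 * s * wedge (th1 x) (th2 x) i j]].
Proof.
move=> oU gm sas ee Up; have [sxi xi1 _ _] := sas.
have [r [r0 rU [e [e0 se on]]]] := extend_to_frame oU gm Up sxi xi1.
have oB : open (ball p r : set space) by exact: ball_open.
have pB : ball p r p by exact: ballxx.
have gmB := is_metric_sub rU gm.
have [_ _ Kil Cur] := sasakian_sub oU gm oB rU sas.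
rewrite -e0 in Kil Cur ee *.
pose s := rot g e 1 0 2; pose q0 := rot g e 0 1 2; pose q1 := rot g e 1 1 2; pose q2 := rot g e 2 1 2.
have sr a' b' c' : smooth (ball p r) (rot g e a' b' c') by exact: smooth_rot.
have T x : ball p r x -> forall a b c, rot g e a b c x =
    killing_rot (s x) (q0 x) (q1 x) (q2 x) a b c.
  by move=> xr a' b' c'; exact: (killing_rotP oB gmB se on).
have se' x : ball p r x -> sasaki_equations e s q0 q1 q2 x.
  by move=> xr; apply: (sasaki_equationsP oB gmB se on _ _ _ _ T xr Cur); exact: sr.
(* The eta-Einstein condition on the diagonal of the frame: c = 0 gives a + b = 2, and c = 1 makes
   the horizontal curvature constant, whence the factor - (a + 2) in the derivative of the
   connection form. *)
have ric x (c : 'I_3) : ball p r x -> a + b * ((0 == c)%:R) =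
    if c == 0 then 2 else 1 - gauss_curvature e s q0 q1 q2 x.
  move=> xr; have := sasaki_ricci oB gmB se on (sr _ _ _) (sr _ _ _) (sr _ _ _) (sr _ _ _) T c c xr (se' _ xr).
  rewrite ee; last exact: rU.
  rewrite eqxx mul1r => <-.
  have ic : inner g (e c) (e c) x = 1 by rewrite on// eqxx.
  have i0 : inner g (e 0) (e c) x = (0 == c)%:R by exact: on.
  rewrite mulmxDr mulmxDl -!scalemxAr -!scalemxAl [RHS]mxE; congr (_ + _).
    by rewrite [RHS]mxE -[X in _ * X]/(inner g (e c) (e c) x) ic mulr1.
  rewrite [RHS]mxE; congr (_ * _).
  have -> : e c x *m sq (dual g (e 0) x) *m (e c x)^T =
     (dual g (e 0) x *m (e c x)^T)^T *m (dual g (e 0) x *m (e c x)^T).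
    by rewrite /sq; move: (dual g (e 0) x) (e c x) => u v; rewrite trmx_mul trmxK !mulmxA.
  rewrite mxE big_ord1 mxE -[X in _ = X * X]/(inner g (e 0) (e c) x) i0.
  by case: (0 == c); rewrite ?mulr1 ?mulr0.
split; first by have := ric p 0 pB; rewrite mulr1.
exists r; split => //; exists (dual g (e 1)), (dual g (e 2)), (connection_form g e s q0 q1 q2), (s p).
(* All frame derivatives of s vanish, so its gradient does, and the sign at p serves for the whole
   ball. *)
have sp x : ball p r x -> s x = s p.
  move=> xr; apply: (@const_on_ball _ s p r x) => //.
    by move=> y yr; exact: smooth_differentiable (sr _ _ _) yr.
  move=> y i yr; have [_ E _ _] := se' y yr.
  have := pair_expand on (grad s) (coord_field i) yr.
  rewrite {1}/pair_cov sum_coord mxE => ->; rewrite big1// => k _.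
  suff -> : pair_cov (grad s) (e k) y = 0 by rewrite mulr0.
  by rewrite -(E k); apply: eq_bigr => j _; rewrite mxE.
split.
- have sd c : smooth_map (ball p r) (dual g (e c)) by exact: smooth_dual.
  by split => //; apply: smooth_connection_form => //; exact: sr.
- by have [] := se' p pB.
- by move=> x xr; rewrite (metric_dual gmB on xr) -addrA addrC.
- move=> x i j xr; split; first exact: (dext_theta1 oB gmB se on T).
  exact: (dext_theta2 oB gmB se on T).
- move=> x i j xr; split; last first.
    by rewrite (dext_theta0 oB gmB se on T)// sp.
  rewrite (dext_connection oB gmB se on _ _ _ _ T se')//; try exact: sr.
  have := ric x 1 xr; rewrite /= mulr0 addr0 => ->; congr (_ * _).
  by move: (gauss_curvature _ _ _ _ _ _) => t; ring.
Qed.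

Definition row3 (a b c : space -> R) (x : space) : space :=
  \row_j match nat_of_ord j with 0 => a x | 1 => b x | _ => c x end.

Lemma smooth_row3 V a b c : open V -> smooth V a -> smooth V b -> smooth V c ->
  smooth_map V (row3 a b c).
Proof.
move=> oV sa sb sc; apply: ord3_ind.
- by apply: smooth_eq_on sa => // x _; rewrite mxE.
- by apply: smooth_eq_on sb => // x _; rewrite mxE.
- by apply: smooth_eq_on sc => // x _; rewrite mxE.
Qed.

Lemma dx_jacobian (f : space -> space) x j :
  (forall j, differentiable (fun y => f y 0 j) x) ->
  dx j *m ('J f x)^T = grad (fun y => f y 0 j) x.
Proof.
move=> df; apply/rowP => i; rewrite -rowE [LHS]mxE [LHS]mxE jacobianE//.
by rewrite [RHS]mxE.
Qed.

Lemma dx_jacobian_row3 V a b c x : open V -> smooth V a -> smooth V b -> smooth V c -> V x ->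
  [/\ dx 0 *m ('J (row3 a b c) x)^T = grad a x, dx 1 *m ('J (row3 a b c) x)^T = grad b x
    & dx 2 *m ('J (row3 a b c) x)^T = grad c x].
Proof.
move=> oV sa sb sc Vx; have sr := smooth_row3 oV sa sb sc.
have dr j : differentiable (fun y => row3 a b c y 0 j) x by exact: smooth_differentiable (sr j) Vx.
have E f h : (forall y, f y = h y) -> grad f x = grad h x by move=> /funext ->.
by split; rewrite dx_jacobian//; apply: E => y; rewrite mxE.
Qed.

Lemma sq_mul (v : space) (J : 'M[R]_3) : J *m sq v *m J^T = sq (v *m J^T).
Proof. by rewrite /sq trmx_mul trmxK !mulmxA. Qed.

Lemma sqZ (k : R) (v : space) : sq (k *: v) = k ^+ 2 *: sq v.
Proof. by apply/matrixP => i j; rewrite sqE [RHS]mxE sqE !mxE; ring. Qed.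

(** The normal form as a pullback by a map f not yet known to be a coordinate system; covectors are
    pulled back by the transposed Jacobian. *)
Definition local_form_at U g (al : space -> space) p (D : set space)
    (gU : space -> 'M[R]_3) (aU : space -> space) : Prop :=
  exists r : R, [/\ 0 < r, ball p r `<=` U & exists2 f : space -> space,
    smooth_map (ball p r) f & forall x, ball p r x ->
    [/\ D (f x), g x = 'J f x *m gU (f x) *m ('J f x)^T &
       al x = aU (f x) *m ('J f x)^T]].

(** The second initial derivative of z is taken to be 0, as only the length of the initial gradient
    enters the first integral. *)
Lemma polar_sasaki U g xi (a b : R) p (z0 z10 c0 nu : R) : open U -> is_metric U g ->
  sasakian_on U g xi -> eta_einstein_on U g xi a b -> U p ->
  0 < z10 ^+ 2 -> c0 != 0 -> nu != 0 ->
  a + b = 2 /\ exists r : R, [/\ 0 < r, ball p r `<=` U & exists N z phi rho : space -> R,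
  [/\ z p = z0, [/\ smooth (ball p r) z, smooth (ball p r) phi & smooth (ball p r) rho],
    forall x, ball p r x -> 0 < N x /\
       N x = z10 ^+ 2 + (a + 2) * (z0 ^+ 2 - z x ^+ 2) &
    forall x, ball p r x ->
    g x = (N x)^-1 *: sq (grad z x) + (N x / (2 * c0 * nu) ^+ 2) *: sq (grad phi x)
       + sq (dual g xi x) /\
    dual g xi x = c0^-1 *: (grad rho x + (z x / nu) *: grad phi x)]].
Proof.
move=> oU gm sas ee Up z1p c00 nu0.
have [ab [r [r0 rU [th1 [th2 [w [s [[s1 s2 sw sal] ss gE d12 dwa]]]]]]]] := sasaki_coframe oU gm sas ee Up.
split => //.
have oB : open (ball p r : set space) by exact: ball_open.
have N0 : 0 < z10 ^+ 2 + 0 ^+ 2 by rewrite expr0n addr0.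
have [r' [r'0 r'r [N [z [phi [rho [zp sz NE H]]]]]]] := polar_coordinates oB s1 s2 sw sal
  (fun x i j xr => (d12 x i j xr).1) (fun x i j xr => (d12 x i j xr).2)
  (fun x i j xr => (dwa x i j xr).1) (fun x i j xr => (dwa x i j xr).2) z0
  (ballxx p r0) N0 c00 nu0 ss.
exists r'; split => //; first by move=> x /r'r/rU.
exists N, z, phi, rho; split => //.
  by move=> x xr; have [Np E] := NE x xr; split => //; rewrite E expr0n addr0.
move=> x xr; have [E al0] := H x xr; split => //.
by rewrite gE ?E//; exact: r'r.
Qed.

(** Here the quotient is flat, N is constantly 1, and z, phi are Cartesian coordinates v, u on
    it. *)
Lemma local_form_zero U g xi (a b : R) p : open U -> is_metric U g ->
  sasakian_on U g xi -> eta_einstein_on U g xi a b -> U p -> 3 * a + b + 2 = 0 ->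
  local_form_at U g (dual g xi) p dom_zero g_zero alpha_zero.
Proof.
move=> oU gm sas ee Up W0.
have n1 : 0 < (1 : R) ^+ 2 by rewrite expr1n.
have nu0 : (2^-1 : R) != 0 by rewrite invr_eq0 pnatr_eq0.
have [ab [r [r0 rU [N [z [phi [rho [zp [sz sphi srho] NE H]]]]]]]] :=
  polar_sasaki 0 oU gm sas ee Up n1 (oner_neq0 R) nu0.
have oB : open (ball p r : set space) by exact: ball_open.
exists r; split => //; exists (row3 rho phi z); first exact: smooth_row3.
move=> x xr; have [g0 al0] := H x xr; have [_ N1] := NE x xr.
have {}N1 : N x = 1.
  rewrite N1 (_ : a + 2 = 0) ?mul0r ?addr0 ?expr1n//; move: W0 ab; clear; lra.
have [d0 d1 d2] := dx_jacobian_row3 oB srho sphi sz xr.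
have f2 : row3 rho phi z x 0 2 = z x by rewrite mxE.
have aE : dual g xi x = alpha_zero (row3 rho phi z x) *m ('J (row3 rho phi z) x)^T.
  rewrite /alpha_zero f2 mulmxDl -scalemxAl d0 d1 al0 invr1 scale1r invrK.
  by rewrite [z x * 2]mulrC.
split => //; rewrite /g_zero f2 !mulmxDr !mulmxDl !sq_mul d1 d2.
rewrite -[in RHS]f2 -/(alpha_zero (row3 rho phi z x)) -aE g0 N1 invr1 scale1r.
have -> : (1 / (2 * 1 / 2) ^+ 2 : R) = 1 by field.
by rewrite scale1r addrC -addrA [sq (grad z x) + _]addrC addrA.
Qed.

Lemma local_form_pos U g xi (a b W : R) p : open U -> is_metric U g ->
  sasakian_on U g xi -> eta_einstein_on U g xi a b -> U p ->
  4 * W = 3 * a + b + 2 -> 0 < W ->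
  local_form_at U g (dual g xi) p dom_pos (g_pos W) (alpha_pos W).
Proof.
move=> oU gm sas ee Up WE W0.
have WN : W != 0 by rewrite gt_eqF.
have W2 : 0 < 2 * W by rewrite mulr_gt0.
have K0 : 0 < Num.sqrt (2 * W) ^+ 2 by rewrite sqr_sqrtr// ltW.
(* The values z = 0 and N = 2 W at p give N = 2 W (1 - z^2) throughout; p is placed on the equator,
   away from the poles where theta degenerates. *)
have [ab [r [r0 rU [N [z [phi [rho [zp [sz sphi srho] NE H]]]]]]]] :=
  polar_sasaki 0 oU gm sas ee Up K0 WN (oner_neq0 R).
have aW : a + 2 = 2 * W by move: WE ab; clear; lra.
have oB : open (ball p r : set space) by exact: ball_open.
have {}NE x : ball p r x -> 0 < N x /\ N x = 2 * W * (1 - z x ^+ 2).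
  move=> xr; have [N0 NE'] := NE x xr; split => //.
  by rewrite NE' aW sqr_sqrtr ?(ltW W2)//; ring.
have z1 x : ball p r x -> -1 < z x < 1.
  move=> /NE[N0 NE']; move: N0; rewrite NE' (pmulr_rgt0 _ W2) subr_gt0.
  by move: (z x) => y; clear => y2; apply/andP; split; nra.
pose t x := acos (z x).
have st : smooth (ball p r) t by exact: smooth_acos.
have zt x : ball p r x -> cos (t x) = z x.
  by move=> /z1/andP[y1 y2]; rewrite /t acosK// in_itv/= (ltW y1) (ltW y2).
have tpi x : ball p r x -> 0 < t x < pi.
  by move=> /z1/andP[y1 y2]; rewrite /t acos_gt0 ?acos_ltpi ?y1 ?y2 ?(ltW y1) ?(ltW y2).
exists r; split => //; exists (row3 rho t phi); first exact: smooth_row3.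
move=> x xr; have [g0 al0] := H x xr; have [N0 N1] := NE x xr.
have [d0 d1 d2] := dx_jacobian_row3 oB srho st sphi xr.
have f1 : row3 rho t phi x 0 1 = t x by rewrite mxE.
have dz : grad z x = - sin (t x) *: grad t x.
  apply/rowP => i; rewrite !mxE.
  rewrite -(@partial_eq_on _ (ball p r) (fun y => cos (t y)) z i oB zt x xr).
  by rewrite (partial_comp1 _ (is_derive_cos _))//; exact: smooth_differentiable st xr.
have sc : z x ^+ 2 + sin (t x) ^+ 2 = 1 by rewrite -zt// cos2Dsin2.
have s2 : N x = 2 * W * sin (t x) ^+ 2 by rewrite N1 -sc; ring.
have sn0 : sin (t x) != 0.
  by apply: contraTneq N0 => s0; rewrite s2 s0 expr0n mulr0 ltxx.
have aE : dual g xi x = alpha_pos W (row3 rho t phi x) *m ('J (row3 rho t phi) x)^T.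
  by rewrite /alpha_pos f1 -scalemxAl mulmxDl -scalemxAl d0 d2 al0 zt// divr1 div1r.
have aE2 : sq (dual g xi x) = (1 / W) ^+ 2 *: sq (grad rho x + cos (t x) *: grad phi x).
  by rewrite al0 sqZ zt// divr1 div1r.
split => //; first by rewrite /dom_pos /= f1; exact: tpi.
rewrite /g_pos f1 -scalemxAr -scalemxAl !mulmxDr !mulmxDl -!scalemxAr -!scalemxAl !sq_mul d1 d2.
rewrite mulmxDl -scalemxAl d0 d2 g0 aE2 dz sqZ s2 sqrrN.
move: (sin _) sn0 (sq _) (sq _) (sq _) => S S0 m1 m2 m3.
apply/matrixP => i j; rewrite !mxE.
by field; rewrite S0 WN.
Qed.

Lemma local_form_neg U g xi (a b W : R) p : open U -> is_metric U g ->
  sasakian_on U g xi -> eta_einstein_on U g xi a b -> U p ->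
  4 * W = 3 * a + b + 2 -> W < 0 ->
  local_form_at U g (dual g xi) p dom_neg (g_neg W) (alpha_neg W).
Proof.
move=> oU gm sas ee Up WE W0.
have WN : W != 0 by rewrite lt_eqF.
have mW : 0 < - (2 * W) by rewrite oppr_gt0 pmulr_rlt0.
have K0 : 0 < Num.sqrt (- (2 * W)) ^+ 2 by rewrite sqr_sqrtr ?ltW.
(* The values z = sqrt 2 and N = - 2 W at p are consistent with N = - 2 W (z^2 - 1), and z > 1 near
   p allows z = cosh theta with theta > 0. *)
have [ab [r [r0 rU [N [z [phi [rho [zp [sz sphi srho] NE H]]]]]]]] :=
  polar_sasaki (Num.sqrt 2) oU gm sas ee Up K0 WN (oner_neq0 R).
have aW : a + 2 = 2 * W by move: WE ab; clear; lra.
have {}NE x : ball p r x -> 0 < N x /\ N x = - (2 * W) * (z x ^+ 2 - 1).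
  move=> xr; have [N0 NE'] := NE x xr; split => //.
  by rewrite NE' aW !sqr_sqrtr ?ler0n ?ltW//; ring.
have pB : ball p r p by exact: ballxx.
have [r1 r10 z1] : exists2 r1 : R, 0 < r1 & forall x, ball p r1 x -> 1 < z x.
  apply: nbhs_ball_ex; have : nbhs (z p) [set y | 1 < y].
    apply: open_nbhs_nbhs; split; first exact: open_gt.
    by rewrite /= zp -[X in X < _]sqrtr1 ltr_sqrt// ltr1n.
  exact: (smooth_continuous sz pB).
pose q := Num.min r r1.
have q0 : 0 < q by rewrite lt_min r0.
have qr : ball p q `<=` (ball p r : set space) by apply: le_ball; rewrite ge_min lexx.
have qr1 : ball p q `<=` (ball p r1 : set space) by apply: le_ball; rewrite ge_min lexx orbT.
have oB : open (ball p q : set space) by exact: ball_open.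
have szq : smooth (ball p q) z by exact: smooth_sub sz.
have sphiq : smooth (ball p q) phi by exact: smooth_sub sphi.
have srhoq : smooth (ball p q) rho by exact: smooth_sub srho.
have z2 x : ball p q x -> 0 < z x ^+ 2 - 1.
  by move=> /qr1/z1 z1x; rewrite subr_gt0 -[X in X < _](expr1n _ 2) ltr_pXn2r// ?nnegrE// ltW// (lt_trans _ z1x).
pose h x := Num.sqrt (z x ^+ 2 - 1).
have sh : smooth (ball p q) h.
  apply: smooth_sqrt => //; apply: smoothB => //; last exact: smooth_cst.
  by apply: (@smooth_eq_on _ _ (fun x => z x * z x)) => //; exact: smoothM.
have h2 x : ball p q x -> h x * h x = z x ^+ 2 - 1.
  by move=> /z2 z2x; rewrite -expr2 sqr_sqrtr// ltW.
have h0 x : ball p q x -> 0 < h x by move=> /z2 z2x; rewrite sqrtr_gt0.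
(* The inverse hyperbolic cosine of z, with h in the role of sinh theta. *)
pose t x := ln (z x + h x).
have zh x : ball p q x -> 1 < z x + h x.
  by move=> xq; have := h0 x xq; have := z1 x (qr1 _ xq); clear; lra.
have st : smooth (ball p q) t.
  by apply: smooth_ln => //; [exact: smoothD|move=> x /zh; exact: lt_trans].
have et x : ball p q x -> expR (t x) = z x + h x /\ expR (- t x) = z x - h x.
  move=> xq; have p0 : 0 < z x + h x by rewrite (lt_trans _ (zh x xq)).
  have E : expR (t x) = z x + h x by rewrite /t lnK.
  split => //; rewrite expRN E; apply: (mulfI (lt0r_neq0 p0)); rewrite mulfV ?gt_eqF//.
  have := h2 x xq; move: (z x) (h x) => a' b' E'; transitivity (a' ^+ 2 - b' * b'); last by ring.
  by rewrite E'; ring.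
have ch x : ball p q x -> cosh (t x) = z x.
  by move=> /et[e1 e2]; rewrite /cosh e1 e2; field.
have shE x : ball p q x -> sinh (t x) = h x.
  by move=> /et[e1 e2]; rewrite /sinh e1 e2; field.
exists q; split => //; first by move=> x /qr/rU.
exists (row3 rho t phi); first exact: smooth_row3.
move=> x xq; have [g0 al0] := H x (qr _ xq); have [N0 N1] := NE x (qr _ xq).
have [d0 d1 d2] := dx_jacobian_row3 oB srhoq st sphiq xq.
have f1 : row3 rho t phi x 0 1 = t x by rewrite mxE.
have dz : grad z x = h x *: grad t x.
  apply/rowP => i; rewrite !mxE.
  rewrite -(@partial_eq_on _ (ball p q) (fun y => cosh (t y)) z i oB ch x xq).
  rewrite -shE//; apply: partial_comp1; last exact: smooth_differentiable st xq.
  exact: is_derive_cosh.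
have s2 : N x = - (2 * W) * h x ^+ 2 by rewrite N1 -(h2 x xq) [h x ^+ 2]expr2.
have hn0 := lt0r_neq0 (h0 x xq).
have aE : dual g xi x = alpha_neg W (row3 rho t phi x) *m ('J (row3 rho t phi) x)^T.
  by rewrite /alpha_neg f1 -scalemxAl mulmxDl -scalemxAl d0 d2 al0 ch// divr1 div1r.
have aE2 : sq (dual g xi x) = (1 / W) ^+ 2 *: sq (grad rho x + cosh (t x) *: grad phi x).
  by rewrite al0 sqZ ch// divr1 div1r.
split => //; first by rewrite /dom_neg /= f1 ln_gt0// zh.
rewrite /g_neg f1 -scalemxAr -scalemxAl mulmxBr mulmxBl !mulmxDr !mulmxDl -!scalemxAr -!scalemxAl !sq_mul d1 d2.
rewrite mulmxDl -scalemxAl d0 d2 g0 aE2 dz sqZ s2 shE//.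
move: (h x) hn0 (sq _) (sq _) (sq _) => S S0 m1 m2 m3.
apply/matrixP => i j; rewrite !mxE.
by rewrite mulNr invrN; field; rewrite S0 WN.
Qed.

End LocalNormalForm.

(** * Changes of charts *)

Section Charts.
Context {R : realType} {M : topologicalType}.
Notation space := 'rV[R]_3.
Variable A : set (chart R M).
Hypothesis sA : smooth_structure A.

Lemma open_chart_im (c : chart R M) : is_chart c -> open (chart_im c : set space).
Proof. by move=> [oD _ _ oM]; exact: oM oD _. Qed.

Definition change_coordinates (c : chart R M) (V : set space) (f : space -> space) : chart R M :=
  Chart (chart_dom c `&` chart_map c @^-1` V) (f \o chart_map c).

(** Membership follows from maximality of the atlas: the transitions to and from any other chart are
    those of [c] composed with [h] or [f]. *)
Lemma change_coordinatesP c V f h : A c -> open V -> V `<=` chart_im c ->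
  smooth_map V f -> (forall W, open W -> W `<=` V -> open (f @` W)) ->
  (forall x, V x -> h (f x) = x) -> smooth_map (f @` V) h ->
  A (change_coordinates c V f).
Proof.
move=> Ac oV Vc sf fo fK sh; have [Achart _ Acomp Amax] := sA.
have [oD inj cont om] := Achart c Ac.
set c' := change_coordinates c V f.
have oD' : open (chart_dom c').
  rewrite openE => q [Dq Vq]; apply: filterI; first exact: open_nbhs_nbhs.
  by apply: (cont q Dq); exact: open_nbhs_nbhs.
have map' W : chart_map c' @` W = f @` (chart_map c @` W) by rewrite image_comp.
have subV W : W `<=` chart_dom c' -> chart_map c @` W `<=` V.
  by move=> WD _ [q /WD[_ Vq] <-].
have chart' : is_chart c'.
  split; first exact: oD'.
  - move=> q q' /set_mem[Dq Vq] /set_mem[Dq' Vq'] /= fq.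
    apply: inj; rewrite ?inE//.
    by rewrite -[LHS](fK _ Vq) fq fK.
  - move=> q [Dq Vq]; apply: continuous_comp; first exact: cont.
    apply: continuous_map => j; exact: smooth_continuous (sf j) Vq.
  - move=> W oW WD; rewrite map'; apply: fo; last exact: subV.
    by apply: om => // q /WD[].
have oov d : A d -> open (overlap c' d) by move=> /Achart[oDd _ _ _]; exact: openI.
apply: Amax => // d Ad; split.
- have [t tP st] := Acomp c d Ac Ad; exists (t \o h).
    by move=> q [[Dq Vq] Ddq] /=; rewrite fK// tP.
  have oU : open (chart_map c' @` overlap c' d).
    by have [_ _ _] := chart'; apply; [exact: oov|move=> q []].
  move=> j; apply: (smooth_comp oU (st j)).
    by move=> i; apply: smooth_sub (sh i) => _ [q [[Dq Vq] _] <-]; exists (chart_map c q).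
  move=> _ [q [[Dq Vq] Ddq] <-] /=; rewrite fK//; by exists q.
- have [t tP st] := Acomp d c Ad Ac; exists (f \o t).
    by move=> q [Ddq [Dq Vq]] /=; rewrite tP.
  have oU : open (chart_map d @` overlap d c').
    have [_ _ _] := Achart d Ad; apply; first by rewrite /overlap setIC; exact: oov.
    by move=> q [].
  move=> j; apply: (smooth_comp oU (sf j)).
    by move=> i; apply: smooth_sub (st i) => _ [q [Ddq [Dq _]] <-]; exists q.
  by move=> _ [q [Ddq [Dq Vq]] <-] /=; rewrite tP.
Qed.

Variables (g : chart R M -> space -> 'M[R]_3) (e0 : chart R M -> space -> space).
Hypotheses (rm : riemannian_metric A g) (vf : vector_field A e0).

(** The relation g = J gU J^T with g invertible forces J to be invertible, so the inverse function
    theorem applies without a separate proof that the coordinate functions are independent.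
    Comparing with the transformation laws and cancelling J gives the normal form in the new
    chart. *)
Lemma chart_of_local_form c q D gU aU : A c -> chart_dom c q ->
  local_form_at (chart_im c) (g c) (dual (g c) (e0 c)) (chart_map c q) D gU aU ->
  exists c', [/\ A c', chart_dom c' q, chart_im c' `<=` D &
    forall x, chart_im c' x -> g c' x = gU x /\ dual (g c') (e0 c') x = aU x].
Proof.
move=> Ac Dq [r [r0 rU [f sf fP]]].
have [gm gtr] := rm; have [_ etr] := vf.
have oB : open (ball (chart_map c q) r : set space) by exact: ball_open.
have pB : ball (chart_map c q) r (chart_map c q) by exact: ballxx.
have uJ x : ball (chart_map c q) r x -> 'J f x \in unitmx.
  move=> xr; have [_ gE _] := fP x xr.
  have := is_metric_unit (gm c Ac) (rU _ xr).
  by rewrite gE !unitmx_mul => /andP[/andP[]].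
have [V [oV Vp VB fo [h fK sh]]] := inverse_function oB pB sf (uJ _ pB).
have Vc : V `<=` chart_im c by move=> x /VB/rU.
have sfV : smooth_map V f by move=> j; exact: smooth_sub (sf j).
have Ac' := change_coordinatesP Ac oV Vc sfV fo fK sh.
exists (change_coordinates c V f); split => //.
  by move=> _ [m [Dm Vm] <-]; have [] := fP _ (VB _ Vm).
move=> _ [m [Dm Vm] <-]; have Bm := VB _ Vm; have [_ gE aE] := fP _ Bm.
have uJm := uJ _ Bm.
have uJT : ('J f (chart_map c m))^T \in unitmx by rewrite unitmx_tr.
have tr : is_transition c (change_coordinates c V f) f by [].
have ov : overlap c (change_coordinates c V f) m by split.
have g1 := gtr _ _ _ Ac Ac' tr m ov; have e1 := etr _ _ _ Ac Ac' tr m ov.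
have gEq : g (change_coordinates c V f) (chart_map (change_coordinates c V f) m)
    = gU (f (chart_map c m)).
  by apply: (can_inj (mulKmx uJm)); apply: (can_inj (mulmxK uJT)); rewrite -gE -g1.
split; first by rewrite gEq.
apply: (can_inj (mulmxK uJT)); rewrite -aE /dual g1 e1.
by rewrite !mulmxA.
Qed.

End Charts.

Lemma sasaki_classification (R : realType) (M : topologicalType) (A : set (chart R M))
    (g : chart R M -> 'rV[R]_3 -> 'M[R]_3) (e0 : chart R M -> 'rV[R]_3 -> 'rV[R]_3) :
  smooth_manifold A -> riemannian_metric A g -> sasakian A g e0 -> eta_einstein A g e0 ->
  exists2 Rsc : R,
    (forall c x, A c -> chart_im c x -> scalar_curvature (g c) x = Rsc) &
    let W := (Rsc + 2) / 4 in
    [/\ 0 < W -> has_local_form A g e0 dom_pos (g_pos W) (alpha_pos W),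
        W = 0 -> has_local_form A g e0 dom_zero g_zero alpha_zero &
        W < 0 -> has_local_form A g e0 dom_neg (g_neg W) (alpha_neg W)].
Proof.
move=> [_ _ sA] rm [vf sas] [a [b ee]]; have [gm _] := rm.
have [Achart cover _ _] := sA.
exists (3 * a + b) => [c x Ac xc|W].
  have [_ xi1 _ _] := sas c Ac.
  exact: scalar_curvature_eta_einstein (gm c Ac) (ee c Ac) xc (xi1 x xc).
have WE : 4 * W = 3 * a + b + 2 by rewrite /W; field.
have H D gU aU : (forall c q, A c -> chart_dom c q -> local_form_at (chart_im c) (g c)
    (dual (g c) (e0 c)) (chart_map c q) D gU aU) -> has_local_form A g e0 D gU aU.
  move=> H q; have [c Ac Dq] := cover q.
  exact (chart_of_local_form sA rm vf Ac Dq (H c q Ac Dq)).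
have im (c : chart R M) q : chart_dom c q -> chart_im c (chart_map c q) by exists q.
split => W0; apply: H => c q Ac Dq; have oc := open_chart_im (Achart c Ac).
- exact (local_form_pos oc (gm c Ac) (sas c Ac) (ee c Ac) (im c q Dq) WE W0).
- have Wz : 3 * a + b + 2 = 0 by rewrite -WE W0 mulr0.
  exact (local_form_zero oc (gm c Ac) (sas c Ac) (ee c Ac) (im c q Dq) Wz).
- exact (local_form_neg oc (gm c Ac) (sas c Ac) (ee c Ac) (im c q Dq) WE W0).
Qed.

(** * The models *)

Section OrthonormalCoframe.
Context {R : realType}.
Notation space := 'rV[R]_3.
Variables (U : set space) (g : space -> 'M[R]_3) (e th : 'I_3 -> space -> space).
Hypotheses (oU : open U) (se : forall a, smooth_map U (e a)).
Hypothesis sth : forall a, smooth_map U (th a).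
Hypothesis gE : forall x, U x -> g x = \sum_a sq (th a x).
Hypothesis dual_basis : forall x, U x -> forall a b, (e a x *m (th b x)^T) 0 0 = (a == b)%:R.

Lemma coframe_expand (v w : space) x : U x -> (v *m g x *m w^T) 0 0 =
  \sum_a (v *m (th a x)^T) 0 0 * (w *m (th a x)^T) 0 0.
Proof.
move=> Ux; rewrite gE// mulmx_sumr mulmx_suml summxE; apply: eq_bigr => a _.
rewrite /sq; have -> : v *m ((th a x)^T *m th a x) *m w^T =
    (v *m (th a x)^T) *m (w *m (th a x)^T)^T by rewrite trmx_mul trmxK !mulmxA.
by rewrite mxE big_ord1 [X in _ * X]mxE.
Qed.

Lemma coframe_orthonormal x : U x -> forall a b, inner g (e a) (e b) x = (a == b)%:R.
Proof.
move=> Ux a b; rewrite /inner coframe_expand// (bigD1 b)//= big1 => [|c cb].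
  by rewrite !dual_basis// eqxx mulr1 addr0.
by rewrite !dual_basis// eq_sym [b == c]eq_sym (negPf cb) mulr0.
Qed.

(** A sum of squares is definite here because a vector annihilated by all [th a] vanishes, the
    matrices of frame and coframe being mutually inverse up to transposition. *)
Lemma coframe_metric : is_metric U g.
Proof.
split.
- move=> i j; apply: (@smooth_eq_on _ _ (fun x => \sum_a th a x 0 i * th a x 0 j)) => //.
    by move=> x Ux; rewrite gE// summxE; apply: eq_bigr => a _; rewrite sqE.
  by apply: smooth_sum => // a _; apply: smoothM => //; exact: sth.
- move=> x Ux; rewrite gE// raddf_sum; apply: eq_bigr => a _.
  by apply/matrixP => i j; rewrite [LHS]mxE !sqE mulrC.
- move=> x v Ux v0; rewrite coframe_expand//.
  rewrite lt_def sumr_ge0 ?andbT => [|a _]; last by rewrite -expr2 sqr_ge0.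
  apply: contraNneq v0 => /eqP.
  rewrite psumr_eq0 => [/allP H|a _]; last by rewrite -expr2 sqr_ge0.
  have vth a : (v *m (th a x)^T) 0 0 = 0.
    by have /implyP/(_ isT) := H a (mem_index_enum a); rewrite mulf_eq0 orbb => /eqP.
  have E1 : frame_mx e x *m (frame_mx th x)^T = 1%:M.
    apply/matrixP => a b; rewrite [RHS]mxE -(dual_basis Ux) !mxE.
    by apply: eq_bigr => i _; rewrite !mxE.
  rewrite -[v]mulmx1 -(mulmx1C E1) mulmxA.
  suff -> : v *m (frame_mx th x)^T = 0 by rewrite mul0mx.
  apply/rowP => a; rewrite [RHS]mxE -(vth a) !mxE.
  by apply: eq_bigr => i _; rewrite !mxE.
Qed.

Lemma coframe_dual x a : U x -> dual g (e a) x = th a x.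
Proof.
move=> Ux; rewrite /dual gE// mulmx_sumr (bigD1 a)//= big1 => [|b ba].
  rewrite addr0 /sq mulmxA [_ *m (_)^T]mx11_scalar dual_basis// eqxx.
  by rewrite mul_scalar_mx scale1r.
rewrite /sq mulmxA [_ *m (_)^T]mx11_scalar dual_basis// eq_sym (negPf ba).
by rewrite mul_scalar_mx scale0r.
Qed.

End OrthonormalCoframe.

(** * From the brackets of an orthonormal frame to the Sasakian eta-Einstein conditions *)

Section ModelFrame.
Context {R : realType}.
Notation space := 'rV[R]_3.
Variables (U : set space) (g : space -> 'M[R]_3) (e : 'I_3 -> space -> space).
Hypotheses (oU : open U) (gm : is_metric U g) (se : forall a, smooth_map U (e a)).
Hypothesis on : forall x, U x -> forall a b, inner g (e a) (e b) x = (a == b)%:R.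

(* Koszul: a tensor symmetric in its first two and skew in its last two arguments vanishes. *)
Lemma rot_of_bracket (k : 'I_3 -> 'I_3 -> 'I_3 -> R) x : U x ->
  (forall a b c, k a b c = - k a c b) ->
  (forall a b c, inner g (bracket (e a) (e b)) (e c) x = k a b c - k b a c) ->
  forall a b c, rot g e a b c x = k a b c.
Proof.
move=> Ux ks bk.
have sy a b c : rot g e a b c x - k a b c = rot g e b a c x - k b a c.
  have := bk a b c; rewrite (bracket_rot oU gm)//.
  move: (rot g e a b c x) (rot g e b a c x) (k a b c) (k b a c) => *; lra.
have sk a b c : rot g e a b c x - k a b c = - (rot g e a c b x - k a c b).
  by rewrite (rot_skew oU gm se on)// ks; ring.
move=> a b c; apply/eqP; rewrite -subr_eq0; apply/eqP.
have E : rot g e a b c x - k a b c = - (rot g e a b c x - k a b c).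
  by rewrite {1}sy sk sy sk opprK sy sk.
by move: E; move: (_ - _) => t; lra.
Qed.

Lemma bracket_anti (X Y : space -> space) x : bracket X Y x = - bracket Y X x.
Proof. by apply/rowP => i; rewrite !mxE opprB. Qed.

Lemma bilinear_sum (v w : space) (P : 'M[R]_3) :
  (v *m P *m w^T) 0 0 = \sum_i \sum_j v 0 i * w 0 j * P i j.
Proof.
rewrite mxE exchange_big; apply: eq_bigr => j _ /=; rewrite !mxE mulr_suml.
by apply: eq_bigr => i _; rewrite mulrAC.
Qed.

Lemma frame_matrix_eq (P Q : 'M[R]_3) x : U x ->
  (forall b c, (e b x *m P *m (e c x)^T) 0 0 = (e b x *m Q *m (e c x)^T) 0 0) -> P = Q.
Proof.
move=> Ux H; apply/matrixP; apply: (two_form_eq on Ux) => b c.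
by rewrite -!bilinear_sum.
Qed.

(** Together with [sasaki_rhs_bilinear] this writes both sides of the Sasakian condition as bilinear
    forms in X and Y at x, so that checking frame vectors suffices. *)
Lemma curvature_bilinear X Y Z x l : smooth_map U X -> smooth_map U Y -> smooth_map U Z ->
  U x -> curvature g X Z Y x 0 l =
  \sum_i \sum_k X x 0 i * Y x 0 k * \sum_j Z x 0 j * riem g i j k l x.
Proof.
move=> sX sY sZ Ux; rewrite (curvatureE oU gm l sX sZ sY Ux).
apply: eq_bigr => i _; rewrite exchange_big; apply: eq_bigr => k _ /=.
by rewrite mulr_sumr; apply: eq_bigr => j _; rewrite !mulrA [_ * Y x 0 k]mulrAC.
Qed.

Lemma sasaki_rhs_bilinear X Y Z x l :
  (inner g Z Y x *: X x - inner g X Y x *: Z x) 0 l =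
  \sum_i \sum_k X x 0 i * Y x 0 k * ((i == l)%:R * dual g Z x 0 k - Z x 0 l * g x i k).
Proof.
have -> : (inner g Z Y x *: X x - inner g X Y x *: Z x) 0 l =
   inner g Z Y x * X x 0 l - inner g X Y x * Z x 0 l by rewrite !mxE.
transitivity (\sum_i \sum_k X x 0 i * Y x 0 k * ((i == l)%:R * dual g Z x 0 k)
   - \sum_i \sum_k X x 0 i * Y x 0 k * g x i k * Z x 0 l).
  congr (_ - _).
    rewrite (bigD1 l)//= [X in _ = _ + X]big1 => [|i il]; last first.
      by apply: big1 => k _; rewrite (negPf il) mul0r mulr0.
    rewrite addr0 eqxx /inner mxE mulr_suml; apply: eq_bigr => k _.
    by rewrite mul1r [X in _ * X * _]mxE /dual; move: ((_ *m _) 0 k) => t; ring.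
  rewrite /inner bilinear_sum mulr_suml; apply: eq_bigr => i _.
  by rewrite mulr_suml.
rewrite -sumrB; apply: eq_bigr => i _; rewrite -sumrB; apply: eq_bigr => k _.
by ring.
Qed.

Variables s q0 q1 q2 : space -> R.
Hypotheses (ss : smooth U s) (sq0 : smooth U q0) (sq1 : smooth U q1) (sq2 : smooth U q2).
Hypothesis T : forall x, U x -> forall a b c,
  rot g e a b c x = killing_rot (s x) (q0 x) (q1 x) (q2 x) a b c.
Hypothesis sas : forall x, U x -> sasaki_equations e s q0 q1 q2 x.

(** The coefficients [killing_rot] k 0 l are skew in k and l. *)
Lemma killing_of_rot : killing_on U g (e 0).
Proof.
move=> Y Z sY sZ x Ux; rewrite (lie_metric_nabla (e 0) oU gm sY sZ Ux).
rewrite (inner_sym gm Y _ Ux).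
have E X X' : inner g (nabla g X (e 0)) X' x =
    \sum_k \sum_l inner g X (e k) x * inner g X' (e l) x *
      killing_rot (s x) (q0 x) (q1 x) (q2 x) k 0 l.
  rewrite (nabla_frame on _ _ _ Ux); apply: eq_bigr => k _.
  rewrite [inner g (nabla g (e k) (e 0)) X' x](frame_inner gm on _ _ Ux) mulr_sumr; apply: eq_bigr => l _.
  by rewrite -T// /rot; move: (inner _ _ _ _) (inner _ _ _ _) (inner _ _ _ _) => *; ring.
rewrite !E !big_ord3 /killing_rot /=.
move: (inner g Y (e 0) x) (inner g Y (e 1) x) (inner g Y (e 2) x).
move: (inner g Z (e 0) x) (inner g Z (e 1) x) (inner g Z (e 2) x) => *; ring.
Qed.

Lemma sasakian_of_rot : sasakian_on U g (e 0).
Proof.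
split => //; first by move=> x Ux; rewrite on.
  exact: killing_of_rot.
move=> X Y sX sY x Ux; apply/rowP => l.
rewrite (curvature_bilinear l sX sY (se 0) Ux) sasaki_rhs_bilinear.
apply: eq_bigr => i _; apply: eq_bigr => k _; congr (_ * _); move: i k.
apply: (two_form_eq on (F := fun i k => \sum_j e 0 x 0 j * riem g i j k l x)
  (G := fun i k => (i == l)%:R * dual g (e 0) x 0 k - e 0 x 0 l * g x i k) Ux) => a c.
rewrite -(curvature_bilinear l (se a) (se c) (se 0) Ux) -sasaki_rhs_bilinear.
congr ((_ : 'rV_3) 0 l); apply: (frame_eq on Ux) => d.
rewrite -/(inner g (curvature g (e a) (e 0) (e c)) (e d) x).
rewrite (sasaki_curvature oU gm se on ss sq0 sq1 sq2 T _ _ _ Ux (sas Ux)).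
rewrite !on// mulmxBl mulmxBl -!scalemxAl [RHS]mxE [X in _ = X + _]mxE
  [X in _ = _ + X]mxE [X in _ = _ - X]mxE.
by congr (_ * _ - _ * _); rewrite -(on Ux).
Qed.

Lemma eta_einstein_of_rot (a : R) :
  (forall x, U x -> 1 - gauss_curvature e s q0 q1 q2 x = a) ->
  eta_einstein_on U g (e 0) a (2 - a).
Proof.
move=> Ha x Ux; apply: (frame_matrix_eq Ux) => b c.
rewrite (sasaki_ricci oU gm se on ss sq0 sq1 sq2 T _ _ Ux (sas Ux)) Ha//.
rewrite mulmxDr mulmxDl -!scalemxAr -!scalemxAl [RHS]mxE [X in _ = X + _]mxE [X in _ = _ + X]mxE.
rewrite -[X in _ = _ * X + _]/(inner g (e b) (e c) x) on//.
have -> : (e b x *m sq (dual g (e 0) x) *m (e c x)^T) 0 0 = (0 == b)%:R * (0 == c)%:R.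
  have -> : e b x *m sq (dual g (e 0) x) *m (e c x)^T =
     (dual g (e 0) x *m (e b x)^T)^T *m (dual g (e 0) x *m (e c x)^T).
    by rewrite /sq; move: (dual g (e 0) x) => u; rewrite trmx_mul trmxK !mulmxA.
  by rewrite mxE big_ord1 mxE; congr (_ * _); rewrite -(on Ux).
by move: b c; apply: ord3_ind; apply: ord3_ind; rewrite /=; ring.
Qed.

End ModelFrame.

Section ModelStructure.
Context {R : realType}.
Notation space := 'rV[R]_3.

(** e1 and e2 are horizontal lifts of the radial and angular unit vectors of geodesic polar
    coordinates on the quotient (Cartesian ones if q = 0). The function q is the geodesic curvature
    of the circles, and e1 q + q^2 = - 2 W is its Riccati equation for curvature 2 W. *)
Lemma model_structure (U : set space) (g : space -> 'M[R]_3) (e th : 'I_3 -> space -> space)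
    (s W : R) (q : space -> R) :
  open U -> (forall a, smooth_map U (e a)) -> (forall a, smooth_map U (th a)) -> smooth U q ->
  (forall x, U x -> g x = \sum_a sq (th a x)) ->
  (forall x, U x -> forall a b, (e a x *m (th b x)^T) 0 0 = (a == b)%:R) ->
  s * s = 1 ->
  (forall x, U x -> [/\ bracket (e 0) (e 1) x = 0, bracket (e 0) (e 2) x = 0 &
     bracket (e 1) (e 2) x = - (2 * s) *: e 0 x - q x *: e 2 x]) ->
  (forall x, U x -> act (e 0) q x = 0 /\ act (e 1) q x + q x * q x = - (2 * W)) ->
  defines_sasakian_eta_einstein U g (th 0) (4 * W - 2).
Proof.
move=> oU se sth sq gE db s1 br dq.
have gm := coframe_metric oU sth gE db.
have on := coframe_orthonormal gE db.
have sc (c : R) : smooth U (fun=> c) by exact: smooth_cst.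
(* The frame is invariant under the flow of e0, so the connection form vanishes on e0, which means
   q0 = s. *)
pose k x := killing_rot s s 0 (q x).
have T x : U x -> forall a b c, rot g e a b c x = k x a b c.
  move=> Ux; apply: (rot_of_bracket oU gm se on) => //.
    by apply: ord3_ind; apply: ord3_ind; apply: ord3_ind; rewrite /k /killing_rot /= ?opprK ?oppr0.
  have [b01 b02 b12] := br x Ux.
  pose B a b c := inner g (bracket (e a) (e b)) (e c) x.
  have BN a b c : B a b c = - B b a c.
    by rewrite /B /inner bracket_anti !mulNmx [LHS]mxE.
  have B01 c : B 0 1 c = 0 by rewrite /B /inner b01 !mul0mx mxE.
  have B02 c : B 0 2 c = 0 by rewrite /B /inner b02 !mul0mx mxE.
  have B12 c : B 1 2 c = - (2 * s) * (0 == c)%:R - q x * (2 == c)%:R.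
    rewrite /B /inner b12 !mulmxBl -!scalemxAl [LHS]mxE [X in X + _]mxE [X in _ + X]mxE [X in _ - X]mxE.
    by congr (_ * _ - _ * _); rewrite -(on x Ux).
  have B0 a c : B a a c = 0 by move: (BN a a c); move: (B a a c) => t; lra.
  move=> a b c; rewrite -/(B a b c).
  move: B BN B01 B02 B12 B0 => B BN B01 B02 B12 B0.
  have {B01 B02 B12} [B10 [B20 B21]] : (forall c, B 1 0 c = 0) /\ (forall c, B 2 0 c = 0) /\
    (forall c, B 2 1 c = 2 * s * (0 == c)%:R + q x * (2 == c)%:R) /\
    (forall c, B 0 1 c = 0) /\ (forall c, B 0 2 c = 0) /\
    (forall c, B 1 2 c = - (2 * s) * (0 == c)%:R - q x * (2 == c)%:R).
    do !split => //; move=> d; rewrite BN ?B01 ?B02 ?B12 ?oppr0//; ring.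
  move: B21 => [B21 [B01 [B02 B12]]].
  move: a b; apply: ord3_ind; apply: ord3_ind;
    rewrite ?B0 ?B01 ?B02 ?B12 ?B10 ?B20 ?B21; move: c; apply: ord3_ind;
    rewrite /k /killing_rot /=; ring.
have se' x : U x -> sasaki_equations e (fun=> s) (fun=> s) (fun=> 0) q x.
  by move=> /dq[q0 _]; split=> [//|a||]; rewrite ?act_cst ?q0; ring.
have G x : U x -> 1 - gauss_curvature e (fun=> s) (fun=> s) (fun=> 0) q x = 2 * W - 2.
  move=> Ux; rewrite /gauss_curvature act_cst; have [_] := dq x Ux; move: s1.
  move: (act _ _ _) (q x) => t y; rewrite -[2 * s * s]mulrA => -> H.
  by move: H; clear; lra.
have ee := eta_einstein_of_rot oU gm se on (sc s) (sc s) (sc 0) sq T se' G.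
have sasE := sasakian_of_rot oU gm se on (sc s) (sc s) (sc 0) sq T se'.
split; first exact: gm.
exists (e 0); split => //.
- by exists (2 * W - 2), (2 - (2 * W - 2)).
- by move=> x Ux; exact: (coframe_dual gE db).
- move=> x Ux; have [_ xi1 _ _] := sasE.
  rewrite (scalar_curvature_eta_einstein gm ee Ux (xi1 x Ux)); ring.
Qed.

Definition frame3 (a b c : space -> space) (k : 'I_3) : space -> space :=
  match nat_of_ord k with 0 => a | 1 => b | _ => c end.

Lemma smooth_frame3 (U : set space) a b c : smooth_map U a -> smooth_map U b -> smooth_map U c ->
  forall k, smooth_map U (frame3 a b c k).
Proof. by move=> sa sb sc; apply: ord3_ind. Qed.

Lemma row3_mul (a b c a' b' c' : space -> R) x :
  (row3 a b c x *m (row3 a' b' c' x)^T) 0 0 = a x * a' x + b x * b' x + c x * c' x.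
Proof. by rewrite mxE big_ord3 !mxE. Qed.

Lemma act_row3 (a b c : space -> R) f x :
  act (row3 a b c) f x = a x * partial 0 f x + b x * partial 1 f x + c x * partial 2 f x.
Proof. by rewrite /act big_ord3 !mxE. Qed.

Lemma row3_comp (a b c : space -> R) k : (fun y => row3 a b c y 0 k) =
  match nat_of_ord k with 0 => a | 1 => b | _ => c end.
Proof. by apply/funext => y; rewrite mxE; move: k; apply: ord3_ind. Qed.

Lemma row_dx (a b c : R) x : a *: dx 0 + b *: dx 1 + c *: dx 2 = row3 (fun=> a) (fun=> b) (fun=> c) x.
Proof.
apply/rowP => j; rewrite row_comb3E !mxE /=.
by move: j; apply: ord3_ind; rewrite /= !mulr0 ?mulr1 ?addr0 ?add0r.
Qed.

Lemma zero_model (W : R) : W = 0 ->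
  defines_sasakian_eta_einstein dom_zero (g_zero : space -> 'M[R]_3) alpha_zero (4 * W - 2).
Proof.
move=> W0; pose c (t : R) : space -> R := fun=> t.
have oU : open (dom_zero : set space) by exact: openT.
have sc t : smooth dom_zero (c t) by exact: smooth_cst.
pose v : space -> R := fun x => x 0 2.
have sv (t : R) : smooth dom_zero (fun x => t * v x).
  exact: smoothM oU (sc t) (smooth_coord _ 2).
(* With d/dv placed before the horizontal lift of d/du, the bracket of e1 and e2 is - 2 e0, that is
   s = 1. *)
pose e := frame3 (row3 (c 1) (c 0) (c 0)) (row3 (c 0) (c 0) (c 1))
  (row3 (fun x => - 2 * v x) (c 1) (c 0)).
pose th := frame3 (alpha_zero : space -> space) (row3 (c 0) (c 0) (c 1)) (row3 (c 0) (c 1) (c 0)).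
have aE : (alpha_zero : space -> space) = row3 (c 1) (fun x => 2 * v x) (c 0).
  apply/funext => x; rewrite /alpha_zero -[dx 0]scale1r -[X in X = _]addr0 -(scale0r (dx 2)).
  by rewrite (row_dx _ _ _ x); apply/rowP => j; rewrite !mxE.
have dv (t : R) i x : partial i (fun x => t * v x) x = t * (i == 2)%:R.
  rewrite partialM; [|exact: differentiable_cst|exact: smooth_differentiable (smooth_coord _ 2) (I : dom_zero x)].
  by rewrite partial_cst mul0r add0r /v partial_coord.
apply: (@model_structure _ _ e th 1 W (c 0)) => //.
- by apply: smooth_frame3; exact: smooth_row3.
- by apply: smooth_frame3; rewrite ?aE; exact: smooth_row3.
- move=> x _; rewrite big_ord3 /th /frame3 /=.
  have -> : g_zero x = sq (alpha_zero x) + sq (dx 2) + sq (dx 1) by rewrite /g_zero -/(alpha_zero x) addrAC.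
  congr (_ + sq _ + sq _); apply/rowP => j; rewrite !mxE /=; move: j; exact: ord3_ind.
- move=> x _; apply: ord3_ind; apply: ord3_ind; rewrite /e /th /frame3 /= ?aE row3_mul /c; ring.
- by rewrite mulr1.
- move=> x _; rewrite /e /frame3 /=; split; apply/rowP => k; rewrite !mxE !act_row3;
    move: k; apply: ord3_ind; rewrite !row3_comp /= ?partial_cst ?dv /c /=; ring.
- move=> x _; rewrite act_cst /act /c W0; split => //.
  by rewrite big1 => [|i _]; [rewrite !mulr0 addr0 oppr0|rewrite partial_cst mulr0].
Qed.

(* The two curved models at once: S, C = sin, cos for k = 1 and sinh, cosh for k = -1. *)
Lemma curved_model (U : set space) (W k l : R) (S C : space -> R) :
  open U -> W != 0 -> l != 0 -> k * k = 1 -> l * l = 2 * k * W ->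
  smooth U S -> smooth U C -> (forall x, U x -> S x != 0) ->
  (forall x, U x -> C x * C x + k * (S x * S x) = 1) ->
  (forall x i, U x -> partial i S x = (i == 1)%:R * C x) ->
  (forall x i, U x -> partial i C x = - k * (i == 1)%:R * S x) ->
  defines_sasakian_eta_einstein U
    (fun x => (l * l)^-1 *: (sq (dx 1) + S x ^+ 2 *: sq (dx 2))
              + (W * W)^-1 *: sq (dx 0 + C x *: dx 2))
    (fun x => W^-1 *: (dx 0 + C x *: dx 2)) (4 * W - 2).
Proof.
move=> oU W0 l0 kk ll sS sC S0 CS dS dC.
pose c (t : R) : space -> R := fun=> t.
have sc t : smooth U (c t) by exact: smooth_cst.
have kl : 2 * W = k * (l * l) by rewrite ll -[in LHS](mulr1 2) -kk; ring.
have sV : smooth U (fun x => (S x)^-1) by exact: smoothV.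
pose P x := - l * C x * (S x)^-1; pose Q x := l * (S x)^-1; pose q x := l * C x * (S x)^-1.
have slC (t : R) : smooth U (fun x => t * C x) by exact: smoothM oU (sc t) sC.
have sP : smooth U P by exact: smoothM.
have sQ : smooth U Q by exact: smoothM oU (sc _) sV.
have sq' : smooth U q by exact: smoothM.
have slS : smooth U (fun x => l^-1 * S x) by exact: smoothM oU (sc _) sS.
have dVS x i : U x -> partial i (fun x => (S x)^-1) x = - (S x)^-2 * partial i S x.
  by move=> Ux; apply: partialV (S0 x Ux); exact: smooth_differentiable sS Ux.
(* C / S is cot or coth; for both signs of k its derivative is - 1 / S^2. *)
have dm x i (t : R) : U x -> partial i (fun x => t * C x * (S x)^-1) x =
    - t * (i == 1)%:R * (S x)^-2.
  move=> Ux; have df f : smooth U f -> differentiable f x.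
    by move=> sf; exact: smooth_differentiable sf Ux.
  rewrite partialM; [|exact: df|exact: df].
  rewrite partialM; [|exact: differentiable_cst|exact: df].
  rewrite partial_cst mul0r add0r dC// dVS// dS//.
  have := CS x Ux; have := S0 x Ux; move: (S x) (C x) => a b a0 E.
  transitivity (- t * (i == 1)%:R * (b * b + k * (a * a)) * a ^- 2); first by field.
  by rewrite E mulr1.
have dQ x i : U x -> partial i Q x = - l * (i == 1)%:R * C x * (S x)^-2.
  move=> Ux; have df f : smooth U f -> differentiable f x.
    by move=> sf; exact: smooth_differentiable sf Ux.
  rewrite partialM; [|exact: differentiable_cst|exact: df].
  by rewrite partial_cst dVS// dS//; move: (S x) (C x) => a b; ring.
(* P is determined by Q through al (e2) = 0; with this order of the frame s = -1. *)
pose e := frame3 (row3 (c W) (c 0) (c 0)) (row3 (c 0) (c l) (c 0)) (row3 P (c 0) Q).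
pose th := frame3 (fun x => W^-1 *: (dx 0 + C x *: dx 2))
  (row3 (c 0) (c l^-1) (c 0)) (row3 (c 0) (c 0) (fun x => l^-1 * S x)).
have aE : (fun x => W^-1 *: (dx 0 + C x *: dx 2)) = row3 (c W^-1) (c 0) (fun x => W^-1 * C x).
  apply/funext => x; rewrite scalerDr scalerA -[_ *: dx 0]addr0 -(scale0r (dx 1)).
  by rewrite (row_dx _ _ _ x); apply/rowP => j; rewrite !mxE.
have aEx x : W^-1 *: (dx 0 + C x *: dx 2) = row3 (c W^-1) (c 0) (fun x => W^-1 * C x) x.
  exact: (congr1 (fun f => f x) aE).
apply: (@model_structure _ _ e th (-1) W q) => //.
- by apply: smooth_frame3; exact: smooth_row3.
- by apply: smooth_frame3; rewrite ?aE; exact: smooth_row3.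
- move=> x Ux; rewrite big_ord3 /th /frame3 /=.
  have -> : row3 (c 0) (c l^-1) (c 0) x = l^-1 *: dx 1.
    apply/rowP => j; rewrite !mxE /c; move: j; apply: ord3_ind => /=; ring.
  have -> : row3 (c 0) (c 0) (fun x => l^-1 * S x) x = (l^-1 * S x) *: dx 2.
    apply/rowP => j; rewrite !mxE /c; move: j; apply: ord3_ind => /=; ring.
  rewrite !sqZ; move: (sq _) (sq _) (sq _) => m1 m2 m3.
  apply/matrixP => i j; rewrite !mxE; move: (m1 i j) (m2 i j) (m3 i j) (S x) => *.
  by field; rewrite l0 W0.
- move=> x Ux; have a0 := S0 x Ux.
  apply: ord3_ind; apply: ord3_ind; rewrite /e /th /frame3 /= ?aEx row3_mul /c /P /Q;
    move: (S x) (C x) a0 => a b a0; field; rewrite ?l0 ?W0 ?a0//.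
- by ring.
- move=> x Ux; rewrite /e /frame3 /=; have a0 := S0 x Ux; have E := CS x Ux.
  split; apply/rowP => j; rewrite !mxE !act_row3;
    move: j; apply: ord3_ind; rewrite !row3_comp /= ?partial_cst ?dm ?dQ// /c /=
      ?mulr0 ?mul0r ?addr0 ?subr0 ?add0r ?oppr0//.
  + by rewrite mulr0.
  + by rewrite mulr0.
  + rewrite /q /P; move: (S x) (C x) a0 E => a b a0 E.
    transitivity (l * l * (b * b + k * (a * a)) / a ^+ 2); first by rewrite E; ring.
    have -> : - (2 * -1) * W = k * (l * l) by rewrite -kl; ring.
    by field.
  + rewrite /q /Q; move: (S x) (C x) a0 => a b a0; by field.
- move=> x Ux; have a0 := S0 x Ux; have E := CS x Ux.
  rewrite /e /frame3 /= !act_row3 !dm// /c /= /q; move: (S x) (C x) a0 E => a b a0 E.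
  split; first by ring.
  rewrite kl; transitivity (l * l * (b * b) / a ^+ 2 - l * l * (b * b + k * (a * a)) / a ^+ 2).
    by rewrite E; field.
  by field.
Qed.

End ModelStructure.

(** * The trigonometric and hyperbolic instances *)

Section CurvedModels.
Context {R : realType}.
Notation space := 'rV[R]_3.

Lemma open_dom_neg : open (dom_neg : set space).
Proof.
have -> : (dom_neg : set space) = (fun x : space => x 0 1) @^-1` [set y | 0 < y] by [].
apply: open_comp; last exact: open_gt.
by move=> x _; exact: smooth_continuous (smooth_coord setT 1) (I : setT x).
Qed.

Lemma open_dom_pos : open (dom_pos : set space).
Proof.
have -> : (dom_pos : set space) = dom_neg `&` (fun x : space => x 0 1) @^-1` [set y | y < pi].
  by apply/seteqP; split => x /= => [/andP|] [x1 x2]; rewrite /dom_pos /= ?x1 ?x2.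
apply: openI; first exact: open_dom_neg.
apply: open_comp; last exact: open_lt.
by move=> x _; exact: smooth_continuous (smooth_coord setT 1) (I : setT x).
Qed.

Lemma partial_theta (f : R -> R) (l : R) i (x : space) : is_derive (x 0 1) 1 f l ->
  partial i (fun x : space => f (x 0 1)) x = (i == 1)%:R * l.
Proof.
move=> df; have dx1 : differentiable (fun x : space => x 0 1) x.
  exact: smooth_differentiable (smooth_coord setT 1) (I : setT x).
by rewrite (partial_comp1 _ df dx1) partial_coord mulrC.
Qed.

Lemma pos_model (W : R) : 0 < W ->
  defines_sasakian_eta_einstein (dom_pos : set space) (g_pos W) (alpha_pos W) (4 * W - 2).
Proof.
move=> W0; have Wn : W != 0 by rewrite gt_eqF.
have W2 : 0 < 2 * W by rewrite mulr_gt0.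
pose l := Num.sqrt (2 * W).
have ll : l * l = 2 * 1 * W by rewrite mulr1 -expr2 sqr_sqrtr// ltW.
have l0 : l != 0 by rewrite gt_eqF// sqrtr_gt0.
have [sS sC] := smooth_sin_cos open_dom_pos (smooth_coord dom_pos 1 : smooth dom_pos (fun x : space => x 0 1)).
have -> : alpha_pos W = fun x : space => W^-1 *: (dx 0 + cos (x 0 1) *: dx 2).
  by apply/funext => x; rewrite /alpha_pos div1r.
have -> : g_pos W = fun x : space => (l * l)^-1 *: (sq (dx 1) + sin (x 0 1) ^+ 2 *: sq (dx 2))
    + (W * W)^-1 *: sq (dx 0 + cos (x 0 1) *: dx 2).
  apply/funext => x; rewrite /g_pos ll mulr1 div1r scalerDr scalerA; congr (_ + _ *: _).
  by field.
apply: (@curved_model _ _ W 1 l _ _ open_dom_pos) => //.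
- by rewrite mulr1.
- by move=> x /andP[x0 xp]; rewrite gt_eqF// sin_gt0_pi// x0.
- by move=> x _; rewrite mul1r -!expr2 cos2Dsin2.
- by move=> x i _; rewrite (partial_theta _ (is_derive_sin _)).
- by move=> x i _; rewrite (partial_theta _ (is_derive_cos _)); ring.
Qed.

Lemma sinh_gt0 (t : R) : 0 < t -> 0 < sinh t.
Proof.
by move=> t0; rewrite /sinh divr_gt0// subr_gt0 ltr_expR (lt_trans _ t0)// oppr_lt0.
Qed.

Lemma cosh2_sinh2 (t : R) : cosh t * cosh t - sinh t * sinh t = 1.
Proof.
have := expRxMexpNx_1 t; rewrite /cosh /sinh; move: (expR t) (expR (- t)) => a b E.
by transitivity (a * b); [field|].
Qed.

Lemma neg_model (W : R) : W < 0 ->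
  defines_sasakian_eta_einstein (dom_neg : set space) (g_neg W) (alpha_neg W) (4 * W - 2).
Proof.
move=> W0; have Wn : W != 0 by rewrite lt_eqF.
have W2 : 0 < - (2 * W) by rewrite oppr_gt0 pmulr_rlt0.
pose l := Num.sqrt (- (2 * W)).
have ll : l * l = 2 * -1 * W by rewrite mulrN1 mulNr -expr2 sqr_sqrtr// ltW.
have l0 : l != 0 by rewrite gt_eqF// sqrtr_gt0.
have sx : smooth dom_neg (fun x : space => x 0 1) by exact: smooth_coord.
have oU := open_dom_neg.
have sE : smooth dom_neg (fun x : space => expR (x 0 1)) by exact: smooth_expR.
have sEN : smooth dom_neg (fun x : space => expR (- x 0 1)).
  by apply: smooth_expR => //; exact: smoothN.
have s2 : smooth (dom_neg : set space) (fun=> 2^-1) by exact: smooth_cst.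
have sS : smooth dom_neg (fun x : space => sinh (x 0 1)).
  by apply: smoothM => //; exact: smoothB.
have sC : smooth dom_neg (fun x : space => cosh (x 0 1)).
  by apply: smoothM => //; exact: smoothD.
have -> : alpha_neg W = fun x : space => W^-1 *: (dx 0 + cosh (x 0 1) *: dx 2).
  by apply/funext => x; rewrite /alpha_neg div1r.
have -> : g_neg W = fun x : space => (l * l)^-1 *: (sq (dx 1) + sinh (x 0 1) ^+ 2 *: sq (dx 2))
    + (W * W)^-1 *: sq (dx 0 + cosh (x 0 1) *: dx 2).
  apply/funext => x; rewrite /g_neg ll mulrN1 mulNr div1r scalerBr scalerA invrN -scaleNr.
  by congr (_ + _ *: _); field.
apply: (@curved_model _ _ W (-1) l _ _ open_dom_neg) => //.
- by ring.
- by move=> x x0; rewrite gt_eqF// sinh_gt0.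
- by move=> x _; rewrite mulN1r cosh2_sinh2.
- by move=> x i _; rewrite (partial_theta _ (is_derive_sinh _)).
- by move=> x i _; rewrite (partial_theta _ (is_derive_cosh _)); ring.
Qed.

End CurvedModels.

Theorem mainTheorem6 (R : realType) :
  (forall (M : topologicalType) (A : set (chart R M))
          (g : chart R M -> 'rV[R]_3 -> 'M[R]_3)
          (e0 : chart R M -> 'rV[R]_3 -> 'rV[R]_3),
     smooth_manifold A -> riemannian_metric A g ->
     sasakian A g e0 -> eta_einstein A g e0 ->
     exists2 Rsc : R,
       (forall c x, A c -> chart_im c x -> scalar_curvature (g c) x = Rsc) &
       let W := (Rsc + 2) / 4 in
       [/\ 0 < W -> has_local_form A g e0 dom_pos (g_pos W) (alpha_pos W),
           W = 0 -> has_local_form A g e0 dom_zero g_zero alpha_zero &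
           W < 0 -> has_local_form A g e0 dom_neg (g_neg W) (alpha_neg W)])
  /\
  (forall W : R,
     [/\ 0 < W -> defines_sasakian_eta_einstein dom_pos (g_pos W) (alpha_pos W)
                    (4 * W - 2),
         W = 0 -> defines_sasakian_eta_einstein dom_zero g_zero alpha_zero
                    (4 * W - 2) &
         W < 0 -> defines_sasakian_eta_einstein dom_neg (g_neg W) (alpha_neg W)
                    (4 * W - 2)]).
Proof.
split; first by move=> M A g e0; exact: sasaki_classification.
by move=> W; split; [exact: pos_model|exact: zero_model|exact: neg_model].
Qed.
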